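(* Let $\xi=\{\xi(t),t\in\mathbb{R}\}$ be a real-valued, measurable, mean-square continuous stationary Gaussian process with $E\xi(t)=0$, $E\xi^2(t)=1$ and covariance function $$B(t)=E[\xi(0)\xi(t)]=\sum_{j=0}^{\kappa}D_j\frac{\cos(\varkappa_j t)}{(1+t^2)^{\alpha_j/2}},\quad t\in\mathbb{R},$$ where $\kappa\ge 0$ is an integer, $D_j\ge 0$, $\sum_{j=0}^{\kappa}D_j=1$, $0\le\varkappa_0<\varkappa_1<\dots<\varkappa_\kappa$ and $\alpha_j>0$ for $j=0,\dots,\kappa$. Let $G:\mathbb{R}\to\mathbb{R}$ be a non-random measurable function with $E\,G(\xi(0))=0$ and $E\,G^4(\xi(0))<\infty$, and let $\varepsilon(t)=G(\xi(t))$. Consider the observations $x(t)=g(t,\theta)+\varepsilon(t)$, $t\in[0,T]$, with $$g(t,\theta)=\sum_{k=1}^N\left(A_k\cos\varphi_k t+B_k\sin\varphi_k t\right),\quad \theta=(A_1,B_1,\varphi_1,\dots,A_N,B_N,\varphi_N)\in\mathbb{R}^{3N},$$ where the true parameter $\theta$ satisfies $A_k^2+B_k^2>0$, $k=1,\dots,N$, and $0\le\underline{\varphi}<\varphi_1<\dots<\varphi_N<\overline{\varphi}<\infty$. Then the least-squares estimate in the Walker sense $\hat\theta_T=(\hat A_{1T},\hat B_{1T},\hat\varphi_{1T},\dots,\hat A_{NT},\hat B_{NT},\hat\varphi_{NT})$ of $\theta$ is weakly consistent in the following sense: as $T\to\infty$, $$\hat A_{kT}\overset{P}{\longrightarrow}A_k,\qquad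 \hat B_{kT}\overset{P}{\longrightarrow}B_k,\qquad T(\hat\varphi_{kT}-\varphi_k)\overset{P}{\longrightarrow}0,\qquad k=1,\dots,N,$$ where $\overset{P}{\longrightarrow}$ denotes convergence in probability.
   Context: Least-squares estimate in the Walker sense: let $S(\underline{\varphi},\overline{\varphi})=\{(\varphi_1,\dots,\varphi_N):0\le\underline{\varphi}<\varphi_1<\dots<\varphi_N<\overline{\varphi}<\infty\}$. One fixes a monotone non-decreasing (in $T$) system of open sets $S_T\subset S(\underline{\varphi},\overline{\varphi})$, $T>T_0>0$, such that the true value $(\varphi_1,\dots,\varphi_N)$ of the unknown frequency vector belongs to $S_T$ and $$\lim_{T\to\infty}\ \inf_{1\le j<k\le N,\ \varphi\in S_T}T(\varphi_k-\varphi_j)=+\infty,\qquad \lim_{T\to\infty}\ \inf_{\varphi\in S_T}T\varphi_1=+\infty .$$ The LSE in the Walker sense is any random vector $\hat\theta_T$ with values in the set $\Theta^c$ of all $\tau=(a_1,b_1,\phi_1,\dots,a_N,b_N,\phi_N)$ with $a_k,b_k\in\mathbb{R}$ and $(\phi_1,\dots,\phi_N)\in S_T^c$ (the closure of $S_T$ in $\mathbb{R}^N$) such that $$Q_T(\hat\theta_T)=\inf_{\tau\in\Theta^c}Q_T(\tau),\qquad Q_T(\tau)=\frac1T\int_0^T[x(t)-g(t,\tau)]^2dt .$$ *)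

(* Defs.v *)
From HB Require Import structures.
From mathcomp Require Import all_boot all_order all_algebra.
From mathcomp Require Import all_classical all_reals all_analysis.

Set Implicit Arguments.
Unset Strict Implicit.
Unset Printing Implicit Defensive.

Import Order.TTheory GRing.Theory Num.Theory.
Import numFieldNormedType.Exports.

Local Open Scope classical_set_scope.
Local Open Scope ring_scope.

Section process.
Context (R : realType) (d : measure_display) (Omega : measurableType d).
Variable P : probability Omega R.
Implicit Types xi : R -> Omega -> R.

Definition measurable_process xi :=
  measurable_fun [set: R * Omega] (fun p => xi p.1 p.2).

Definition ms_continuous xi := forall t : R,
  'E_P[(fun w => (xi s w - xi t w) ^+ 2)%R]%E @[s --> t] --> 0%E.

Definition fdd_vector xi n (t : n.-tuple R) (w : Omega) : n.-tuple R :=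
  [tuple xi (tnth t i) w | i < n].

Definition strictly_stationary xi :=
  forall (n : nat) (t : n.-tuple R) (h : R) (A : set (n.-tuple R)),
    measurable A ->
    pushforward P (fdd_vector xi [tuple tnth t i + h | i < n]) A =
    pushforward P (fdd_vector xi t) A.

(* Degenerate laws count as Gaussian. They need a separate case because
   [normal_prob m 0] is the uniform law on [0, 1], not the Dirac mass at m. *)
Definition gaussian_law (mu : set R -> \bar R) :=
  exists m s : R, 0 <= s /\
    forall A : set R, measurable A ->
      mu A = if s == 0 then \d_m A else normal_prob m s A.

Definition gaussian_process xi :=
  forall (n : nat) (t c : n.-tuple R),
    gaussian_law
      (pushforward P (fun w => \sum_(i < n) tnth c i * xi (tnth t i) w)).

Definition cvg_in_probability (X : R -> Omega -> R) (c : R) :=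
  forall e : R, 0 < e ->
    P [set w | e <= `|X T w - c|] @[T --> +oo] --> 0%E.

End process.

Definition covB (R : realType) (kappa : nat) (D kap alpha : 'I_kappa.+1 -> R)
    (t : R) : R :=
  \sum_(j < kappa.+1) D j * (cos (kap j * t) / (1 + t ^+ 2) `^ (alpha j / 2)).

Section regression.
Context (R : realType) (N : nat).

(* A point (a_1, b_1, phi_1, ..., a_N, b_N, phi_N) of R^(3N). *)
Record param := Param {
  amp_cos : 'rV[R]_N;
  amp_sin : 'rV[R]_N;
  freq : 'rV[R]_N }.

Definition trig_sum (t : R) (tau : param) : R :=
  \sum_(k < N) (amp_cos tau 0 k * cos (freq tau 0 k * t) +
                amp_sin tau 0 k * sin (freq tau 0 k * t)).

Definition freq_region (lo hi : R) : set 'rV[R]_N :=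
  [set phi | (forall k, lo < phi 0 k < hi) /\
             (forall j k : 'I_N, (j < k)%N -> phi 0 j < phi 0 k)].

Definition scaled_min_gap (S : set 'rV[R]_N) (T : R) : \bar R :=
  ereal_inf [set y | exists (j k : 'I_N) (phi : 'rV[R]_N),
    [/\ (j < k)%N, S phi & y = (T * (phi 0 k - phi 0 j))%:E]].

Definition scaled_min_coord (k : 'I_N) (S : set 'rV[R]_N) (T : R) : \bar R :=
  ereal_inf [set (T * phi 0 k)%:E | phi in S].

(* Only the values of [S] at T > T0 are constrained. *)
Definition walker_system (hN : (0 < N)%N) (lo hi : R) (phi0 : 'rV[R]_N)
    (T0 : R) (S : R -> set 'rV[R]_N) : Prop :=
  [/\ (forall T, T0 < T -> [/\ open (S T), S T `<=` freq_region lo hi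
                             & S T phi0]),
      (forall T1 T2, T0 < T1 -> T1 <= T2 -> S T1 `<=` S T2),
      scaled_min_gap (S T) T @[T --> +oo] --> +oo%E
    & scaled_min_coord (Ordinal hN) (S T) T @[T --> +oo] --> +oo%E].

Definition param_closure (S : set 'rV[R]_N) : set param :=
  [set tau | closure S (freq tau)].

(* Extended real: the observed path is square integrable on [0, T] almost
   surely, not necessarily surely, and otherwise the criterion is +oo. *)
Definition lsq (x : R -> R) (T : R) (tau : param) : \bar R :=
  ((T^-1)%:E * \int[lebesgue_measure]_(t in `[0%R, T])
                  ((x t - trig_sum t tau) ^+ 2)%:E)%E.

Definition walker_lse (d : measure_display) (Omega : measurableType d)
    (x : R -> Omega -> R) (T : R) (S : set 'rV[R]_N)
    (theta : Omega -> param) : Prop :=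
  [/\ (forall k, measurable_fun [set: Omega] (fun w => amp_cos (theta w) 0 k)),
      (forall k, measurable_fun [set: Omega] (fun w => amp_sin (theta w) 0 k)),
      (forall k, measurable_fun [set: Omega] (fun w => freq (theta w) 0 k)),
      (forall w, param_closure S (theta w))
    & (forall w, lsq (x ^~ w) T (theta w) =
                 ereal_inf (lsq (x ^~ w) T @` param_closure S))].

End regression.

(* Main.v *)
Require Import Defs.
From HB Require Import structures.
From mathcomp Require Import all_boot all_order all_algebra.
From mathcomp Require Import all_classical all_reals all_analysis.
From mathcomp Require Import measurable_realfun ring lra zify.

Set Implicit Arguments.
Unset Strict Implicit.
Unset Printing Implicit Defensive.

Import Order.TTheory GRing.Theory Num.Theory.
Import numFieldNormedType.Exports.

Local Open Scope classical_set_scope.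
Local Open Scope ring_scope.

(** Why the estimator is consistent.

    On a fixed path, least squares is governed by one quantity: the correlation
    over [0, T] of the noise with pure waves cos (l t + psi). Suppose that it is
    at most eta T for all l and psi. Comparing the criterion at the fitted
    parameter with its value at the true one bounds the mean square distance r^2
    of the two trigonometric sums by a multiple of eta times their amplitudes.
    The Walker conditions make the waves of any admissible parameter nearly
    orthogonal, so the amplitudes of the fit are controlled by r and r is small.
    Testing the difference against single waves then pairs each true frequency
    with a fitted one, the pairing preserves the order and is therefore the
    identity, and T times the frequency error must be small since the average
    of exp (i x t / T) over [0, T] has modulus sinc (x / 2). This is
    [lse_identification].

    It remains to see that the correlations of G (xi t) with all waves are o(T)
    in probability, uniformly in the frequency: [negligible_transform]. In L^1 of
    the normal law, G is approximated by trigonometric polynomials ([trig_dense],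
    through Bernstein polynomials of a sine); an error that is small in mean at
    each time is small on [0, T] by the inequalities of Tonelli and Markov
    ([tonelli_markov]). This reduces the problem to centred waves
    f(t) = cos (u xi t + phi) - E cos (u xi t + phi), for which all moments are
    explicit. Cutting [0, T] into unit blocks leads to exponential sums in
    f(s + k), k < n. The modulus of such a sum is bounded, uniformly in its
    frequency, by the autocorrelations of the sequence ([exp_sum_le]), and the
    expectation of their squares is a sum of fourth moments of centred waves,
    which are bounded by covariances ([four_cwaves]). The fourth power of the sum
    is thus o(n^4) in mean, because the covariance function tends to 0 at
    infinity ([expected_energy]). *)

(** * Averages of pure waves *)

Section trig_averages.
Context {R : realType}.
Local Notation mu := (@lebesgue_measure R).

Lemma MVT_lipschitz (f f' : R -> R) (C : R) :
  (forall x : R, is_derive x 1 f (f' x)) -> (forall x : R, `|f' x| <= C) ->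
  forall a b, `|f a - f b| <= C * `|a - b|.
Proof.
move=> df fC a b.
wlog ab : a b / b <= a => [wl|].
  case: (leP b a) => [/wl//|/ltW/wl]; by rewrite distrC (distrC a).
have cf : {within `[b, a], continuous f}.
  apply: continuous_subspaceT => x.
  by apply/differentiable_continuous/derivable1_diffP; case: (df x).
have [c _ ->] := MVT_segment ab (fun x _ => df x) cf.
by rewrite normrM ler_wpM2r.
Qed.

Lemma cos_lipschitz (a b : R) : `|cos a - cos b| <= `|a - b|.
Proof.
rewrite -[leRHS]mul1r; apply: (@MVT_lipschitz cos (fun x => - sin x)) => x.
by rewrite normrN ler_norml sin_le1 sin_geN1.
Qed.

Lemma is_derive_continuous (f : R -> R) (x df : R) :
  is_derive x 1 f df -> {for x, continuous f}.
Proof.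
by move=> [dfx _]; apply/differentiable_continuous/derivable1_diffP.
Qed.

Lemma continuous_cos_affine (l psi : R) :
  continuous (fun t : R => cos (l * t + psi)).
Proof. by move=> t; exact: is_derive_continuous. Qed.

Lemma continuous_integrable_itv (f : R -> R) (a b : R) :
  continuous f -> mu.-integrable `[a, b] (EFin \o f).
Proof.
move=> cf; apply: continuous_compact_integrable; first exact: segment_compact.
exact: continuous_subspaceT.
Qed.

Lemma Rintegral_sum d (U : measurableType d) (m : {measure set U -> \bar R})
    (D : set U) (I : Type) (r : seq I) (f : I -> U -> R) :
    measurable D -> (forall i, m.-integrable D (EFin \o f i)) ->
  m.-integrable D (EFin \o (fun x => \sum_(i <- r) f i x)) /\
  \int[m]_(x in D) (\sum_(i <- r) f i x) = \sum_(i <- r) \int[m]_(x in D) f i x.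
Proof.
move=> mD fi; elim: r => [|i r [IH1 IH2]].
  split.
    rewrite (_ : EFin \o _ = cst 0%E); first exact: integrable0.
    by apply/funext => x /=; rewrite big_nil.
  rewrite big_nil; under eq_Rintegral do rewrite big_nil.
  by rewrite Rintegral_cst// mul0r.
split.
  rewrite (_ : EFin \o _ = (EFin \o f i) \+
      (EFin \o (fun x => (\sum_(j <- r) f j x)%R)))%E; last first.
    by apply/funext => x /=; rewrite big_cons EFinD.
  by apply: integrableD => //; exact: fi.
under eq_Rintegral do rewrite big_cons.
by rewrite RintegralD// big_cons IH2.
Qed.

(** A sine is a cosine of phase - pi / 2, so one kind of wave is enough. *)
Definition wave_avg (T psi l : R) : R :=
  T^-1 * \int[mu]_(t in `[0, T]) cos (l * t + psi).

Lemma Rintegral_itv_cst (T c : R) : 0 < T ->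
  \int[mu]_(t in `[0, T]) c = c * T.
Proof.
move=> T0; rewrite Rintegral_cst//= lebesgue_measure_itv/= lte_fin T0.
by rewrite -EFinD/= subr0.
Qed.

Lemma Rintegral_itv_le (f : R -> R) (T C : R) : 0 < T ->
  mu.-integrable `[0, T] (EFin \o f) -> (forall t, 0 <= t <= T -> `|f t| <= C) ->
  `|\int[mu]_(t in `[0, T]) f t| <= C * T.
Proof.
move=> T0 fi fC; rewrite -Rintegral_itv_cst//.
apply: le_trans (le_normr_Rintegral _ fi) _ => //.
apply: le_Rintegral => //.
- exact: integrable_norm.
- by apply: continuous_integrable_itv; exact: cst_continuous.
Qed.

Lemma norm_wave_avg_le1 (T psi l : R) : 0 < T -> `|wave_avg T psi l| <= 1.
Proof.
move=> T0; rewrite /wave_avg normrM normfV (gtr0_norm T0) mulrC ler_pdivrMr//.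
apply: Rintegral_itv_le => //.
  exact/continuous_integrable_itv/continuous_cos_affine.
by move=> t _; rewrite ler_norml cos_le1 cos_geN1.
Qed.

Lemma wave_avgE (T psi l : R) : 0 < T -> l != 0 ->
  wave_avg T psi l = (sin (l * T + psi) - sin psi) / (l * T).
Proof.
move=> T0 l0.
have dF (x : R) : is_derive x 1 (fun t => l^-1 * sin (l * t + psi)) (cos (l * x + psi)).
  apply: is_derive_eq.
  rewrite addr0 [l%:A]mulr1 [cos _ * l]mulrC.
  by rewrite -[LHS]/(_ * _) mulKf.
have cF : continuous (fun t : R => l^-1 * sin (l * t + psi)).
  move=> x; apply/differentiable_continuous/derivable1_diffP.
  by case: (dF x).
rewrite /wave_avg /Rintegral.
rewrite (@continuous_FTC2 _ _ (fun t => l^-1 * sin (l * t + psi))) //.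
- by rewrite -EFinB/= mulr0 add0r -mulrBr invfM mulrCA mulrA mulrC mulrA.
- exact/continuous_subspaceT/continuous_cos_affine.
- split.
  + by move=> x _; case: (dF x).
  + by apply: cvg_at_right_filter; exact: cF.
  + by apply: cvg_at_left_filter; exact: cF.
- by move=> x _; rewrite derive1E; case: (dF x) => _ ->.
Qed.

Lemma norm_wave_avg_far (T psi l K : R) : 0 < T -> 0 < K -> K <= T * `|l| ->
  `|wave_avg T psi l| <= 2 / K.
Proof.
move=> T0 K0 Kl.
have l0 : 0 < `|l| by rewrite -(pmulr_rgt0 _ T0); exact: lt_le_trans Kl.
rewrite wave_avgE//; last by rewrite -normr_gt0.
rewrite normrM; apply: ler_pM => //.
  apply: le_trans (ler_normB _ _) _.
  have h x : `|sin x : R| <= 1 by rewrite ler_norml sin_le1 sin_geN1.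
  by have := h (l * T + psi); have := h psi; lra.
rewrite normfV lef_pV2 ?posrE ?normrM ?(gtr0_norm T0) 1?mulrC//.
by rewrite mulr_gt0.
Qed.

Lemma norm_wave_avg_near (T psi l : R) : 0 < T ->
  `|wave_avg T psi l - cos psi| <= T * `|l|.
Proof.
move=> T0.
have -> : wave_avg T psi l - cos psi =
    T^-1 * \int[mu]_(t in `[0, T]) (cos (l * t + psi) - cos psi).
  rewrite RintegralB//.
  - by rewrite Rintegral_itv_cst// mulrBr mulrCA mulVf ?mulr1// gt_eqF.
  - exact/continuous_integrable_itv/continuous_cos_affine.
  - by apply: continuous_integrable_itv; exact: cst_continuous.
rewrite normrM normfV (gtr0_norm T0) mulrC ler_pdivrMr//.
apply: Rintegral_itv_le => //.
  apply: continuous_integrable_itv => x.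
  by apply: continuousB; [exact: continuous_cos_affine|exact: cst_continuous].
move=> t /andP[t0 tT]; apply: le_trans (cos_lipschitz _ _) _.
by rewrite addrK normrM mulrC (ger0_norm t0) ler_wpM2r.
Qed.

Lemma wave_avg0 (T psi : R) : 0 < T -> wave_avg T psi 0 = cos psi.
Proof.
move=> T0; apply/eqP; rewrite -subr_eq0 -normr_le0.
by have := norm_wave_avg_near psi 0 T0; rewrite normr0 mulr0.
Qed.

(** sin y <= y cos (y / 2) on [0, pi], by the half-angle formula and
    sin z <= z; this keeps sin y / y away from 1 when y is away from 0. *)
Lemma sinc_lt1 (e : R) : 0 < e ->
  exists2 d : R, 0 < d & forall y : R, e <= `|y| -> (sin y / y) ^+ 2 <= 1 - d.
Proof.
move=> e0.
have sin_le (y : R) : `|sin y| <= `|y|.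
  by rewrite -!cosBpihalf -[leRHS]subr0 -cos_pihalf;
    have := cos_lipschitz (y - pi / 2) (- (pi / 2));
    rewrite cosN cos_pihalf opprK subrK !subr0.
have [f [f0 f1 fe]] : exists f : R, [/\ 0 < f, f <= 1 & f <= e].
  by exists (Num.min e 1); rewrite lt_min e0 ltr01 !ge_min !lexx orbT.
have pi2 := pi_ge2 R.
have cf1 : cos (f / 2) < 1.
  by rewrite -[ltRHS](@cos0 R) ltr_cos ?in_itv//=; try (apply/andP; split); lra.
have cf0 : 0 < cos (f / 2) by apply: cos_gt0_pihalf; lra.
have cf2 : cos (f / 2) ^+ 2 < 1 by rewrite expr_lt1 ?ltW.
exists (Num.min (1 - cos (f / 2) ^+ 2) (1 / 2)).
  by rewrite lt_min subr_gt0 cf2/=; lra.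
move=> y ey.
wlog y0 : y ey / 0 < y => [wl|].
  have [/(wl y ey)//|] := ltP 0 y; rewrite le_eqVlt => /predU1P[y0|y0].
    by move: ey; rewrite y0 normr0 leNgt e0.
  by have := wl (- y); rewrite normrN oppr_gt0 sinN invrN mulrNN; apply.
rewrite (gtr0_norm y0) in ey.
have [y2|y2] := leP y 2.
  rewrite -subr_ge0; apply: (@le_trans _ _ (1 - (1 - cos (f / 2) ^+ 2) - (sin y / y) ^+ 2)); last first.
    by rewrite lerD2r lerD2l lerN2 ge_min lexx.
  rewrite opprB addrCA subrr addr0 subr_ge0.
  have y20 : 0 <= cos (y / 2) by apply: cos_ge0_pihalf; lra.
  have -> : sin y = 2 * sin (y / 2) * cos (y / 2).
    rewrite {1}[y](_ : _ = y / 2 + y / 2); last by lra.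
    by rewrite sinD; ring.
  apply: (@le_trans _ _ (cos (y / 2) ^+ 2)); last first.
    rewrite ler_pXn2r ?nnegrE ?(ltW cf0)//.
    rewrite leNgt; apply/negP.
    by rewrite ltr_cos ?in_itv//=; try (apply/andP; split); lra.
  rewrite mulrAC exprMn ler_piMl ?sqr_ge0//.
  rewrite -[leLHS]real_normK ?num_real// expr_le1// normrM normfV (gtr0_norm y0) ler_pdivrMr// mul1r.
  have := sin_le (y / 2); rewrite (gtr0_norm (_ : 0 < y / 2)); last by lra.
  by rewrite normrM gtr0_norm//; lra.
apply: (@le_trans _ _ (1 / 2)); last first.
  by rewrite lerBrDl -lerBrDr (_ : 1 - 1 / 2 = 1 / 2 :> R)//; [rewrite ge_min lexx orbT|lra].
rewrite expr_div_n ler_pdivrMr ?exprn_gt0//.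
have : sin y ^+ 2 <= 1 by rewrite sin2cos2 gerBl sqr_ge0.
have : 4 < y ^+ 2 by rewrite expr2 (_ : 4 = 2 * 2 :> R); [rewrite ltr_pM//; lra|lra].
by lra.
Qed.

(** The squared modulus of the average of exp(i l t) is sinc^2 (l T / 2),
    which is close to 1 only when T l is close to 0. *)
Lemma wave_avg_unimodular (e : R) : 0 < e ->
  exists2 d : R, 0 < d & forall T l : R, 0 < T ->
    1 - d < wave_avg T 0 l ^+ 2 + wave_avg T (- (pi / 2)) l ^+ 2 -> T * `|l| < e.
Proof.
move=> e0; have [d d0 hd] := sinc_lt1 (divr_gt0 e0 (ltr0n _ 2)).
exists d => // T l T0; apply: contraTT; rewrite -!leNgt => el.
have l0 : l != 0.
  by apply: contraTneq el => ->; rewrite normr0 mulr0 -ltNge.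
rewrite !wave_avgE//; set x := l * T.
have x0 : x != 0 by rewrite mulf_neq0// gt_eqF.
have /hd : e / 2 <= `|x / 2|.
  rewrite normrM normfV normr_nat ler_pM2r ?invr_gt0//.
  by rewrite normrM (gtr0_norm T0) mulrC.
apply: le_trans; rewrite le_eqVlt; apply/orP; left; apply/eqP; clearbody x.
rewrite sin0 subr0 addr0 sinB cos_pihalf sin_pihalf sinN sin_pihalf.
have xE : x = x / 2 + x / 2 by lra.
have -> : sin x = sin (x / 2 + x / 2) by rewrite -xE.
have -> : cos x = cos (x / 2 + x / 2) by rewrite -xE.
rewrite sinD cosD; have := cos2Dsin2 (x / 2).
set c := cos _; set s := sin _ => cs.
have c2 : c ^+ 2 = 1 - s ^+ 2 by rewrite -cs addrK.
rewrite mulr0 mulr1 sub0r opprK [s * c]mulrC -!expr2 c2.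
rewrite !expr_div_n.
rewrite [(c * s + c * s) ^+ 2](_ : _ = 4 * c ^+ 2 * s ^+ 2); last by ring.
by rewrite c2; field.
Qed.

End trig_averages.

(** * Correlation of a trigonometric sum with a wave *)

Lemma ord_homo_id (n : nat) (f : 'I_n -> 'I_n) :
  {homo f : i j / (i < j)%N} -> f =1 id.
Proof.
have le_f (g : 'I_n -> 'I_n) : {homo g : i j / (i < j)%N} ->
    forall i : 'I_n, (i <= g i)%N.
  move=> hg i; case: i => m; elim: m => [//|m IH] mn.
  exact: leq_ltn_trans (IH (ltnW mn)) (hg (Ordinal (ltnW mn)) (Ordinal mn) _).
move=> hf i; apply/val_inj/eqP; rewrite eqn_leq /= le_f// andbT.
have homo_rev : {homo (fun i => rev_ord (f (rev_ord i))) : i j / (i < j)%N}.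
  move=> a b ab /=; have /= := hf (rev_ord b) (rev_ord a).
  have := ltn_ord (f (rev_ord a)); have := ltn_ord b; lia.
have := le_f _ homo_rev (rev_ord i); rewrite /= rev_ordK.
by rewrite leq_sub2lE// ltnS.
Qed.

Section projections.
Context {R : realType} (N : nat).
Local Notation mu := (@lebesgue_measure R).
Implicit Types (tau : param R N) (T K : R).

(** l^1 norm of the amplitudes: the trigonometric sum tau pairs with any wave
    to at most this much. *)
Definition amp_norm tau : R :=
  \sum_(k < N) (`|amp_cos tau 0 k| + `|amp_sin tau 0 k|).

(** The Walker conditions at a given T, with constant K. A frequency far from 0
    is far from the opposite of any other, which also matters because cos is
    even. *)
Definition sep T K (phi : 'rV[R]_N) : Prop :=
  (forall j k : 'I_N, (j < k)%N -> K <= T * (phi 0 k - phi 0 j)) /\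
  (forall k, K <= T * phi 0 k).

Definition proj T tau (m psi : R) : R :=
  T^-1 * \int[mu]_(t in `[0, T]) (trig_sum t tau * cos (m * t + psi)).

Lemma amp_norm_ge0 tau : 0 <= amp_norm tau.
Proof. by apply: sumr_ge0 => k _; rewrite addr_ge0. Qed.

Lemma le_amp_norm tau k :
  `|amp_cos tau 0 k| + `|amp_sin tau 0 k| <= amp_norm tau.
Proof.
rewrite /amp_norm (bigD1 k)//= lerDl; apply: sumr_ge0 => i _.
by rewrite addr_ge0.
Qed.

Lemma continuous_trig_sum tau : continuous (fun t : R => trig_sum t tau).
Proof.
rewrite /trig_sum => t; apply: cvg_big => [|k _]; first exact: add_continuous.
have ck : continuous (fun x : R => amp_cos tau 0 k * cos (freq tau 0 k * x) +
    amp_sin tau 0 k * sin (freq tau 0 k * x)).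
  by move=> x; exact: is_derive_continuous.
exact: ck.
Qed.

Lemma cosM (x y : R) : cos x * cos y = 2^-1 * cos (x - y) + 2^-1 * cos (x + y).
Proof. by rewrite cosB cosD; lra. Qed.

Lemma wave_avg_sum T (I : Type) (r : seq I) (c l p : I -> R) :
  T^-1 * \int[mu]_(t in `[0, T]) (\sum_(i <- r) c i * cos (l i * t + p i)) =
  \sum_(i <- r) c i * wave_avg T (p i) (l i).
Proof.
have int_wave i : mu.-integrable `[0, T]
    (EFin \o (fun t => c i * cos (l i * t + p i))).
  apply: continuous_integrable_itv => t.
  by apply: continuousM; [exact: cst_continuous|exact: continuous_cos_affine].
have [|_ ->] := @Rintegral_sum R _ _ mu `[0, T] I r
  (fun i t => c i * cos (l i * t + p i)) _ int_wave; first by [].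
rewrite mulr_sumr; apply: eq_bigr => i _.
rewrite RintegralZl//; first by rewrite mulrCA.
exact/continuous_integrable_itv/continuous_cos_affine.
Qed.

(** Product-to-sum formulas reduce the correlation to averages of waves whose
    frequencies are the differences and the sums with m. *)
Lemma projE T tau m psi :
  proj T tau m psi = \sum_(k < N)
    (amp_cos tau 0 k / 2 * (wave_avg T (- psi) (freq tau 0 k - m) +
                            wave_avg T psi (freq tau 0 k + m)) +
     amp_sin tau 0 k / 2 *
       (wave_avg T (- (pi / 2) - psi) (freq tau 0 k - m) +
        wave_avg T (psi - pi / 2) (freq tau 0 k + m))).
Proof.
pose waves (k : 'I_N) : seq (R * R * R) :=
  let a := amp_cos tau 0 k / 2 in let b := amp_sin tau 0 k / 2 in
  let f := freq tau 0 k in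
  [:: (a, f - m, - psi); (a, f + m, psi);
      (b, f - m, - (pi / 2) - psi); (b, f + m, psi - pi / 2)].
pose r := flatten [seq waves k | k <- enum 'I_N].
have rE (F : R * R * R -> R) :
    \sum_(p <- r) F p = \sum_(k < N) \sum_(p <- waves k) F p.
  by rewrite big_flatten big_map big_enum.
transitivity (T^-1 * \int[mu]_(t in `[0, T])
    (\sum_(p <- r) p.1.1 * cos (p.1.2 * t + p.2))).
  congr (_ * _); apply: eq_Rintegral => t _.
  rewrite rE /trig_sum mulr_suml; apply: eq_bigr => k _.
  rewrite !big_cons big_nil /= -[sin _]cosBpihalf mulrDl -!mulrA !cosM.
  set f := freq tau 0 k.
  rewrite [f * t - (m * t + psi)](_ : _ = (f - m) * t - psi); last by ring.
  rewrite [f * t + (m * t + psi)](_ : _ = (f + m) * t + psi); last by ring.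
  rewrite [f * t - _ - (m * t + psi)](_ : _ = (f - m) * t + (- (pi / 2) - psi));
    last by ring.
  rewrite [f * t - _ + (m * t + psi)](_ : _ = (f + m) * t + (psi - pi / 2));
    last by ring.
  by ring.
rewrite (wave_avg_sum T r (fun p => p.1.1) (fun p => p.1.2) (fun p => p.2)) rE.
by apply: eq_bigr => k _; rewrite !big_cons big_nil /=; ring.
Qed.

(** Only the frequencies within K / T of m contribute to the pairing with a
    wave of frequency m. *)
Lemma proj_approx T tau m psi K (C : pred 'I_N) : 0 < T -> 0 < K ->
  (forall k, ~~ C k -> K <= T * `|freq tau 0 k - m|) ->
  (forall k, K <= T * `|freq tau 0 k + m|) ->
  `|proj T tau m psi - \sum_(k < N | C k)
     (amp_cos tau 0 k / 2 * wave_avg T (- psi) (freq tau 0 k - m) +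
      amp_sin tau 0 k / 2 * wave_avg T (- (pi / 2) - psi) (freq tau 0 k - m))|
  <= 2 / K * amp_norm tau.
Proof.
move=> T0 K0 far1 far2; rewrite projE [\sum_(k < N | C k) _]big_mkcond/= -sumrB mulr_sumr.
apply: le_trans (ler_norm_sum _ _ _) _; apply: ler_sum => k _.
have w1 p := norm_wave_avg_far p T0 K0 (far2 k).
have K20 : 0 < 2 / K by rewrite divr_gt0.
have bound (a x y B : R) : `|x| <= B -> `|y| <= B ->
    `|a / 2 * (x + y)| <= B * `|a|.
  move=> xB yB; rewrite normrM normrM normfV normr_nat.
  have : `|x + y| <= 2 * B by apply: le_trans (ler_normD _ _) _; lra.
  by move=> /(ler_wpM2l (normr_ge0 a)); lra.
case: ifPn => [Ck|/far1 far].
  set x1 := wave_avg T (- psi) _; set y1 := wave_avg T psi _.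
  set x2 := wave_avg T (- _ - _) _; set y2 := wave_avg T (psi - _) _.
  rewrite [X in `|X|](_ : _ = amp_cos tau 0 k / 2 * (0 + y1) +
    amp_sin tau 0 k / 2 * (0 + y2)); last by ring.
  apply: le_trans (ler_normD _ _) _; rewrite [leRHS]mulrDr.
  by apply: lerD; apply: bound; rewrite ?normr0 ?(ltW K20)//; exact: w1.
have w2 p := norm_wave_avg_far p T0 K0 far.
rewrite subr0; apply: le_trans (ler_normD _ _) _; rewrite [leRHS]mulrDr.
by apply: lerD; exact: bound (w2 _) (w1 _).
Qed.

Lemma norm_proj_le T tau m psi : 0 < T -> `|proj T tau m psi| <= amp_norm tau.
Proof.
move=> T0; rewrite projE.
apply: le_trans (ler_norm_sum _ _ _) _; apply: ler_sum => k _.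
have w p l := norm_wave_avg_le1 p l T0.
have bound (a x y : R) : `|x| <= 1 -> `|y| <= 1 -> `|a / 2 * (x + y)| <= `|a|.
  move=> xB yB; rewrite normrM normrM normfV normr_nat.
  have : `|x + y| <= 2 by apply: le_trans (ler_normD _ _) _; lra.
  by move=> /(ler_wpM2l (normr_ge0 a)); lra.
by apply: le_trans (ler_normD _ _) _; apply: lerD; apply: bound; exact: w.
Qed.

Lemma sep_dist T K phi i k : 0 < T -> sep T K phi -> i != k ->
  K <= T * `|phi 0 i - phi 0 k|.
Proof.
move=> T0 [sepphi _]; rewrite -(inj_eq val_inj) neq_ltn => /orP[ik|ki].
  rewrite distrC; apply: le_trans (sepphi _ _ ik) _.
  by rewrite ler_pM2l// ler_norm.
by apply: le_trans (sepphi _ _ ki) _; rewrite ler_pM2l// ler_norm.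
Qed.

Lemma proj_near T tau m psi K k : 0 < T -> 0 < K ->
  (forall i, i != k -> K <= T * `|freq tau 0 i - m|) ->
  (forall i, K <= T * `|freq tau 0 i + m|) ->
  `|proj T tau m psi -
     (amp_cos tau 0 k / 2 * wave_avg T (- psi) (freq tau 0 k - m) +
      amp_sin tau 0 k / 2 * wave_avg T (- (pi / 2) - psi) (freq tau 0 k - m))|
  <= 2 / K * amp_norm tau.
Proof.
move=> T0 K0 h1 h2.
by have := proj_approx psi T0 K0 (C := pred1 k) h1 h2; rewrite big_pred1_eq.
Qed.

Lemma proj_far T tau m psi K : 0 < T -> 0 < K ->
  (forall i, K <= T * `|freq tau 0 i - m|) ->
  (forall i, K <= T * `|freq tau 0 i + m|) ->
  `|proj T tau m psi| <= 2 / K * amp_norm tau.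
Proof.
move=> T0 K0 h1 h2.
have := proj_approx psi T0 K0 (C := pred0) (fun i _ => h1 i) h2.
by rewrite big_pred0_eq subr0.
Qed.

End projections.

(** * Identification of amplitudes and frequencies *)

Section identification.
Context {R : realType} (N : nat).
Local Notation mu := (@lebesgue_measure R).
Implicit Types (tau theta : param R N) (T K rho : R) (phi : 'rV[R]_N).

(** Single waves are the only test functions that the identification needs; the
    bound is uniform in their frequency because the waves to test with are those
    of the fitted sum. *)
Definition wave_close T rho tau theta : Prop :=
  forall m psi, `|proj T tau m psi - proj T theta m psi| <= rho.

Lemma sep_dist_near T K phi (phi' : R) i k : 0 < T -> sep T K phi -> i != k ->
  T * `|phi' - phi 0 k| < K / 3 -> K / 3 <= T * `|phi 0 i - phi'|.
Proof.
move=> T0 sepphi ik near; have K0 : 0 < K.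
  by have := le_lt_trans (mulr_ge0 (ltW T0) (normr_ge0 _)) near; lra.
have := sep_dist T0 sepphi ik.
have -> : phi 0 i - phi 0 k = phi 0 i - phi' + (phi' - phi 0 k) by ring.
have := ler_normD (phi 0 i - phi') (phi' - phi 0 k).
by move=> /(ler_wpM2l (ltW T0)); rewrite mulrDr; lra.
Qed.

Lemma sep_dist_sum T K phi i (x : R) : 0 < T -> sep T K phi -> 0 <= T * x ->
  K <= T * `|phi 0 i + x|.
Proof.
move=> T0 [_ sepphi] x0; apply: (@le_trans _ _ (T * (phi 0 i + x))).
  by rewrite mulrDr; have := sepphi i; lra.
by rewrite ler_pM2l// ler_norm.
Qed.

(** Pairing tau with its own waves recovers each amplitude up to an error
    amp_norm tau / K; summing over the waves absorbs the error. *)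
Lemma amp_norm_bound T K rho tau theta :
  0 < T -> 0 < K -> 16 * N%:R <= K -> sep T K (freq tau) ->
  wave_close T rho tau theta ->
  amp_norm tau <= 8 * N%:R * (rho + amp_norm theta).
Proof.
move=> T0 K0 NK septau close.
pose M := rho + amp_norm theta + 2 / K * amp_norm tau.
have bound k : `|amp_cos tau 0 k| + `|amp_sin tau 0 k| <= 4 * M.
  have proj_le psi : `|proj T tau (freq tau 0 k) psi| <= rho + amp_norm theta.
    rewrite -[X in `|X|](subrK (proj T theta (freq tau 0 k) psi)).
    by apply: le_trans (ler_normD _ _) _; apply: lerD; [exact: close|exact: norm_proj_le].
  have near psi : `|amp_cos tau 0 k / 2 * wave_avg T (- psi) 0 +
      amp_sin tau 0 k / 2 * wave_avg T (- (pi / 2) - psi) 0| <= M.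
    have := @proj_near R N T tau (freq tau 0 k) psi K k T0 K0.
    rewrite subrr => /(_ _ _)/wrap[].
    - by move=> i ik; exact: sep_dist.
    - move=> i; apply: sep_dist_sum => //.
      by apply: le_trans (ltW K0) _; case: septau.
    - set X := _ + amp_sin _ _ _ / _ * _ => near.
      rewrite -[X](subrK (proj T tau (freq tau 0 k) psi)) /M addrC.
      apply: le_trans (ler_normD _ _) _; apply: lerD; first exact: proj_le.
      by rewrite distrC.
  have := near 0; have := near (- (pi / 2)).
  rewrite !(wave_avg0 _ T0) !opprK !oppr0 !addr0 addNr cos0 cosN cos_pihalf.
  rewrite !mulr0 !addr0 !add0r !mulr1 !normrM normfV normr_nat; lra.
have : amp_norm tau <= \sum_(k < N) 4 * M by apply: ler_sum => k _; exact: bound.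
rewrite sumr_const card_ord -mulr_natr /M.
have : 2 / K * amp_norm tau * (4 * N%:R) <= amp_norm tau / 2.
  rewrite mulrAC -mulrA -[leRHS]mul1r; have := amp_norm_ge0 tau.
  move=> /(ler_wpM2r)h.
  have -> : amp_norm tau / 2 = 2^-1 * amp_norm tau by rewrite mulrC.
  rewrite mul1r [2 / K * _](_ : _ = (2 / K * (4 * N%:R)) * amp_norm tau); last by ring.
  apply: h; rewrite mulrAC ler_pdivrMr//; lra.
by lra.
Qed.

(** A rotation and its inverse, both shrunk by the modulus of c + i s: going
    back and forth multiplies (A, B) by c^2 + s^2, up to the errors. *)
Lemma amp_identity (a b A B c s e1 e2 e3 e4 : R) :
  e1 = a * c + b * s - A -> e2 = b * c - a * s - B ->
  e3 = A * c - B * s - a -> e4 = B * c + A * s - b ->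
  A * (1 - (c ^+ 2 + s ^+ 2)) = - (e1 + e3 * c + e4 * s) /\
  B * (1 - (c ^+ 2 + s ^+ 2)) = - (e2 + e4 * c - e3 * s).
Proof. by move=> -> -> -> ->; split; ring. Qed.

Lemma amp_lower_bound theta :
  (forall k, 0 < amp_cos theta 0 k ^+ 2 + amp_sin theta 0 k ^+ 2) ->
  exists2 kappa : R, 0 < kappa &
    forall k, kappa <= `|amp_cos theta 0 k| + `|amp_sin theta 0 k|.
Proof.
move=> amp0.
pose w k : R := `|amp_cos theta 0 k| + `|amp_sin theta 0 k|.
have w0 k : 0 < w k.
  rewrite lt_neqAle addr_ge0// andbT eq_sym paddr_eq0// !normr_eq0.
  apply/negP => /andP[/eqP a0 /eqP b0].
  by have := amp0 k; rewrite a0 b0 !expr0n/= addr0 ltxx.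
exists (1 + \sum_k (w k)^-1)^-1.
  rewrite invr_gt0 ltr_pwDl// sumr_ge0// => k _.
  by rewrite invr_ge0 ltW.
move=> k; rewrite -[leRHS]invrK lef_pV2 ?posrE ?invr_gt0//; last first.
  exact: w0.
  by rewrite ltr_pwDl// sumr_ge0// => i _; rewrite invr_ge0 ltW.
rewrite (bigD1 k)//= addrCA lerDl addr_ge0// sumr_ge0// => i _.
by rewrite invr_ge0 ltW.
Qed.

(** Matching of the frequencies: a wave of theta is seen by tau only if some
    frequency of tau lies within K / (3 T) of it, and since both lists of
    frequencies are increasing and K / T-separated the match is the identity. *)
Lemma freq_match T K rho E tau theta :
  0 < T -> 0 < K -> sep T K (freq tau) -> sep T K (freq theta) ->
  wave_close T rho tau theta ->
  2 * (rho + 6 / K * amp_norm tau + 2 / K * amp_norm theta) <= E ->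
  (forall k, 2 * E < `|amp_cos theta 0 k| + `|amp_sin theta 0 k|) ->
  forall k, T * `|freq tau 0 k - freq theta 0 k| < K / 3.
Proof.
move=> T0 K0 septau septh close leE largeE.
have K30 : 0 < K / 3 by rewrite divr_gt0.
have seppos phi : sep T K phi -> forall i, 0 <= T * phi 0 i.
  by case=> _ pos i; exact: le_trans (ltW K0) (pos i).
have ex_near k : exists i, T * `|freq tau 0 i - freq theta 0 k| < K / 3.
  apply: contrapT => /forallNP far.
  have {}far i : K / 3 <= T * `|freq tau 0 i - freq theta 0 k|.
    by rewrite leNgt; apply/negP; exact: far.
  have sum_far i : K / 3 <= T * `|freq tau 0 i + freq theta 0 k|.
    apply: (le_trans _ (sep_dist_sum _ T0 septau (seppos _ septh k))); lra.
  have bound psi : `|amp_cos theta 0 k * wave_avg T (- psi) 0 +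
      amp_sin theta 0 k * wave_avg T (- (pi / 2) - psi) 0| <= E.
    have h1 := proj_far psi T0 K30 far sum_far.
    have h2 := @proj_near R N T theta (freq theta 0 k) psi K k T0 K0
      (fun i => sep_dist T0 septh)
      (fun i => sep_dist_sum i T0 septh (seppos _ septh k)).
    have h3 := close (freq theta 0 k) psi.
    rewrite subrr in h2.
    move: h1 h2 h3 leE.
    have -> : 2 / (K / 3) = 6 / K by field; rewrite gt_eqF.
    set p1 := proj _ _ _ _; set p2 := proj _ _ _ _.
    set x := wave_avg _ _ _; set y := wave_avg _ _ _.
    set a := amp_cos _ _ _; set b := amp_sin _ _ _.
    rewrite !ler_norml; lra.
  have := bound 0; have := bound (- (pi / 2)); have := largeE k.
  rewrite !(wave_avg0 _ T0) !opprK !oppr0 !addr0 addNr cos0 cosN cos_pihalf.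
  rewrite !mulr0 !addr0 !add0r !mulr1; lra.
have [f near_f] := choice ex_near.
suff f_id : f =1 id by move=> k; have := near_f k; rewrite f_id.
apply: ord_homo_id => i j ij.
have dij : K <= T * (freq theta 0 j - freq theta 0 i) by case: septh => h _; exact: h.
have lt_freq : T * freq tau 0 (f i) < T * freq tau 0 (f j).
  have := near_f i; have := near_f j.
  rewrite -(gtr0_norm T0) -!normrM !ltr_norml (gtr0_norm T0) !mulrBr.
  by move: dij; rewrite mulrBr; lra.
rewrite ltnNge leq_eqVlt; apply/negP => /orP[/eqP/val_inj fij|fji].
  by move: lt_freq; rewrite fij ltxx.
have := (septau.1 _ _ fji); rewrite mulrBr; lra.
Qed.

(** Near the diagonal the two pairings, of tau with a wave of theta and of
    theta with a wave of tau, rotate and shrink the amplitudes by the same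
    factor c + i s; composing them gives c^2 + s^2 close to 1. *)
Lemma identify_wave T K rho E tau theta k :
  0 < T -> 0 < K -> sep T K (freq tau) -> sep T K (freq theta) ->
  wave_close T rho tau theta ->
  2 * (rho + 6 / K * amp_norm tau + 6 / K * amp_norm theta) <= E ->
  T * `|freq tau 0 k - freq theta 0 k| < K / 3 ->
  let c := wave_avg T 0 (freq tau 0 k - freq theta 0 k) in
  let s := wave_avg T (- (pi / 2)) (freq tau 0 k - freq theta 0 k) in
  let a := amp_cos tau 0 k in let b := amp_sin tau 0 k in
  let A := amp_cos theta 0 k in let B := amp_sin theta 0 k in
  [/\ `|a * c + b * s - A| <= E, `|b * c - a * s - B| <= E,
      `|A * c - B * s - a| <= E & `|B * c + A * s - b| <= E].
Proof.
move=> T0 K0 septau septh close leE near c s a b A B.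
have K30 : 0 < K / 3 by rewrite divr_gt0.
have seppos phi : sep T K phi -> forall i, 0 <= T * phi 0 i.
  by case=> _ pos i; exact: le_trans (ltW K0) (pos i).
have K3E : 2 / (K / 3) = 6 / K by field; rewrite gt_eqF.
have avgN psi l : wave_avg T (- psi) (- l) = wave_avg T psi l.
  congr (_ * _); apply: eq_Rintegral => t _.
  by rewrite mulNr -opprD cosN.
have avg_pi l : wave_avg T (pi / 2) l = - wave_avg T (- (pi / 2)) l.
  rewrite /wave_avg -mulrN; congr (_ * _).
  rewrite -mulN1r -RintegralZl//; last first.
    exact/continuous_integrable_itv/continuous_cos_affine.
  by apply: eq_Rintegral => t _; rewrite mulN1r cosBpihalf cosDpihalf.
have far_sum (phi phi' : 'rV[R]_N) i : sep T K phi -> sep T K phi' ->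
    K / 3 <= T * `|phi 0 i + phi' 0 k|.
  move=> h h'; apply: (le_trans _ (sep_dist_sum _ T0 h (seppos _ h' k))); lra.
have pair (tau1 tau2 : param R N) psi :
    T * `|freq tau2 0 k - freq tau1 0 k| < K / 3 ->
    sep T K (freq tau1) -> sep T K (freq tau2) ->
    `|proj T tau1 (freq tau2 0 k) psi -
     (amp_cos tau1 0 k / 2 * wave_avg T (- psi) (freq tau1 0 k - freq tau2 0 k) +
      amp_sin tau1 0 k / 2 *
        wave_avg T (- (pi / 2) - psi) (freq tau1 0 k - freq tau2 0 k))|
    <= 6 / K * amp_norm tau1.
  move=> near12 h1 h2; rewrite -K3E; apply: proj_near => // i.
  - by move=> ik; exact: sep_dist_near near12.
  - exact: far_sum.
have near' : T * `|freq theta 0 k - freq tau 0 k| < K / 3 by rewrite distrC.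
have self (tau1 : param R N) : T * `|freq tau1 0 k - freq tau1 0 k| < K / 3.
  by rewrite subrr normr0 mulr0.
have cE psi : wave_avg T psi (freq theta 0 k - freq tau 0 k) =
    wave_avg T (- psi) (freq tau 0 k - freq theta 0 k).
  by rewrite -avgN opprB.
have main psi :
    `|a * wave_avg T (- psi) (freq tau 0 k - freq theta 0 k) +
      b * wave_avg T (- (pi / 2) - psi) (freq tau 0 k - freq theta 0 k) -
      (A * cos psi - B * sin psi)| <= E /\
    `|A * wave_avg T psi (freq tau 0 k - freq theta 0 k) +
      B * wave_avg T (pi / 2 + psi) (freq tau 0 k - freq theta 0 k) -
      (a * cos psi - b * sin psi)| <= E.
  have sinE : cos (- (pi / 2) - psi) = - sin psi.
    by rewrite -opprD cosN addrC cosDpihalf.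
  have h1 := pair _ _ psi near' septau septh.
  have h2 := pair _ _ psi (self theta) septh septh.
  have h3 := pair _ _ psi near septh septau.
  have h4 := pair _ _ psi (self tau) septau septau.
  have h5 := close (freq theta 0 k) psi.
  have h6 := close (freq tau 0 k) psi.
  rewrite !subrr !(wave_avg0 _ T0) sinE !cosN in h2 h4.
  rewrite !cE !opprB !opprK in h3.
  move: leE h1 h2 h3 h4 h5 h6; rewrite -/a -/b -/A -/B.
  rewrite [pi / 2 + psi]addrC.
  set w1 := wave_avg _ _ _; set w2 := wave_avg _ _ _.
  set w3 := wave_avg _ _ _; set w4 := wave_avg _ _ _.
  move: (amp_norm tau) (amp_norm theta) => n1 n2.
  move: (6 / K * n1) (6 / K * n2) => m1 m2.
  rewrite !ler_norml; split; lra.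
have [m1 m2] := main 0; have [m3 m4] := main (- (pi / 2)).
move: m1 m2 m3 m4; rewrite !oppr0 !opprK !addr0 addNr addrN !avg_pi cos0 sin0.
rewrite sinN sin_pihalf cosN cos_pihalf -/c -/s.
by rewrite !ler_norml; split; lra.
Qed.

End identification.

(** * Least squares on a fixed path *)

Section least_squares.
Context {R : realType} (N : nat).
Local Notation mu := (@lebesgue_measure R).
Implicit Types (tau theta : param R N) (T K eta rho e : R) (eps : R -> R).

Lemma integrable_wave_mul T l psi eps : mu.-integrable `[0, T] (EFin \o eps) ->
  mu.-integrable `[0, T] (EFin \o (fun t => cos (l * t + psi) * eps t)).
Proof.
move=> ieps; apply: (le_integrable _ _ _ ieps) => //.
- apply/measurable_EFinP/measurable_funM.
    apply: measurable_funTS; apply: continuous_measurable_fun.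
    exact: continuous_cos_affine.
  by case/integrableP : ieps => /measurable_EFinP.
- move=> t _; rewrite /= lee_fin normrM ler_piMl//.
  by rewrite ler_norml cos_le1 cos_geN1.
Qed.

Lemma pair_trig_sum T tau eps eta : mu.-integrable `[0, T] (EFin \o eps) ->
  (forall l psi, `|\int[mu]_(t in `[0, T]) (cos (l * t + psi) * eps t)| <= eta) ->
  mu.-integrable `[0, T] (EFin \o (fun t => trig_sum t tau * eps t)) /\
  `|\int[mu]_(t in `[0, T]) (trig_sum t tau * eps t)| <= amp_norm tau * eta.
Proof.
move=> ieps heta.
pose f (p : R * R * R) t := p.1.1 * (cos (p.1.2 * t + p.2) * eps t).
pose waves (k : 'I_N) : seq (R * R * R) := [:: (amp_cos tau 0 k, freq tau 0 k, 0);
                             (amp_sin tau 0 k, freq tau 0 k, - (pi / 2))].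
pose r := flatten [seq waves k | k <- enum 'I_N].
have rE (F : R * R * R -> R) :
    \sum_(p <- r) F p = \sum_(k < N) \sum_(p <- waves k) F p.
  by rewrite big_flatten big_map big_enum.
have int_f p : mu.-integrable `[0, T] (EFin \o f p).
  rewrite (_ : EFin \o _ = fun t => (p.1.1%:E * (cos (p.1.2 * t + p.2) * eps t)%:E)%E).
    by apply: integrableZl => //; exact: integrable_wave_mul.
  by apply/funext => t; rewrite /= -EFinM.
have fE : (fun t => trig_sum t tau * eps t) = fun t => \sum_(p <- r) f p t.
  apply/funext => t; rewrite rE /trig_sum mulr_suml; apply: eq_bigr => k _.
  by rewrite !big_cons big_nil /f /= -[sin _]cosBpihalf !addr0; ring.
rewrite fE; have [|-> ->] := @Rintegral_sum R _ _ mu `[0, T] _ r f _ int_f => //.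
split=> //; rewrite rE /amp_norm mulr_suml.
apply: le_trans (ler_norm_sum _ _ _) _; apply: ler_sum => k _.
rewrite !big_cons big_nil addr0; apply: le_trans (ler_normD _ _) _.
by rewrite [leRHS]mulrDl; apply: lerD; rewrite /f RintegralZl ?normrM ?ler_wpM2l//;
  exact: integrable_wave_mul.
Qed.

(** Expanding the square turns the least-squares inequality into a bound of the
    energy of the difference of the two sums by twice its correlation with the
    noise. *)
Lemma lse_energy T theta tau eps eta : 0 < T ->
  mu.-integrable `[0, T] (EFin \o eps) ->
  mu.-integrable `[0, T] (EFin \o (fun t => eps t ^+ 2)) ->
  (forall l psi,
     `|\int[mu]_(t in `[0, T]) (cos (l * t + psi) * eps t)| <= eta * T) ->
  \int[mu]_(t in `[0, T]) (trig_sum t theta + eps t - trig_sum t tau) ^+ 2 <=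
    \int[mu]_(t in `[0, T]) eps t ^+ 2 ->
  T^-1 * \int[mu]_(t in `[0, T]) (trig_sum t tau - trig_sum t theta) ^+ 2 <=
    2 * ((amp_norm tau + amp_norm theta) * eta).
Proof.
move=> T0 ieps ieps2 heta.
pose D t := trig_sum t tau - trig_sum t theta.
have cD : continuous D by move=> t; apply: continuousB; exact: continuous_trig_sum.
have iD2 : mu.-integrable `[0, T] (EFin \o (fun t => D t ^+ 2)).
  by apply: continuous_integrable_itv => t; exact: continuousM (cD t) (cD t).
have [i1 b1] := pair_trig_sum tau ieps heta.
have [i2 b2] := pair_trig_sum theta ieps heta.
have DepsE : (fun t => D t * eps t) =
    fun t => trig_sum t tau * eps t - trig_sum t theta * eps t.
  by apply/funext => t; rewrite mulrBl.
have iDe : mu.-integrable `[0, T] (EFin \o (fun t => D t * eps t)).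
  rewrite DepsE (_ : EFin \o _ = (EFin \o (fun t => trig_sum t tau * eps t)%R) \-
    (EFin \o (fun t => trig_sum t theta * eps t)%R))%E; first exact: integrableB.
  by apply/funext => t; rewrite /= EFinB.
have bDe : `|\int[mu]_(t in `[0, T]) (D t * eps t)| <=
    (amp_norm tau + amp_norm theta) * (eta * T).
  by rewrite DepsE RintegralB// mulrDl (le_trans (ler_normB _ _))// lerD.
have iDe2 : mu.-integrable `[0, T] (EFin \o (fun t => 2 * (D t * eps t))).
  rewrite (_ : EFin \o _ = fun t => (2%:E * (D t * eps t)%:E)%E).
    exact: integrableZl.
  by apply/funext => t; rewrite /= -EFinM.
have -> : \int[mu]_(t in `[0, T]) (trig_sum t theta + eps t - trig_sum t tau) ^+ 2 =
    \int[mu]_(t in `[0, T]) (D t ^+ 2 + eps t ^+ 2) -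
    2 * \int[mu]_(t in `[0, T]) (D t * eps t).
  rewrite -RintegralZl// -RintegralB//.
    by apply: eq_Rintegral => t _; rewrite /D; ring.
  rewrite (_ : EFin \o _ = (EFin \o (fun t => D t ^+ 2)%R) \+
    (EFin \o (fun t => eps t ^+ 2)%R))%E; first exact: integrableD.
  by apply/funext => t; rewrite /= EFinD.
rewrite RintegralD// -/D [T^-1 * _]mulrC ler_pdivrMr//.
by move: bDe; rewrite ler_norml; lra.
Qed.

(** A small mean square difference cannot be detected by a single wave, by
    |D c| <= (D^2 / rho + rho) / 2 for |c| <= 1. *)
Lemma wave_close_energy T theta tau rho : 0 < T -> 0 < rho ->
  T^-1 * \int[mu]_(t in `[0, T]) (trig_sum t tau - trig_sum t theta) ^+ 2 <=
    rho ^+ 2 ->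
  wave_close T rho tau theta.
Proof.
move=> T0 rho0 energy m psi.
pose D t := trig_sum t tau - trig_sum t theta.
have cD : continuous D by move=> t; apply: continuousB; exact: continuous_trig_sum.
have cc := @continuous_cos_affine R m psi.
have -> : proj T tau m psi - proj T theta m psi =
    T^-1 * \int[mu]_(t in `[0, T]) (D t * cos (m * t + psi)).
  rewrite /proj -mulrBr -RintegralB//.
  - by congr (_ * _); apply: eq_Rintegral => t _; rewrite mulrBl.
  - apply: continuous_integrable_itv => t.
    by apply: continuousM; [exact: continuous_trig_sum|exact: cc].
  - apply: continuous_integrable_itv => t.
    by apply: continuousM; [exact: continuous_trig_sum|exact: cc].
rewrite normrM normfV (gtr0_norm T0) mulrC ler_pdivrMr//.
have iDc : mu.-integrable `[0, T] (EFin \o (fun t => D t * cos (m * t + psi))).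
  by apply: continuous_integrable_itv => t; apply: continuousM; [exact: cD|exact: cc].
apply: le_trans (le_normr_Rintegral _ iDc) _ => //.
have cD2 : continuous (fun t : R => D t ^+ 2 : R).
  by move=> t; exact: continuousM (cD t) (cD t).
have c2 : continuous (fun t : R => (2 * rho)^-1 * D t ^+ 2 : R).
  by move=> t; exact: (continuousM (@cst_continuous _ _ _ t) (cD2 t)).
apply: (@le_trans _ _ (\int[mu]_(t in `[0, T]) ((2 * rho)^-1 * D t ^+ 2 + rho / 2))).
  apply: le_Rintegral => //.
  - exact: integrable_norm.
  - apply: continuous_integrable_itv => t.
    exact: (continuousD (c2 t) (@cst_continuous _ _ _ t)).
  - move=> t _; rewrite normrM; apply: (@le_trans _ _ `|D t|).
      by rewrite ler_piMr// ler_norml cos_le1 cos_geN1.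
    rewrite -[D t ^+ 2]real_normK ?num_real//.
    move: `|D t| => x; rewrite -subr_ge0.
    have -> : (2 * rho)^-1 * x ^+ 2 + rho / 2 - x = (2 * rho)^-1 * (x - rho) ^+ 2.
      by field; rewrite gt_eqF.
    by rewrite mulr_ge0 ?sqr_ge0// invr_ge0 mulr_ge0// ltW.
rewrite RintegralD//; last 2 first.
- exact: continuous_integrable_itv.
- by apply: continuous_integrable_itv; exact: cst_continuous.
rewrite Rintegral_itv_cst// RintegralZl//; last first.
  exact: continuous_integrable_itv.
move: energy; rewrite mulrC ler_pdivrMr// -/D.
have r20 : 0 <= (2 * rho)^-1 by rewrite invr_ge0 mulr_ge0// ltW.
move=> /(ler_wpM2l r20).
have -> : (2 * rho)^-1 * (rho ^+ 2 * T) = rho / 2 * T by field; rewrite gt_eqF.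
lra.
Qed.

(** The mean square distance r^2 of the fitted sum to the true one satisfies
    r^2 <= C (1 + r) eta, because the amplitudes of the fit are themselves
    controlled by r; hence r is small when the noise correlations eta are. *)
Lemma lse_wave_close theta rho : 0 < rho ->
  exists2 eta : R, 0 < eta & forall T K tau eps,
    0 < T -> 0 < K -> 16 * N%:R <= K -> sep T K (freq tau) ->
    mu.-integrable `[0, T] (EFin \o eps) ->
    mu.-integrable `[0, T] (EFin \o (fun t => eps t ^+ 2)) ->
    (forall l psi,
       `|\int[mu]_(t in `[0, T]) (cos (l * t + psi) * eps t)| <= eta * T) ->
    \int[mu]_(t in `[0, T]) (trig_sum t theta + eps t - trig_sum t tau) ^+ 2 <=
      \int[mu]_(t in `[0, T]) eps t ^+ 2 ->
    wave_close T rho tau theta.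
Proof.
move=> rho0; have t0 := amp_norm_ge0 theta.
pose n : R := N%:R.
have n0 : 0 <= n by rewrite ler0n.
(* C r bounds both amplitude norms together once the distance r exceeds rho *)
pose C := 1 + 8 * n + (8 * n + 1) * amp_norm theta / rho.
have C0 : 0 < C.
  rewrite /C; apply: ltr_wpDr; first by rewrite divr_ge0 ?mulr_ge0 ?(ltW rho0)//; lra.
  by lra.
exists (rho / (4 * C)); first by rewrite divr_gt0// mulr_gt0.
move=> T K tau eps T0 K0 NK septau ieps ieps2 heta lse.
have energy := lse_energy T0 ieps ieps2 heta lse.
set q := T^-1 * _ in energy.
have [q_le|lt_q] := leP q (rho ^+ 2); first exact: wave_close_energy.
pose r := Num.sqrt q.
have rq : r ^+ 2 = q by rewrite sqr_sqrtr// (le_trans _ (ltW lt_q))// sqr_ge0.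
have r0 : 0 <= r by rewrite sqrtr_ge0.
have rho_r : rho < r.
  by rewrite -(ltr_pXn2r (ltn0Sn 1)) ?nnegrE ?(ltW rho0)// rq.
have close : wave_close T r tau theta.
  by apply: wave_close_energy => //; [exact: lt_trans rho_r|rewrite rq].
have tau_le := amp_norm_bound T0 K0 NK septau close.
have th_le : amp_norm theta <= amp_norm theta / rho * r.
  by rewrite mulrAC -mulrA ler_peMr// ler_pdivlMr// mul1r ltW.
have sum_le : amp_norm tau + amp_norm theta <= C * r.
  rewrite /C; move: tau_le; rewrite -/n => tau_le.
  have := ler_wpM2l n0 th_le; move: th_le.
  set x := amp_norm theta / rho * r => th_le nth_le.
  have -> : (1 + 8 * n + (8 * n + 1) * amp_norm theta / rho) * r =
    r + 8 * (n * r) + 8 * (n * x) + x by rewrite /x; ring.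
  lra.
have : r ^+ 2 <= rho / 2 * r.
  rewrite rq; apply: le_trans energy _.
  have := ler_wpM2r (ltW (divr_gt0 rho0 (mulr_gt0 (ltr0n R 4) C0))) sum_le.
  have -> : C * r * (rho / (4 * C)) = rho * r / 4 by field; rewrite gt_eqF.
  by lra.
rewrite expr2 ler_pM2r; last exact: lt_trans rho_r.
by move: rho_r rho0; lra.
Qed.

(** The deterministic core. The fit is close to the truth when tested on waves,
    so the frequencies match; then c^2 + s^2 is close to 1, where c and s are the
    averages of the cosine and sine waves of the frequency error, which forces T
    times that error to be small, and finally the amplitudes agree. *)
Theorem lse_identification theta e :
  (forall k, 0 < amp_cos theta 0 k ^+ 2 + amp_sin theta 0 k ^+ 2) -> 0 < e ->
  exists eta K : R, [/\ 0 < eta, 0 < K & forall T tau eps,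
    0 < T -> sep T K (freq tau) -> sep T K (freq theta) ->
    mu.-integrable `[0, T] (EFin \o eps) ->
    mu.-integrable `[0, T] (EFin \o (fun t => eps t ^+ 2)) ->
    (forall l psi,
       `|\int[mu]_(t in `[0, T]) (cos (l * t + psi) * eps t)| <= eta * T) ->
    \int[mu]_(t in `[0, T]) (trig_sum t theta + eps t - trig_sum t tau) ^+ 2 <=
      \int[mu]_(t in `[0, T]) eps t ^+ 2 ->
    forall k, [/\ `|amp_cos tau 0 k - amp_cos theta 0 k| < e,
                  `|amp_sin tau 0 k - amp_sin theta 0 k| < e &
                  `|T * (freq tau 0 k - freq theta 0 k)| < e]].
Proof.
move=> amp0 e0.
have [kappa kappa0 kappaP] := amp_lower_bound amp0.
have th0 := amp_norm_ge0 theta; set M := amp_norm theta in th0.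
(* x is the tolerance on T times the frequency error: it costs M x on the
   amplitudes *)
pose x := Num.min e (e / (4 * (M + 1))).
have x0 : 0 < x by rewrite lt_min e0 divr_gt0// mulr_gt0//; lra.
have xe : x <= e by rewrite ge_min lexx.
have xM : M * x <= e / 4.
  have : x <= e / (4 * (M + 1)) by rewrite ge_min lexx orbT.
  rewrite ler_pdivlMr; last by rewrite mulr_gt0//; lra.
  by have := ltW x0; lra.
have [d d0 dP] := wave_avg_unimodular x0.
(* E is the error allowed on the rotated amplitudes: below kappa / 4 the waves
   of theta are seen by tau, below kappa d / 8 the modulus c^2 + s^2 exceeds
   1 - d *)
pose E := Num.min (e / 4) (Num.min (kappa / 4) (kappa * d / 8)).
have E0 : 0 < E by rewrite !lt_min !divr_gt0// mulr_gt0.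
have Ee : E <= e / 4 by rewrite ge_min lexx.
have Ekappa : E <= kappa / 4 by rewrite !ge_min lexx !orbT.
have Ed : E <= kappa * d / 8 by rewrite !ge_min lexx !orbT.
have E80 : 0 < E / 8 by rewrite divr_gt0.
have [eta eta0 closeP] := lse_wave_close theta E80.
pose n : R := N%:R; have n0 : 0 <= n by rewrite ler0n.
(* M0 bounds the amplitudes of the fit, and K makes the interaction of
   distinct frequencies smaller than E *)
pose M0 := 8 * n * (E / 8 + M).
have M00 : 0 <= M0 by rewrite mulr_ge0 ?mulr_ge0 ?addr_ge0 ?(ltW E80).
pose K := 1 + 16 * n + 24 * (M0 + M) / E.
have K1 : 1 + 16 * n <= K.
  by rewrite lerDl divr_ge0 ?(ltW E0)// mulr_ge0// addr_ge0.
have K0 : 0 < K by lra.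
have KM : 6 / K * (M0 + M) <= E / 4.
  rewrite mulrAC ler_pdivrMr// /K.
  have -> : E / 4 * (1 + 16 * n + 24 * (M0 + M) / E) =
    E / 4 * (1 + 16 * n) + 6 * (M0 + M) by field; rewrite gt_eqF.
  by rewrite lerDr mulr_ge0//; lra.
exists eta, K; split=> // T tau eps T0 septau septh ieps ieps2 heta lse.
have NK : 16 * N%:R <= K by rewrite -/n; lra.
have close := closeP T K tau eps T0 K0 NK septau ieps ieps2 heta lse.
have tau_le : amp_norm tau <= M0 := amp_norm_bound T0 K0 NK septau close.
have K60 : 0 <= 6 / K by rewrite divr_ge0// ltW.
have K2 : 2 / K <= 6 / K by rewrite ler_pM2r ?invr_gt0//; lra.
have leE : 2 * (E / 8 + 6 / K * amp_norm tau + 6 / K * amp_norm theta) <= E.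
  have := ler_wpM2l K60 tau_le; move: KM; rewrite mulrDr -/M; lra.
have leE' : 2 * (E / 8 + 6 / K * amp_norm tau + 2 / K * amp_norm theta) <= E.
  by have := ler_wpM2r (amp_norm_ge0 theta) K2; lra.
have large k : 2 * E < `|amp_cos theta 0 k| + `|amp_sin theta 0 k|.
  by have := kappaP k; lra.
move=> k.
have near := freq_match T0 K0 septau septh close leE' large k.
have := identify_wave T0 K0 septau septh close leE near.
set c := wave_avg T 0 _; set s := wave_avg T _ _.
set a := amp_cos tau 0 k; set b := amp_sin tau 0 k.
set A := amp_cos theta 0 k; set B := amp_sin theta 0 k.
move=> [h1 h2 h3 h4].
have [c1 s1] : `|c| <= 1 /\ `|s| <= 1 by split; exact: norm_wave_avg_le1.
have [idA idB] := amp_identity (erefl (a * c + b * s - A))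
  (erefl (b * c - a * s - B)) (erefl (A * c - B * s - a)) (erefl (B * c + A * s - b)).
have bound3 (u v w : R) : `|u| <= E -> `|v| <= E -> `|w| <= E ->
    `|- (u + v * c + w * s)| <= 3 * E.
  move=> uE vE wE; rewrite normrN.
  have vc : `|v * c| <= E by rewrite normrM -[leRHS]mulr1 ler_pM.
  have ws : `|w * s| <= E by rewrite normrM -[leRHS]mulr1 ler_pM.
  have := ler_normD (u + v * c) (w * s); have := ler_normD u (v * c);
    clear - uE vc ws; lra.
set y := 1 - (c ^+ 2 + s ^+ 2) in idA idB.
have yA : `|A| * `|y| <= 3 * E by rewrite -normrM idA; exact: bound3.
have yB : `|B| * `|y| <= 3 * E.
  rewrite -normrM idB (_ : - _ = - (b * c - a * s - B + (B * c + A * s - b) * c +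
    - (A * c - B * s - a) * s)); last by ring.
  by apply: bound3; rewrite ?normrN.
have y_lt : y < d.
  have : kappa * `|y| <= (`|A| + `|B|) * `|y| by rewrite ler_wpM2r// kappaP.
  rewrite mulrDl => hk; apply: le_lt_trans (ler_norm _) _.
  rewrite -(ltr_pM2l kappa0); apply: le_lt_trans hk _.
  have kd : 0 < kappa * d by rewrite mulr_gt0.
  by clear - yA yB Ed kd; lra.
have freq_close : T * `|freq tau 0 k - freq theta 0 k| < x.
  by apply: dP => //; move: y_lt; rewrite /y -/c -/s; clear; lra.
have c_near : `|c - 1| <= x.
  rewrite -[X in c - X]cos0; apply: le_trans (norm_wave_avg_near _ _ T0) _.
  exact: ltW.
have s_near : `|s| <= x.
  rewrite -[s]subr0 -[X in s - X]cos_pihalf -(cosN (pi / 2)).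
  apply: le_trans (norm_wave_avg_near _ _ T0) _.
  exact: ltW.
have AB : `|A| + `|B| <= M by exact: le_amp_norm.
have rot (u v w : R) : `|u| + `|v| <= M -> `|u * (c - 1) + v * s - w| <= E -> `|w| < e.
  move=> uv hw.
  have -> : w = u * (c - 1) + v * s - (u * (c - 1) + v * s - w) by ring.
  have hu : `|u * (c - 1)| <= `|u| * x by rewrite normrM ler_wpM2l.
  have hv : `|v * s| <= `|v| * x by rewrite normrM ler_wpM2l.
  have := ler_wpM2r (ltW x0) uv; rewrite mulrDl => huv.
  have := ler_normB (u * (c - 1) + v * s) (u * (c - 1) + v * s - w).
  have := ler_normD (u * (c - 1)) (v * s).
  by clear - huv hu hv hw xM Ee e0; lra.
split.
- apply: (rot A (- B)); first by rewrite normrN.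
  by rewrite (_ : _ - _ = A * c - B * s - a)//; ring.
- apply: (rot B A); first by rewrite addrC.
  by rewrite (_ : _ - _ = B * c + A * s - b)//; ring.
- by rewrite normrM (gtr0_norm T0); exact: lt_le_trans xe.
Qed.

End least_squares.

(** * Moments of the normal density *)

Section normal_moments.
Context {R : realType}.
Local Notation mu := (@lebesgue_measure R).
Implicit Types (m s u psi x : R).

(** Fundamental theorem of calculus on the whole line, for a primitive F that
    is O(1/|x|) at infinity. *)
Lemma integral_derivative0 (F f : R -> R) m (C : R) :
  (forall x, is_derive x 1 F (f x)) -> continuous f ->
  mu.-integrable setT (EFin \o f) ->
  (forall x, `|F x| * `|x - m| <= C) -> \int[mu]_x f x = 0.
Proof.
move=> dF cf intf FC.
have C0 : 0 <= C by apply: le_trans (FC m); rewrite mulr_ge0.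
pose I n := `[m - n.+1%:R, m + n.+1%:R]%classic : set R.
have int_I n : \int[mu]_(x in I n) f x = F (m + n.+1%:R) - F (m - n.+1%:R).
  rewrite /Rintegral (@continuous_FTC2 _ f F) //.
  - by have : (0 : R) < n.+1%:R by []; lra.
  - exact: continuous_subspaceT.
  - have cF x : {for x, continuous F} := is_derive_continuous (dF x).
    split.
    + by move=> x _; case: (dF x).
    + by apply: cvg_at_right_filter; exact: cF.
    + by apply: cvg_at_left_filter; exact: cF.
  - by move=> x _; rewrite derive1E; case: (dF x) => _ ->.
have bound n : `|\int[mu]_(x in I n) f x| <= 2 * C * n.+1%:R^-1.
  rewrite int_I; apply: le_trans (ler_normB _ _) _.
  have n0 : (0 : R) < n.+1%:R by [].
  have h x : `|x - m| = n.+1%:R -> `|F x| <= C * n.+1%:R^-1.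
    by move=> xn; rewrite ler_pdivlMr// -xn.
  have := h (m + n.+1%:R); have := h (m - n.+1%:R).
  rewrite addrAC subrr add0r normrN addrAC subrr add0r normr_nat.
  by move=> /(_ erefl) h1 /(_ erefl) h2; rewrite -mulrA mulr2n mulrDl mul1r lerD.
have cvgI : (\int[mu]_(x in I n) f x) @[n --> \oo] --> \int[mu]_x f x.
  apply: fine_cvg; rewrite fineK; last exact: integrable_fin_num.
  under eq_fun do rewrite integral_mkcond.
  apply: (@dominated_cvg _ _ _ mu setT measurableT
    (fun n => (EFin \o f) \_ (I n)) (EFin \o f) (fun x => (`|f x|)%:E)) => //.
  - move=> n; apply/(measurable_restrict _ _ _) => //; rewrite ?setTI//.
      exact: measurable_itv.
    by apply: measurable_funTS; case/integrableP : intf.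
  - move=> x _; apply: cvg_near_cst; near=> n.
    rewrite patchE mem_set// /I/= in_itv/=.
    have : `|x - m| <= n.+1%:R.
      near: n; exists (Num.bound `|x - m|) => // k /= kn.
      apply: le_trans (ltW (archi_boundP (normr_ge0 _))) _.
      by rewrite ler_nat; exact: leqW.
    by rewrite ler_norml; lra.
  - exact: integrable_norm.
  - move=> n x _; rewrite patchE; case: ifP => // _.
    by rewrite abse0 lee_fin.
have cvg0 : (\int[mu]_(x in I n) f x) @[n --> \oo] --> (0 : R).
  apply/norm_cvg0P.
  apply: (@squeeze_cvgr _ _ _ _ (cst 0) (fun n => 2 * C * n.+1%:R^-1)).
  - by apply: nearW => n; rewrite normr_ge0 bound.
  - exact: cvg_cst.
  - rewrite -[X in _ --> X](mulr0 (2 * C)); apply: cvgM; first exact: cvg_cst.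
    exact: cvg_harmonic.
exact: cvg_unique cvgI cvg0.
Unshelve. all: by end_near. Qed.

Lemma is_derive_normal_pdf m s x : s != 0 ->
  is_derive x 1 (normal_pdf m s) (- (x - m) / s ^+ 2 * normal_pdf m s x).
Proof.
move=> s0; rewrite normal_pdfE// /normal_fun.
apply: is_derive_eq.
rewrite /GRing.scale/=; set e := expR _; field; exact: s0.
Qed.

(** As y exp (- 2 y) <= exp (- y), a normal density of twice the deviation
    dominates, which makes quadratic moments integrable by comparison. *)
Lemma sqr_normal_pdf_le m s x : s != 0 ->
  (x - m) ^+ 2 * normal_pdf m s x <=
    4 * s ^+ 2 * normal_peak s * normal_fun m (2 * s) x.
Proof.
move=> s0; rewrite normal_pdfE// /normal_fun.
have s20 : 0 < s ^+ 2 by rewrite exprn_even_gt0.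
set z := x - m; pose y := z ^+ 2 / (4 * s ^+ 2).
have y0 : 0 <= y by rewrite divr_ge0 ?sqr_ge0// mulr_ge0// ltW.
have -> : - z ^+ 2 / (s ^+ 2 *+ 2) = - y - y.
  by rewrite /y; field; exact: s0.
have -> : z ^+ 2 = 4 * s ^+ 2 * y by rewrite /y; field; exact: s0.
have le_e : y * expR (- y - y) <= expR (- y).
  rewrite expRD mulrA ler_piMl ?expR_ge0// expRN ler_pdivrMr ?expR_gt0// mul1r.
  by apply: le_trans (expR_ge1Dx y); rewrite lerDr.
have le_e' : expR (- y) <= expR (- (4 * s ^+ 2 * y) / ((2 * s) ^+ 2 *+ 2)).
  rewrite ler_expR.
  have -> : - (4 * s ^+ 2 * y) / ((2 * s) ^+ 2 *+ 2) = - y / 2.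
    by field; exact: s0.
  lra.
have q0 := normal_peak_ge0 s.
set q := normal_peak s in q0 *; set E1 := expR (- y - y) in le_e *.
have -> : 4 * s ^+ 2 * y * (q * E1) = 4 * s ^+ 2 * q * (y * E1) by ring.
rewrite ler_wpM2l//; last exact: le_trans le_e'.
by apply: mulr_ge0 => //; apply: mulr_ge0 => //; exact: sqr_ge0.
Qed.

Lemma integrable_mul_normal_pdf m s (f : R -> R) (A : R) : s != 0 ->
  measurable_fun setT f -> (forall x, `|f x| <= A * (1 + (x - m) ^+ 2)) ->
  mu.-integrable setT (EFin \o (fun x => f x * normal_pdf m s x)).
Proof.
move=> s0 mf fA.
have s20 : 2 * s != 0 by rewrite mulf_neq0.
have A0 : 0 <= A.
  by have := fA m; rewrite subrr expr0n/= addr0 mulr1; exact: le_trans.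
pose c := 4 * s ^+ 2 * normal_peak s / normal_peak (2 * s).
pose g x := A * (normal_pdf m s x + c * normal_pdf m (2 * s) x).
have intg : mu.-integrable setT (EFin \o g).
  rewrite (_ : EFin \o g = fun x => (A%:E * ((normal_pdf m s x)%:E +
      c%:E * (normal_pdf m (2 * s) x)%:E))%E); last first.
    by apply/funext => x; rewrite /g /= EFinM EFinD EFinM.
  apply: integrableZl => //; apply: integrableD => //.
    exact: integrable_normal_pdf.
  by apply: integrableZl => //; exact: integrable_normal_pdf.
apply: (le_integrable _ _ _ intg) => //.
  apply/measurable_EFinP/measurable_funM => //; exact: measurable_normal_pdf.
move=> x _; rewrite /= lee_fin normrM (ger0_norm (normal_pdf_ge0 _ _ _)).
apply: le_trans (ler_norm _); rewrite /g.
apply: le_trans (ler_wpM2r (normal_pdf_ge0 m s x) (fA x)) _.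
rewrite -mulrA ler_wpM2l// mulrDl mul1r lerD2l.
apply: le_trans (sqr_normal_pdf_le m x s0) _.
by rewrite (normal_pdfE _ s20) /c [leRHS]mulrA divfK// gt_eqF// normal_peak_gt0.
Qed.

(** Integration by parts against the Gaussian density. *)
Lemma stein_normal m s (g g' : R -> R) (A : R) : s != 0 ->
  (forall x, is_derive x 1 g (g' x)) -> continuous g' ->
  (forall x, `|g x| <= A * (1 + `|x - m|)) ->
  (forall x, `|g' x| <= A * (1 + (x - m) ^+ 2)) ->
  \int[mu]_x (g x * (x - m) * normal_pdf m s x) =
  s ^+ 2 * \int[mu]_x (g' x * normal_pdf m s x).
Proof.
move=> s0 dg cg' gA g'A.
have s20 : 0 < s ^+ 2 by rewrite exprn_even_gt0.
have A0 : 0 <= A.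
  by have := g'A m; rewrite subrr expr0n/= addr0 mulr1; exact: le_trans.
have cg : continuous g by move=> x; exact: is_derive_continuous (dg x).
have cm : continuous (fun x : R => x - m).
  by move=> x; exact: is_derive_continuous.
have cgm : continuous (fun x : R => g x * (x - m)).
  by move=> x; exact: continuousM (cg x) (cm x).
have i1 : mu.-integrable setT
    (EFin \o (fun x => g x * (x - m) * normal_pdf m s x)).
  apply: (@integrable_mul_normal_pdf _ _ _ (2 * A)) => //.
    exact: continuous_measurable_fun.
  move=> x; rewrite normrM.
  apply: le_trans (ler_wpM2r (normr_ge0 _) (gA x)) _.
  rewrite [2 * A]mulrC -!mulrA ler_wpM2l// -[(x - m) ^+ 2]real_normK ?num_real//.
  move: `|x - m| => z; rewrite -subr_ge0.
  have -> : 2 * (1 + z ^+ 2) - (1 + z) * z =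
    (z - 1) ^+ 2 / 2 + z ^+ 2 / 2 + 3 / 2 by field.
  by have := sqr_ge0 (z - 1); have := sqr_ge0 z; lra.
have i2 : mu.-integrable setT (EFin \o (fun x => g' x * normal_pdf m s x)).
  apply: integrable_mul_normal_pdf g'A => //; exact: continuous_measurable_fun.
apply/eqP; rewrite -subr_eq0 -RintegralZl// -RintegralB//; last first.
  rewrite (_ : EFin \o _ = fun x => ((s ^+ 2)%:E * (g' x * normal_pdf m s x)%:E)%E).
    exact: integrableZl.
  by apply/funext => x; rewrite /= -EFinM.
apply/eqP.
pose F x := - s ^+ 2 * (g x * normal_pdf m s x).
pose f x := g x * (x - m) * normal_pdf m s x - s ^+ 2 * (g' x * normal_pdf m s x).
apply: (@integral_derivative0 F f m (s ^+ 2 * (A * ((1 + 8 * s ^+ 2) * normal_peak s)))).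
- move=> x; have dp := is_derive_normal_pdf m x s0; have dgx := dg x.
  by apply: is_derive_eq; rewrite /GRing.scale/= /f; field; exact: s0.
- have cp := @continuous_normal_pdf R m s s0.
  move=> x; have cgp := continuousM (cg' x) (cp x).
  exact: (continuousB (continuousM (cgm x) (cp x))
    (continuousM (@cst_continuous _ _ (s ^+ 2) x) cgp)).
- rewrite (_ : EFin \o _ = (EFin \o (fun x => g x * (x - m) * normal_pdf m s x)%R) \-
    (fun x => ((s ^+ 2)%:E * (g' x * normal_pdf m s x)%:E)))%E.
    apply: integrableB => //; exact: integrableZl.
  by apply/funext => x; rewrite /= EFinB EFinM.
move=> x; rewrite /F normrM normrN (gtr0_norm s20) -[leLHS]mulrA ler_pM2l//.
rewrite normrM (ger0_norm (normal_pdf_ge0 _ _ _)).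
rewrite -mulrA; apply: le_trans (ler_wpM2r _ (gA x)) _.
  by rewrite mulr_ge0// normal_pdf_ge0.
rewrite -[leLHS]mulrA ler_wpM2l//.
have h1 := normal_pdf_ub m x s0; have p0 := normal_pdf_ge0 m s x.
have pk0 : 0 <= 4 * s ^+ 2 * normal_peak s.
  by apply: mulr_ge0; [apply: mulr_ge0 => //; exact: ltW|exact: normal_peak_ge0].
have h2 : (x - m) ^+ 2 * normal_pdf m s x <= 4 * s ^+ 2 * normal_peak s.
  apply: le_trans (sqr_normal_pdf_le m x s0) _.
  rewrite ler_piMr//.
  rewrite /normal_fun -[leRHS]expR0 ler_expR mulNr oppr_le0 divr_ge0 ?sqr_ge0//.
  by rewrite mulrn_wge0// sqr_ge0.
move: h2; rewrite -[(x - m) ^+ 2]real_normK ?num_real//.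
set p := normal_pdf m s x in h1 p0 *; set q := normal_peak s in h1 pk0 *.
move: `|x - m| => z h2.
have : 0 <= (z - 1) ^+ 2 * p by rewrite mulr_ge0 ?sqr_ge0.
have -> : (z - 1) ^+ 2 * p = z ^+ 2 * p - 2 * (z * p) + p by ring.
have -> : (1 + z) * (p * z) = z * p + z ^+ 2 * p by ring.
have -> : (1 + 8 * s ^+ 2) * q = q + 2 * (4 * s ^+ 2 * q) by ring.
lra.
Qed.

Lemma Rintegral_normal_pdf m s : \int[mu]_x normal_pdf m s x = 1.
Proof. by rewrite /Rintegral integral_normal_pdf. Qed.

Lemma normal_pdf_mean m s : s != 0 ->
  mu.-integrable setT (EFin \o (fun x => x * normal_pdf m s x)) /\
  \int[mu]_x (x * normal_pdf m s x) = m.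
Proof.
move=> s0.
have ip (c : R) : mu.-integrable setT (EFin \o (fun x => c * normal_pdf m s x)).
  apply: (@integrable_mul_normal_pdf _ _ _ `|c|) => // x.
  by rewrite ler_peMr// lerDl sqr_ge0.
have ix : mu.-integrable setT (EFin \o (fun x => (x - m) * normal_pdf m s x)).
  apply: (@integrable_mul_normal_pdf _ _ _ 1) => //.
    by apply: measurable_funB.
  move=> x; rewrite mul1r -[(x - m) ^+ 2]real_normK ?num_real//.
  move: `|x - m| => z; rewrite -subr_ge0.
  have -> : 1 + z ^+ 2 - z = (z - 1 / 2) ^+ 2 + 3 / 4 by field.
  by have := sqr_ge0 (z - 1 / 2); lra.
have xE : (fun x => x * normal_pdf m s x) =
    fun x => (x - m) * normal_pdf m s x + m * normal_pdf m s x.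
  by apply/funext => x; ring.
split.
  rewrite xE (_ : EFin \o _ = (EFin \o (fun x => (x - m) * normal_pdf m s x)%R) \+
    (EFin \o (fun x => m * normal_pdf m s x)%R))%E; first exact: integrableD.
  by apply/funext => x; rewrite /= EFinD.
rewrite xE RintegralD//.
have := @stein_normal m s (cst 1) (cst 0) 1 s0.
under eq_Rintegral do rewrite mul1r.
move=> ->; last first.
- by move=> x; rewrite normr0 mul1r addr_ge0// sqr_ge0.
- by move=> x; rewrite normr1 mul1r lerDl.
- exact: cst_continuous.
under eq_Rintegral do rewrite mul0r.
rewrite Rintegral_cst// mul0r mulr0 add0r RintegralZl//.
  by rewrite Rintegral_normal_pdf mulr1.
by have := ip 1; under eq_fun do rewrite mul1r.
Qed.

Lemma normal_pdf_sqr s : s != 0 ->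
  mu.-integrable setT (EFin \o (fun x => x ^+ 2 * normal_pdf 0 s x)) /\
  \int[mu]_x (x ^+ 2 * normal_pdf 0 s x) = s ^+ 2.
Proof.
move=> s0; split.
  apply: (@integrable_mul_normal_pdf _ _ _ 1) .
- exact: s0.
- by apply: continuous_measurable_fun => x; exact: is_derive_continuous.
- by move=> x; rewrite mul1r subr0 ger0_norm ?sqr_ge0// lerDr.
have := @stein_normal 0 s id (cst 1) 1 s0.
under eq_Rintegral do rewrite subr0 -expr2.
move=> ->.
- under eq_Rintegral do rewrite mul1r.
  by rewrite Rintegral_normal_pdf mulr1.
- exact: cst_continuous.
- by move=> x; rewrite mul1r subr0 lerDr.
- by move=> x; rewrite normr1 mul1r lerDl sqr_ge0.
Qed.

(** The Fourier transform Phi of the centred Gaussian density solves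
    Phi' = - s^2 u Phi, by integration by parts. *)
Lemma normal_pdf_cos s psi : s != 0 ->
  \int[mu]_x (cos (x + psi) * normal_pdf 0 s x) = cos psi * expR (- (s ^+ 2 / 2)).
Proof.
move=> s0.
pose f u x := cos (x * u + psi) * normal_pdf 0 s x.
pose Phi u := \int[mu]_x f u x.
pose f' u x := - (x * sin (x * u + psi)) * normal_pdf 0 s x.
have df u x : is_derive u 1 (f ^~ x) (f' u x).
  rewrite /f; apply: is_derive_eq.
  by rewrite /GRing.scale/= /f'; ring.
have mcos u : measurable_fun setT (fun x : R => cos (x * u + psi)).
  apply: continuous_measurable_fun => x; exact: is_derive_continuous.
have cos1 (y : R) : `|cos y| <= 1 by rewrite ler_norml cos_le1 cos_geN1.
have sin1 (y : R) : `|sin y| <= 1 by rewrite ler_norml sin_le1 sin_geN1.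
have intf u : mu.-integrable setT (EFin \o f u).
  apply: (@integrable_mul_normal_pdf _ _ _ 1) => // x.
  by apply: le_trans (cos1 _) _; rewrite mul1r lerDl sqr_ge0.
have dPhi u : is_derive u 1 Phi (- (s ^+ 2 * u) * Phi u).
  pose g x := `|x| * normal_pdf 0 s x.
  have g0 x : 0 <= g x by rewrite mulr_ge0// normal_pdf_ge0.
  have intg : mu.-integrable setT (EFin \o g).
    apply: (@integrable_mul_normal_pdf _ _ _ 1) => //.
    move=> x; rewrite normr_id mul1r subr0 -[x ^+ 2]real_normK ?num_real//.
    move: `|x| => z; rewrite -subr_ge0.
    have -> : 1 + z ^+ 2 - z = (z - 1 / 2) ^+ 2 + 3 / 4 by field.
    by have := sqr_ge0 (z - 1 / 2); lra.
  have f'E v x : partial1of2 f v x = f' v x.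
    by rewrite partial1of2E; case: (df v x).
  have ui : `](u - 1), (u + 1)[%classic u by rewrite /= in_itv/=; apply/andP; split; lra.
  have df1 x y : `](u - 1), (u + 1)[%classic x -> [set: R] y -> derivable (f ^~ y) x 1.
    by move=> _ _; case: (df x y).
  have f'_le x y : `](u - 1), (u + 1)[%classic x -> [set: R] y ->
      `|partial1of2 f x y| <= g y.
    move=> _ _; rewrite f'E /f' normrM (ger0_norm (normal_pdf_ge0 _ _ _)).
    by rewrite ler_wpM2r ?normal_pdf_ge0// normrN normrM ler_piMr.
  have der := @derivable_under_integral R _ _ mu f setT measurableT u (u - 1) (u + 1)
    ui (fun x _ => intf x) df1 g g0 intg f'_le.
  have val := @differentiation_under_integral R _ _ mu f setT measurableT u (u - 1) (u + 1)
    ui (fun x _ => intf x) df1 g g0 intg f'_le.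
  apply: DeriveDef; first exact: der.
  rewrite -derive1E val.
  under eq_Rintegral do rewrite f'E.
  have dsin x : is_derive x 1 (fun x => - sin (x * u + psi))
      (- (u * cos (x * u + psi))).
    by apply: is_derive_eq; rewrite /GRing.scale/=; ring.
  have := @stein_normal 0 s (fun x => - sin (x * u + psi))
    (fun x => - (u * cos (x * u + psi))) (1 + `|u|) s0 dsin.
  under eq_Rintegral => x _.
    rewrite (_ : - sin _ * (x - 0) * _ = f' u x); last by rewrite /f'; ring.
    over.
  move=> ->.
  - rewrite (_ : (fun x => - (u * cos (x * u + psi)) * normal_pdf 0 s x) =
      fun x => - u * f u x); last by apply/funext => x; rewrite /f; ring.
    by rewrite RintegralZl// -/(Phi u); ring.
  - by move=> x; exact: is_derive_continuous.
  - move=> x; rewrite normrN; apply: le_trans (sin1 _) _.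
    by rewrite -[leLHS]mulr1 ler_pM// lerDl.
  - move=> x; rewrite normrN normrM; apply: (@le_trans _ _ `|u|).
      by rewrite ler_piMr.
    rewrite -[leLHS]mulr1 ler_pM// ?lerDr//.
    by rewrite lerDl sqr_ge0.
pose H u := Phi u * expR (s ^+ 2 / 2 * (u * u)).
have dH u : is_derive u 1 H 0.
  have dPu := dPhi u.
  by rewrite /H; apply: is_derive_eq; rewrite /GRing.scale/=; field.
have H10 : H 1 = H 0 by apply: is_derive_0_is_cst.
have Phi0 : Phi 0 = cos psi.
  rewrite /Phi /f; under eq_Rintegral do rewrite mulr0 add0r.
  rewrite RintegralZl//; first by rewrite Rintegral_normal_pdf mulr1.
  exact: integrable_normal_pdf.
have -> : \int[mu]_x (cos (x + psi) * normal_pdf 0 s x) = Phi 1.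
  by apply: eq_Rintegral => x _; rewrite /f mulr1.
move: H10; rewrite /H Phi0 !mulr0 expR0 !mulr1 => <-.
by rewrite -mulrA -expRD subrr expR0 mulr1.
Qed.

End normal_moments.

(** * Gaussian variables *)

Section normal_change_of_variables.
Context {R : realType}.
Local Notation mu := (@lebesgue_measure R).

Lemma ge0_integral_normal_prob (m s : R) (f : R -> \bar R) :
  measurable_fun setT f -> (forall x, 0 <= f x)%E ->
  (\int[normal_prob m s]_x f x = \int[mu]_x (f x * (normal_pdf m s x)%:E))%E.
Proof.
move=> mf f0; have dom := normal_prob_dominates m s.
rewrite -(Radon_Nikodym_SigmaFinite.change_of_variables dom)//.
apply: ae_eq_integral => //.
- apply: emeasurable_funM => //; apply: (measurable_int mu).
  exact: Radon_Nikodym_SigmaFinite.f_integrable.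
- apply: emeasurable_funM => //; apply/measurable_EFinP.
  exact: measurable_normal_pdf.
- apply: ae_eqe_mul2l => /=; apply: integral_ae_eq => //=.
  + exact: Radon_Nikodym_SigmaFinite.f_integrable.
  + by apply/measurable_EFinP; exact: measurable_normal_pdf.
  + by move=> E _ mE; rewrite -Radon_Nikodym_SigmaFinite.f_integral.
Qed.

Lemma integral_normal_prob (m s : R) (f : R -> R) :
  measurable_fun setT f ->
  mu.-integrable setT (EFin \o (fun x => f x * normal_pdf m s x)) ->
  (normal_prob m s).-integrable setT (EFin \o f) /\
  (\int[normal_prob m s]_x (f x)%:E = (\int[mu]_x (f x * normal_pdf m s x))%:E)%E.
Proof.
move=> mf intf; have dom := normal_prob_dominates m s.
have intf' : (normal_prob m s).-integrable setT (EFin \o f).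
  apply/integrableP; split; first exact/measurable_EFinP.
  rewrite ge0_integral_normal_prob//; last first.
    by apply: measurableT_comp => //; exact/measurable_EFinP.
  case/integrableP : intf => _; congr (_ < _)%E.
  apply: eq_integral => x _; rewrite /= -EFinM normrM.
  by rewrite (ger0_norm (normal_pdf_ge0 _ _ _)).
split=> //; rewrite /Rintegral fineK; last exact: integrable_fin_num.
rewrite -(Radon_Nikodym_change_of_variables dom)//=.
apply: ae_eq_integral => //.
- apply: emeasurable_funM; first exact/measurable_EFinP.
  by apply: (measurable_int mu); exact: Radon_Nikodym_integrable.
- by apply/measurable_EFinP/measurable_funM => //; exact: measurable_normal_pdf.
- under [X in ae_eq _ _ _ X]eq_fun do rewrite EFinM.
  apply: ae_eqe_mul2l => /=; apply: integral_ae_eq => //=.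
  + exact: Radon_Nikodym_integrable.
  + by apply/measurable_EFinP; exact: measurable_normal_pdf.
  + by move=> E _ mE; rewrite -Radon_Nikodym_integral.
Qed.

End normal_change_of_variables.

Section gaussian_variables.
Context {R : realType} d {Omega : measurableType d} (P : probability Omega R).
Local Notation mu := (@lebesgue_measure R).
Local Notation TR := (measurableTypeR R).
Implicit Types (Y Z : Omega -> R) (m s v : R).

Lemma integrable_bounded_RV Z (C : R) : measurable_fun setT Z ->
  (forall w, `|Z w| <= C) -> P.-integrable setT (EFin \o Z).
Proof.
move=> mZ ZC; apply: measurable_bounded_integrable => //.
  by rewrite /= probability_setT ltry.
exists C; split; first exact: num_real.
by move=> x Cx w _; exact: le_trans (ZC w) (ltW Cx).
Qed.

Lemma integrable_mul_RV Y Z : measurable_fun setT Y -> measurable_fun setT Z ->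
  P.-integrable setT (EFin \o (fun w => Y w ^+ 2)) ->
  P.-integrable setT (EFin \o (fun w => Z w ^+ 2)) ->
  P.-integrable setT (EFin \o (fun w => Y w * Z w)).
Proof.
move=> mY mZ Y2 Z2; apply: (le_integrable _ _ _ (integrableD measurableT Y2 Z2)) => //.
  by apply/measurable_EFinP; exact: measurable_funM.
move=> w _; rewrite /= lee_fin [leRHS]ger0_norm ?addr_ge0 ?sqr_ge0// normrM.
rewrite -[Y w ^+ 2]real_normK ?num_real// -[Z w ^+ 2]real_normK ?num_real//.
move: `|Y w| `|Z w| => x y.
by have := sqr_ge0 (x - y); have := sqr_ge0 (x + y); rewrite sqrrB sqrrD; lra.
Qed.

Lemma integrable_sqr_RV Z : measurable_fun setT Z ->
  P.-integrable setT (EFin \o (fun w => Z w ^+ 2)) -> P.-integrable setT (EFin \o Z).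
Proof.
move=> mZ Z2; have mone : measurable_fun setT (fun _ : Omega => 1 : R) by [].
have one2 : P.-integrable setT (EFin \o (fun _ : Omega => (1 : R) ^+ 2)).
  by apply: (@integrable_bounded_RV _ 1) => // w; rewrite expr1n normr1.
by have := integrable_mul_RV mone mZ one2 Z2; under eq_fun do rewrite mul1r.
Qed.

Lemma integrable_of_integral_fin Z (x : R) : measurable_fun setT Z ->
  (forall w, 0 <= Z w) -> (\int[P]_w (Z w)%:E = x%:E)%E ->
  P.-integrable setT (EFin \o Z).
Proof.
move=> mZ Z0 Zx; apply/integrableP; split; first exact/measurable_EFinP.
under eq_integral do rewrite /= ger0_norm//.
by rewrite Zx ltry.
Qed.

(** The variance may vanish, and normal_prob 0 0 is not a Dirac mass. *)
Definition normal_law (s : R) (A : set TR) : \bar R :=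
  if s == 0 then \d_(0 : TR) A else normal_prob 0 s A.

Lemma integral_law (Z : Omega -> TR) (nu : {measure set TR -> \bar R}) (f : TR -> R) :
  measurable_fun setT Z -> measurable_fun setT f ->
  (forall A, measurable A -> pushforward P Z A = nu A) ->
  P.-integrable setT (EFin \o (f \o Z)) ->
  (\int[P]_w (f (Z w))%:E = \int[nu]_x (f x)%:E)%E.
Proof.
move=> mZ mf law intf.
transitivity (\int[pushforward P Z]_x (f x)%:E)%E.
  rewrite (integral_pushforward mZ (f := EFin \o f))//.
  exact/measurable_EFinP.
by apply: eq_measure_integral => A mA _; exact: law.
Qed.

(** Comparing the first two moments of Z with those of the normal or Dirac law
    that it follows identifies the parameters of that law. *)
Lemma gaussian_law_centered Z v : measurable_fun setT Z ->
  gaussian_law (pushforward P Z) ->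
  (\int[P]_w (Z w)%:E = 0)%E -> (\int[P]_w (Z w ^+ 2)%:E = v%:E)%E ->
  exists s, [/\ 0 <= s, s ^+ 2 = v &
    forall A : set TR, measurable A -> pushforward P Z A = normal_law s A].
Proof.
move=> mZ [m [s [s0 law]]] EZ EZ2.
have mid : measurable_fun setT (@id R) by exact: measurable_id.
have msqr : measurable_fun setT (fun x : R => x ^+ 2).
  by apply: continuous_measurable_fun => x; exact: is_derive_continuous.
have iZ2 : P.-integrable setT (EFin \o (fun w => Z w ^+ 2)).
  apply: integrable_of_integral_fin EZ2 => [|w]; last exact: sqr_ge0.
  exact: (measurableT_comp msqr mZ).
have iZ := integrable_sqr_RV mZ iZ2.
have [s_eq0|s_neq0] := eqVneq s 0.
  have lawd (A : set TR) : measurable A -> pushforward P Z A = \d_(m : TR) A.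
    by move=> mA; rewrite law// s_eq0 eqxx.
  have m0 : m = 0.
    have := integral_law mZ mid lawd iZ.
    rewrite EZ integral_dirac// diracT mul1e => -[]; exact: esym.
  have law0 (A : set TR) : measurable A -> pushforward P Z A = normal_law 0 A.
    by move=> mA; rewrite lawd// m0 /normal_law eqxx.
  exists 0; split; [exact: lexx| |exact: law0].
  have := integral_law mZ msqr lawd iZ2.
  rewrite EZ2 integral_dirac//; last exact/measurable_EFinP.
  by rewrite diracT mul1e m0 => -[->].
have lawn (A : set TR) : measurable A -> pushforward P Z A = normal_prob m s A.
  by move=> mA; rewrite law// (negbTE s_neq0).
have [ix meanE] := normal_pdf_mean m s_neq0.
have m0 : m = 0.
  have := integral_law (nu := normal_prob m s) mZ mid lawn iZ.
  rewrite EZ (integral_normal_prob mid ix).2 meanE => -[]; exact: esym.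
have law_s (A : set TR) : measurable A -> pushforward P Z A = normal_law s A.
  by move=> mA; rewrite lawn// m0 /normal_law (negbTE s_neq0).
exists s; split; [exact: s0| |exact: law_s].
have [ix2 varE] := normal_pdf_sqr s_neq0.
have := integral_law (nu := normal_prob m s) mZ msqr lawn iZ2.
by rewrite m0 EZ2 (integral_normal_prob msqr ix2).2 varE => -[->].
Qed.

Lemma gaussian_cos Z v psi : measurable_fun setT Z ->
  gaussian_law (pushforward P Z) ->
  (\int[P]_w (Z w)%:E = 0)%E -> (\int[P]_w (Z w ^+ 2)%:E = v%:E)%E ->
  (\int[P]_w (cos (Z w + psi))%:E = (cos psi * expR (- (v / 2)))%:E)%E.
Proof.
move=> mZ gZ EZ EZ2; have [s [s0 sv law]] := gaussian_law_centered mZ gZ EZ EZ2.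
have mcos : measurable_fun setT (fun x : R => cos (x + psi)).
  by apply: continuous_measurable_fun => x; exact: is_derive_continuous.
have icos : P.-integrable setT (EFin \o ((fun x => cos (x + psi)) \o Z)).
  apply: (@integrable_bounded_RV _ 1); first exact: measurableT_comp.
  by move=> w; rewrite ler_norml cos_le1 cos_geN1.
have [s_eq0|s_neq0] := eqVneq s 0.
  have lawd (A : set TR) : measurable A -> pushforward P Z A = \d_(0 : TR) A.
    by move=> mA; rewrite law// /normal_law s_eq0 eqxx.
  rewrite (integral_law mZ mcos lawd icos) integral_dirac//.
    by rewrite diracT mul1e add0r -sv s_eq0 expr0n/= mul0r oppr0 expR0 mulr1.
  exact/measurable_EFinP.
have lawn (A : set TR) : measurable A -> pushforward P Z A = normal_prob 0 s A.
  by move=> mA; rewrite law// /normal_law (negbTE s_neq0).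
rewrite (integral_law (nu := normal_prob 0 s) mZ mcos lawn icos) (integral_normal_prob mcos _).2.
  by rewrite normal_pdf_cos// sv.
apply: (@integrable_mul_normal_pdf _ _ _ _ 1) => // x.
by rewrite mul1r ler_wpDr ?sqr_ge0// ler_norml cos_le1 cos_geN1.
Qed.

End gaussian_variables.

(** * Density of trigonometric polynomials *)

Section bernstein.
Context {R : realType}.
Implicit Types (f g : nat -> R) (s c : R) (n : nat).

(** Expectation of f at a binomial variable of parameters n and s, that is, the
    Bernstein polynomial of f; the recursion conditions on one trial. *)
Fixpoint bern n f s : R :=
  if n is n'.+1 then s * bern n' (fun k => f k.+1) s + (1 - s) * bern n' f s
  else f 0%N.

Lemma le_bern n f g s : 0 <= s <= 1 -> (forall k, f k <= g k) ->
  bern n f s <= bern n g s.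
Proof.
move=> /andP[s0 s1]; elim: n f g => [|n IH] f g fg //=.
by rewrite lerD// ler_wpM2l ?subr_ge0//; apply: IH.
Qed.

Lemma bern_affine n f s (a b : R) :
  bern n (fun k => a + b * f k) s = a + b * bern n f s.
Proof. by elim: n f => [|n IH] f //=; rewrite !IH; ring. Qed.

Lemma bern_variance n s c :
  bern n (fun k => (k%:R - c) ^+ 2) s = (n%:R * s - c) ^+ 2 + n%:R * s * (1 - s).
Proof.
elim: n c => [|n IH] c /=; first by ring.
have -> : bern n (fun k => (k.+1%:R - c) ^+ 2) s =
    bern n (fun k => (k%:R - (c - 1)) ^+ 2) s.
  by congr bern; apply/funext => k; rewrite -natr1; ring.
by rewrite !IH -natr1; ring.
Qed.

Lemma norm_bern_le n f s (M : R) : 0 <= s <= 1 -> (forall k, `|f k| <= M) ->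
  `|bern n f s| <= M.
Proof.
move=> s01 fM; rewrite ler_norml.
have cst (c : R) : bern n (fun=> c) s = c.
  by elim: n => [|n IH] //=; rewrite IH; ring.
by rewrite -[- M]cst -[X in _ && (_ <= X)]cst; apply/andP; split;
  apply: le_bern => // k; have := fM k; rewrite ler_norml => /andP[].
Qed.

(** Bernstein's argument: f s - f y is at most e / 2 plus a multiple of
    (y - s)^2, whose binomial mean is a variance of order 1 / n. *)
Lemma bern_cvg (f : R -> R) s (M : R) : 0 <= s <= 1 ->
  (forall x, `|f x| <= M) -> {for s, continuous f} ->
  bern n.+1 (fun k => f (k%:R / n.+1%:R)) s @[n --> \oo] --> f s.
Proof.
move=> s01 fM cf; have M0 : 0 <= M by apply: le_trans (fM 0).
have [s0 s1] := andP s01.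
apply/cvgrPdist_le => e e0.
have [r /= r0 near_s] : \forall y \near s, `|f s - f y| <= e / 2.
  by move/cvgrPdist_le : cf => /(_ (e / 2)); apply; rewrite divr_gt0.
(* far from s the oscillation 2 M is paid for by the variance *)
pose C := 2 * M / r ^+ 2.
have C0 : 0 <= C by rewrite divr_ge0 ?sqr_ge0// mulr_ge0.
have osc y : `|f s - f y| <= e / 2 + C * (y - s) ^+ 2.
  have [sy|sy] := ltP `|s - y| r.
    apply: le_trans (near_s y sy) _.
    by rewrite lerDl mulr_ge0// sqr_ge0.
  apply: (@le_trans _ _ (2 * M)).
    by apply: le_trans (ler_normB _ _) _; have := fM s; have := fM y; lra.
  rewrite -[(y - s) ^+ 2]real_normK ?num_real// distrC.
  apply: ler_wpDl; first by rewrite ltW// divr_gt0.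
  rewrite /C mulrAC ler_pdivlMr ?exprn_gt0// ler_wpM2l ?mulr_ge0//.
  by rewrite ler_pXn2r ?nnegrE ?(ltW r0).
have main n : `|f s - bern n.+1 (fun k => f (k%:R / n.+1%:R)) s| <=
    e / 2 + C * n.+1%:R^-1.
  set N := n.+1; have N0 : (0 : R) < N%:R by [].
  have -> : f s - bern N (fun k => f (k%:R / N%:R)) s =
      bern N (fun k => f s - f (k%:R / N%:R)) s.
    rewrite -[RHS](_ : bern N (fun k => f s + -1 * f (k%:R / N%:R)) s = _).
      by rewrite bern_affine mulN1r.
    by congr bern; apply/funext => k; rewrite mulN1r.
  have -> : e / 2 + C * N%:R^-1 = e / 2 + C / N%:R ^+ 2 * N%:R.
    by rewrite expr2 invfM -!mulrA mulVf ?mulr1// gt_eqF.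
  pose h (k : nat) := e / 2 + C / N%:R ^+ 2 * (k%:R - N%:R * s) ^+ 2.
  have bern_h : bern N h s <= e / 2 + C / N%:R ^+ 2 * N%:R.
    rewrite bern_affine bern_variance subrr expr0n/= add0r lerD2l.
    apply: ler_wpM2l; first by rewrite divr_ge0 ?sqr_ge0.
    rewrite -mulrA ler_piMr ?(ltW N0)// mulr_ile1 ?subr_ge0//; lra.
  have fh k : `|f s - f (k%:R / N%:R)| <= h k.
    apply: le_trans (osc _) _; rewrite /h lerD2l.
    rewrite -mulrA ler_wpM2l// -exprVn -exprMn.
    by rewrite (_ : k%:R / N%:R - s = N%:R^-1 * (k%:R - N%:R * s))//; field;
      rewrite gt_eqF.
  rewrite ler_norml; apply/andP; split; last first.
    apply: le_trans bern_h; apply: le_bern => // k.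
    exact: le_trans (ler_norm _) (fh k).
  rewrite lerNl; apply: le_trans bern_h.
  rewrite -mulN1r -[X in X <= _]add0r -bern_affine; apply: le_bern => // k.
  rewrite add0r mulN1r; apply: le_trans (fh k).
  by rewrite -normrN ler_norm.
have [n0 _ hn0] : \forall n \near \oo, C * n.+1%:R^-1 <= e / 2.
  have : C * n.+1%:R^-1 @[n --> \oo] --> C * 0.
    by apply: cvgM; [exact: cvg_cst|exact: cvg_harmonic].
  rewrite mulr0 => /cvgrPdist_le/(_ (e / 2)); rewrite divr_gt0// => /(_ isT).
  apply: filterS => n; rewrite sub0r normrN; exact: le_trans (ler_norm _).
exists n0 => // n /hn0 hn; apply: le_trans (main n) _.
by rewrite [leRHS](splitr e) lerD2l.
Qed.

End bernstein.

Section trigonometric_polynomials.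
Context {R : realType}.
Implicit Types (l : seq (R * R * R)) (f g : R -> R).

Definition trig_poly l (x : R) : R :=
  \sum_(p <- l) p.1.1 * cos (p.1.2 * x + p.2).

Definition is_trig f := exists l, f = trig_poly l.

Lemma is_trig_cos (a u psi : R) : is_trig (fun x => a * cos (u * x + psi)).
Proof.
by exists [:: (a, u, psi)]; apply/funext => x; rewrite /trig_poly big_seq1.
Qed.

Lemma is_trigD f g : is_trig f -> is_trig g -> is_trig (fun x => f x + g x).
Proof.
move=> [l1 ->] [l2 ->]; exists (l1 ++ l2); apply/funext => x.
by rewrite /trig_poly big_cat.
Qed.

Lemma is_trig_cst (a : R) : is_trig (fun=> a).
Proof.
have := is_trig_cos a 0 0; congr is_trig.
by apply/funext => x; rewrite mul0r addr0 cos0 mulr1.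
Qed.

Lemma is_trigM f g : is_trig f -> is_trig g -> is_trig (fun x => f x * g x).
Proof.
move=> [l1 ->] [l2 ->].
exists (flatten [seq flatten [seq
  [:: (p.1.1 * q.1.1 / 2, p.1.2 - q.1.2, p.2 - q.2);
      (p.1.1 * q.1.1 / 2, p.1.2 + q.1.2, p.2 + q.2)] | q <- l2] | p <- l1]).
apply/funext => x; rewrite /trig_poly big_flatten big_map mulr_suml.
apply: eq_bigr => p _; rewrite big_flatten big_map mulr_sumr.
apply: eq_bigr => q _; rewrite !big_cons big_nil /=.
rewrite mulrACA cosM addr0 mulrDr !mulrA; congr (_ * cos _ + _ * cos _); ring.
Qed.

Lemma is_trig_bern n (c : nat -> R) f : is_trig f ->
  is_trig (fun x => bern n c (f x)).
Proof.
move=> tf; elim: n c => [|n IH] c /=; first exact: is_trig_cst.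
apply: is_trigD; apply: is_trigM => //; apply: is_trigD; first exact: is_trig_cst.
have := is_trigM (is_trig_cst (-1)) tf; congr is_trig.
by apply/funext => x; rewrite mulN1r.
Qed.

Lemma continuous_trig_poly l : continuous (trig_poly l).
Proof.
rewrite /trig_poly => x; apply: cvg_big => [|p _]; first exact: add_continuous.
have cp : continuous (fun x : R => p.1.1 * cos (p.1.2 * x + p.2)).
  by move=> y; exact: is_derive_continuous.
exact: cp.
Qed.

(** Composing Bernstein polynomials with (1 + sin (x / L)) / 2, which is
    injective on [-L, L], approximates a bounded continuous function on that
    interval and keeps its bound on the whole line. *)
Lemma trig_cvg (h : R -> R) (L M : R) : 0 < L -> continuous h ->
  (forall x, `|h x| <= M) ->
  exists q : nat -> R -> R, [/\ forall n, is_trig (q n),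
    forall n x, `|q n x| <= M &
    forall x, `|x| <= L -> q n x @[n --> \oo] --> h x].
Proof.
move=> L0 ch hM.
pose s x : R := 2^-1 + 2^-1 * sin (x / (2 * L)).
pose f y := h (2 * L * asin (2 * y - 1)).
have s01 x : 0 <= s x <= 1.
  have := sin_le1 (x / (2 * L)); have := sin_geN1 (x / (2 * L)).
  by rewrite /s => h1 h2; apply/andP; split; lra.
exists (fun n x => bern n.+1 (fun k => f (k%:R / n.+1%:R)) (s x)); split.
- move=> n; apply: is_trig_bern; apply: is_trigD; first exact: is_trig_cst.
  have := is_trig_cos 2^-1 (2 * L)^-1 (- (pi / 2)); congr is_trig.
  by apply/funext => x; rewrite cosBpihalf mulrC [x / (2 * L)]mulrC mulrC.
- by move=> n x; apply: norm_bern_le => // k; exact: hM.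
move=> x xL; have pi2 := pi_ge2 R.
have L20 : 0 < 2 * L by rewrite mulr_gt0.
have : `|x / (2 * L)| <= 2^-1.
  rewrite normrM normfV (gtr0_norm L20) ler_pdivrMr//; lra.
rewrite ler_norml => /andP[xL1 xL2].
have sE : 2 * s x - 1 = sin (x / (2 * L)) by rewrite /s; lra.
have -> : h x = f (s x).
  rewrite /f sE sinK ?in_itv/=; last by apply/andP; split; lra.
  by rewrite mulrCA divff ?mulr1// gt_eqF.
apply: (@bern_cvg R f (s x) M) => //; first by move=> y; exact: hM.
have sin_lt1 : -1 < sin (x / (2 * L)) < 1.
  have bnd (y : R) : - (pi / 2) < y < pi / 2 -> sin y < 1.
    move=> /andP[y1 y2]; rewrite -[ltRHS]sin_pihalf ltr_sin// in_itv/=;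
      apply/andP; split; lra.
  rewrite bnd ?andbT; last by apply/andP; split; lra.
  by rewrite ltrNl -sinN bnd//; apply/andP; split; lra.
have casin : {for s x, continuous (fun y : R => asin (2 * y - 1))}.
  apply: (@continuous_comp _ _ _ (fun y : R => 2 * y - 1) asin).
    exact: is_derive_continuous.
  by rewrite /= sE; exact: continuous_asin.
apply: (@continuous_comp _ _ _ (fun y : R => 2 * L * asin (2 * y - 1)) h); last exact: ch.
exact: (continuousM (@cst_continuous _ _ (2 * L) (s x)) casin).
Qed.

End trigonometric_polynomials.

Section clip.
Context {R : realType}.
Implicit Types M x y : R.

Definition clip M x : R := Num.max (- M) (Num.min M x).

Lemma clipP M x : 0 <= M ->
  [\/ clip M x = x /\ - M <= x <= M, clip M x = M /\ M <= x |
      clip M x = - M /\ x <= - M].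
Proof.
move=> M0; rewrite /clip; case: (leP x M) => xM.
  case: (leP (- M) x) => h; first by constructor 1.
  by constructor 3; split=> //; exact: ltW.
have -> : Num.max (- M) M = M by apply/max_idPr; lra.
by constructor 2; split=> //; exact: ltW.
Qed.

Lemma norm_clip_le M x : 0 <= M -> `|clip M x| <= M.
Proof.
by move=> M0; rewrite ler_norml; case: (clipP x M0) => -[-> h]; lra.
Qed.

Lemma clip_lipschitz M x y : 0 <= M -> `|clip M x - clip M y| <= `|x - y|.
Proof.
move=> M0; wlog xy : x y / x <= y.
  move=> wl; case: (leP x y) => [/wl//|/ltW/wl]; by rewrite distrC (distrC y).
rewrite (ler0_norm (_ : x - y <= 0)) ?subr_le0// opprB ler_norml.
by case: (clipP x M0) => -[-> h1]; case: (clipP y M0) => -[-> h2]; lra.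
Qed.

Lemma clip_id M x : 0 <= M -> `|x| <= M -> clip M x = x.
Proof. by move=> M0; rewrite ler_norml; case: (clipP x M0) => -[-> h]; lra. Qed.

Lemma clip_tail M x : 0 < M -> `|x - clip M x| <= x ^+ 2 / M.
Proof.
move=> M0; have pos (z : R) : M <= z -> z - M <= z ^+ 2 / M.
  move=> Mz; apply: (@le_trans _ _ z); first by lra.
  by rewrite ler_pdivlMr// expr2 ler_wpM2l//; lra.
case: (clipP x (ltW M0)) => -[-> h].
- by rewrite subrr normr0 divr_ge0 ?sqr_ge0// ltW.
- by rewrite ger0_norm ?subr_ge0// pos.
- by rewrite ler0_norm; [rewrite -sqrrN opprB addrC pos; lra|lra].
Qed.

Lemma continuous_clip M : 0 <= M -> continuous (clip M).
Proof.
move=> M0 x; apply/cvgrPdist_le => e e0; near=> y.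
apply: le_trans (clip_lipschitz _ _ M0) _.
by near: y; move/cvgrPdist_le: (@cvg_id R (nbhs x)) => /(_ e e0).
Unshelve. all: by end_near. Qed.

End clip.

Lemma cvge0_near_le (R : realType) (T : Type) (F : set_system T)
    {FF : Filter F} (f : T -> \bar R) (e : R) : 0 < e ->
  f x @[x --> F] --> 0%E -> \forall x \near F, (f x <= e%:E)%E.
Proof.
move=> e0 /fine_cvgP[ffin /cvgrPdist_le/(_ e e0)].
apply: filterS2 ffin => x fx; rewrite sub0r normrN => fe.
by rewrite -(fineK fx) lee_fin (le_trans (ler_norm _)).
Qed.

Lemma ge0_integralD_EFin d (T : measurableType d) (R : realType)
    (m : {measure set T -> \bar R}) (f g : T -> R) :
  measurable_fun setT f -> measurable_fun setT g ->
  (forall x, 0 <= f x) -> (forall x, 0 <= g x) ->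
  (\int[m]_x (f x + g x)%:E = \int[m]_x (f x)%:E + \int[m]_x (g x)%:E)%E.
Proof.
move=> mf mg f0 g0; under eq_integral do rewrite EFinD.
by rewrite ge0_integralD//; try (by move=> x _; rewrite lee_fin);
  exact/measurable_EFinP.
Qed.

Lemma ge0_integralZl_EFin d (T : measurableType d) (R : realType)
    (m : {measure set T -> \bar R}) (c : R) (f : T -> R) :
  0 <= c -> measurable_fun setT f -> (forall x, 0 <= f x) ->
  (\int[m]_x (c * f x)%:E = c%:E * \int[m]_x (f x)%:E)%E.
Proof.
move=> c0 mf f0; under eq_integral do rewrite EFinM.
rewrite ge0_integralZl ?lee_fin//; first exact/measurable_EFinP.
by move=> x _; rewrite lee_fin.
Qed.

Section density.
Context {R : realType}.
Local Notation mu := (@lebesgue_measure R).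
Local Notation gam := (normal_prob (0 : R) 1).

Lemma normal_prob_Lebesgue_le (f : R -> R) : measurable_fun setT f ->
  (forall x, 0 <= f x) ->
  (\int[gam]_x (f x)%:E <= (normal_peak 1)%:E * \int[mu]_x (f x)%:E)%E.
Proof.
move=> mf f0; rewrite ge0_integral_normal_prob//; last exact/measurable_EFinP.
rewrite -ge0_integralZl_EFin ?normal_peak_ge0//.
apply: ge0_le_integral => //.
- by move=> x _; rewrite -EFinM lee_fin mulr_ge0// normal_pdf_ge0.
- by apply/measurable_EFinP/measurable_funM => //; exact: measurable_normal_pdf.
- by apply/measurable_EFinP/measurable_funM.
- by move=> x _; rewrite -EFinM lee_fin mulrC ler_wpM2r// normal_pdf_ub// oner_neq0.
Qed.

Lemma normal_prob_sqr : (\int[gam]_x (x ^+ 2)%:E = 1%:E)%E.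
Proof.
have s0 : (1 : R) != 0 := oner_neq0 R.
have [ix2 varE] := normal_pdf_sqr s0.
have mx2 : measurable_fun setT (fun x : R => x ^+ 2).
  by apply: continuous_measurable_fun => x; exact: is_derive_continuous.
by rewrite (integral_normal_prob mx2 ix2).2 varE expr1n.
Qed.

(** Trigonometric polynomials are dense in L^1 of the Gaussian law: truncate G,
    replace it on a long interval by a continuous function, and apply the
    previous approximation there; outside the interval everything is bounded
    and the Gaussian mass is small. *)
Lemma trig_dense (G : R -> R) (e : R) : measurable_fun setT G ->
  (\int[gam]_x (G x ^+ 2)%:E < +oo)%E -> 0 < e ->
  exists l, (\int[gam]_x (`|G x - trig_poly l x|)%:E <= e%:E)%E.
Proof.
move=> mG G2 e0.
have mx2 : measurable_fun setT (fun x : R => x ^+ 2).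
  by apply: continuous_measurable_fun => x; exact: is_derive_continuous.
pose e4 := e / 4; have e40 : 0 < e4 by rewrite divr_gt0.
pose V := fine (\int[gam]_x (G x ^+ 2)%:E).
have V0 : 0 <= V by apply: fine_ge0; apply: integral_ge0 => x _; rewrite lee_fin sqr_ge0.
have VE : (\int[gam]_x (G x ^+ 2)%:E = V%:E)%E.
  rewrite fineK// ge0_fin_numE//; apply: integral_ge0 => x _.
  by rewrite lee_fin sqr_ge0.
(* truncating at M costs at most V / M, and [- L, L] has mass at least
   1 - 1 / L^2 *)
pose M := 1 + V / e4.
have M0 : 0 < M by rewrite ltr_pwDl// divr_ge0// ltW.
pose L := 1 + 2 * M / e4.
have L1 : 1 <= L by rewrite lerDl divr_ge0// ?mulr_ge0// ltW.
have L0 : 0 < L by apply: lt_le_trans L1.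
pose D := `[- L, L]%classic : set R.
have mD : measurable D by exact: measurable_itv.
pose GM x := clip M (G x).
have mGM : measurable_fun setT GM.
  apply: (measurableT_comp (f := clip M)) => //.
  by apply: continuous_measurable_fun; exact: continuous_clip (ltW M0).
have muD : (mu D < +oo)%E.
  by rewrite /D lebesgue_measure_itv/= lte_fin; case: ifP => _; rewrite ltry.
have intGM : mu.-integrable D (EFin \o GM).
  apply: measurable_bounded_integrable => //; first exact: measurable_funTS.
  exists M; split; first exact: num_real.
  move=> x Mx y _; exact: le_trans (norm_clip_le _ (ltW M0)) (ltW Mx).
have [g_ [cg_ _ cvg_g]] := approximation_continuous_integrable mD muD intGM.
pose pk := normal_peak (1 : R).
have pk0 : 0 < pk by rewrite normal_peak_gt0// oner_neq0.
have [h ch hD] : exists2 h : R -> R, continuous h &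
    (\int[mu]_(x in D) (`|GM x - h x|)%:E <= (e4 / pk)%:E)%E.
  have [n0 _ hn0] : \forall n \near \oo,
      (\int[mu]_(x in D) `|(GM x - g_ n x)%:E| <= (e4 / pk)%:E)%E.
    by apply: cvge0_near_le cvg_g; rewrite divr_gt0.
  exists (g_ n0) => //.
  by have := hn0 n0 (leqnn n0).
pose hc x := clip M (h x).
have chc : continuous hc.
  move=> x; apply: (@continuous_comp _ _ _ h (clip M)); first exact: ch.
  exact: continuous_clip (ltW M0) _.
have hcM x : `|hc x| <= M by exact: norm_clip_le (ltW M0).
have [q [q_trig qM cvg_q]] := trig_cvg L0 chc hcM.
have mq n : measurable_fun setT (q n).
  have [l ->] := q_trig n.
  by apply: continuous_measurable_fun; exact: continuous_trig_poly.
have mhc : measurable_fun setT hc by exact: continuous_measurable_fun.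
have mh : measurable_fun setT h by exact: continuous_measurable_fun.
have mind : measurable_fun setT (\1_D : R -> R) by exact: measurable_indic.
pose f n x := `|hc x - q n x| * \1_D x.
have ind01 x : 0 <= (\1_D x : R) <= 1 by rewrite indicE; case: (_ \in _); rewrite /= ?lexx ?ler01.
have f0 n x : 0 <= f n x by have /andP[? _] := ind01 x; rewrite mulr_ge0.
have mf n : measurable_fun setT (f n).
  apply: measurable_funM => //; apply: measurableT_comp => //.
  exact: measurable_funB.
have f_cvg : (\int[gam]_x (f n x)%:E)%E @[n --> \oo] --> 0%E.
  rewrite -(integral0 gam setT).
  apply: (@dominated_cvg _ _ _ gam setT measurableT (fun n x => (f n x)%:E)
    (cst 0%E) (cst (2 * M)%:E)) => //.
  - by move=> n; apply/measurable_EFinP; exact: mf.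
  - move=> x _; apply: cvg_EFin; first by apply: nearW.
    have [xD|xD] := boolP (x \in D); last first.
      rewrite (_ : _ \o _ = cst 0); first exact: cvg_cst.
      by apply/funext => n /=; rewrite /f indicE (negbTE xD) mulr0.
    rewrite (_ : _ \o _ = fun n => `|hc x - q n x|); last first.
      by apply/funext => n /=; rewrite /f indicE xD mulr1.
    move/set_mem: xD; rewrite /D/= in_itv/= -ler_norml => /cvg_q qx.
    rewrite -(@normr0 _ R); apply: cvg_norm; rewrite -(subrr (hc x)).
    by apply: cvgB => //; exact: cvg_cst.
  - apply: (@integrable_bounded_RV _ _ _ gam (cst (2 * M)) (2 * M)) => //.
    by move=> w; rewrite ger0_norm// mulr_ge0// ltW.
  - move=> n x _; rewrite /= lee_fin ger0_norm ?f0//.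
    have /andP[i0 i1] := ind01 x.
    apply: (@le_trans _ _ `|hc x - q n x|); first by rewrite ler_piMr.
    by apply: le_trans (ler_normB _ _) _; have := hcM x; have := qM n x; lra.
have [n _ hn] := cvge0_near_le e40 f_cvg.
have {hn}fn_le : (\int[gam]_x (f n x)%:E <= e4%:E)%E by exact: (hn n (leqnn n)).
have [l ql] := q_trig n.
exists l; rewrite -ql.
(* errors of the truncation, of the continuous approximation on D, and outside
   D; f n is that of the trigonometric approximation on D *)
pose u1 x := M^-1 * G x ^+ 2.
pose u2 x := `|GM x - h x| * \1_D x.
pose u4 x := 2 * M / L ^+ 2 * x ^+ 2.
have mG2 : measurable_fun setT (fun x => G x ^+ 2).
  exact: (measurableT_comp mx2 mG).
have mu1 : measurable_fun setT u1 by apply: measurable_funM.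
have mu2 : measurable_fun setT u2.
  apply: measurable_funM => //; apply: measurableT_comp => //.
  exact: measurable_funB.
have mu4 : measurable_fun setT u4 by apply: measurable_funM.
have u10 x : 0 <= u1 x by rewrite mulr_ge0 ?sqr_ge0// invr_ge0 ltW.
have u20 x : 0 <= u2 x by have /andP[? _] := ind01 x; rewrite mulr_ge0.
have u40 x : 0 <= u4 x.
  by rewrite mulr_ge0 ?sqr_ge0// divr_ge0 ?sqr_ge0// mulr_ge0// ltW.
have Iu1 : (\int[gam]_x (u1 x)%:E <= e4%:E)%E.
  rewrite ge0_integralZl_EFin ?invr_ge0 ?(ltW M0)//; last first.
    by move=> x; exact: sqr_ge0.
  rewrite VE -EFinM lee_fin mulrC ler_pdivrMr//.
  rewrite /M mulrDr mulr1 [e4 * _]mulrC divfK ?gt_eqF// lerDr ltW//.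
have Iu2 : (\int[gam]_x (u2 x)%:E <= e4%:E)%E.
  apply: le_trans (normal_prob_Lebesgue_le mu2 u20) _.
  have -> : (\int[mu]_x (u2 x)%:E = \int[mu]_(x in D) (`|GM x - h x|)%:E)%E.
    rewrite [RHS]integral_mkcond; apply: eq_integral => x _.
    rewrite /u2 patchE indicE; case: ifP => _; first by rewrite mulr1.
    by rewrite mulr0.
  rewrite -/pk (_ : e4%:E = pk%:E * (e4 / pk)%:E)%E; last first.
    by rewrite -EFinM mulrC divfK// gt_eqF.
  by rewrite lee_pmul2l// lte_fin.
have Iu4 : (\int[gam]_x (u4 x)%:E <= e4%:E)%E.
  rewrite ge0_integralZl_EFin//; last 2 first.
  - by rewrite divr_ge0 ?sqr_ge0// mulr_ge0// ltW.
  - by move=> x; exact: sqr_ge0.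
  rewrite normal_prob_sqr -EFinM mulr1 lee_fin ler_pdivrMr ?exprn_gt0//.
  apply: (@le_trans _ _ (e4 * L)).
    have e4M : e4 * (2 * M / e4) = 2 * M by rewrite mulrC divfK// gt_eqF.
    by rewrite /L [leRHS]mulrDr mulr1 e4M lerDr ltW.
  by rewrite ler_pM2l// expr2 ler_peMl// ltW.
have ms3 := measurable_funD (mf n) mu4.
have ms2 := measurable_funD mu2 ms3.
have ms1 := measurable_funD mu1 ms2.
have s30 x : 0 <= f n x + u4 x by rewrite addr_ge0.
have s20 x : 0 <= u2 x + (f n x + u4 x) by rewrite addr_ge0.
apply: (@le_trans _ _ (\int[gam]_x (u1 x + (u2 x + (f n x + u4 x)))%:E)%E).
  apply: ge0_le_integral => //.
  - apply/measurable_EFinP; apply: measurableT_comp => //.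
    exact: (measurable_funB mG (mq n)).
  - exact/measurable_EFinP.
  - move=> x _; rewrite lee_fin.
    have h1 : `|G x - GM x| <= u1 x by rewrite /u1 mulrC; exact: clip_tail.
    have hu4 := u40 x; have hu2 := u20 x; have hfn := f0 n x.
    have [xL|Lx] := leP `|x| L.
      have iD : \1_D x = 1 :> R.
        by rewrite indicE mem_set// /D/= in_itv/= -ler_norml.
      have h2 : `|GM x - hc x| <= u2 x.
        have GMid : clip M (GM x) = GM x.
          by apply: clip_id; [exact: ltW|exact: norm_clip_le (ltW M0)].
        by have := clip_lipschitz (GM x) (h x) (ltW M0); rewrite GMid /u2 iD mulr1.
      have h3 : `|hc x - q n x| = f n x by rewrite /f iD mulr1.
      have -> : G x - q n x = (G x - GM x) + (GM x - hc x) + (hc x - q n x) by ring.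
      have := ler_normD (G x - GM x + (GM x - hc x)) (hc x - q n x).
      have := ler_normD (G x - GM x) (GM x - hc x).
      by lra.
    have h2 : `|GM x - q n x| <= u4 x.
      apply: (@le_trans _ _ (2 * M)).
        apply: le_trans (ler_normB _ _) _.
        by have := norm_clip_le (G x) (ltW M0); have := qM n x; rewrite -/(GM x); lra.
      rewrite /u4 mulrAC ler_pdivlMr ?exprn_gt0//.
      rewrite ler_wpM2l ?mulr_ge0 ?(ltW M0)// -[x ^+ 2]real_normK ?num_real//.
      by rewrite ler_pXn2r ?nnegrE ?(ltW L0)// ltW.
    have -> : G x - q n x = (G x - GM x) + (GM x - q n x) by ring.
    have := ler_normD (G x - GM x) (GM x - q n x).
    by lra.
rewrite (ge0_integralD_EFin gam mu1 ms2 u10 s20).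
rewrite (ge0_integralD_EFin gam mu2 ms3 u20 s30).
rewrite (ge0_integralD_EFin gam (mf n) mu4 (f0 n) u40).
have -> : e%:E = (e4%:E + (e4%:E + (e4%:E + e4%:E)))%E.
  by rewrite -!EFinD; congr EFin; rewrite /e4; lra.
by rewrite !leeD.
Qed.

End density.

(** * Waves of a Gaussian process *)

Section measurable_processes.
Context {R : realType} d (Omega : measurableType d).
Implicit Types F : R -> Omega -> R.

Lemma measurable_section F w : measurable_process F ->
  measurable_fun setT (F ^~ w).
Proof.
move=> mF; exact: (measurableT_comp mF (pair2_measurable w)).
Qed.

Lemma measurable_marginal F t : measurable_process F ->
  measurable_fun setT (F t).
Proof.
move=> mF; exact: (measurableT_comp mF (pair1_measurable t)).
Qed.

End measurable_processes.

Section gaussian_process_moments.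
Context {R : realType} d {Omega : measurableType d} (P : probability Omega R).
Variables (xi : R -> Omega -> R) (B : R -> R).
Hypothesis xi_meas : measurable_process xi.
Hypothesis xi_gauss : gaussian_process P xi.
Hypothesis xi_mean : forall t, ('E_P[xi t] = 0)%E.
Hypothesis xi_cov : forall s t, (\int[P]_w (xi s w * xi t w)%:E = (B (t - s))%:E)%E.
Hypothesis xi_var : B 0 = 1.
Implicit Types (l : seq (R * R)) (s t u phi psi : R).

Lemma measurable_xi t : measurable_fun setT (xi t).
Proof. exact: measurable_marginal. Qed.

(** Linear combination of values of the process, given as a list of pairs
    (coefficient, time). *)
Definition lin l w := \sum_(p <- l) p.1 * xi p.2 w.

Definition lin_cov l1 l2 : R :=
  \sum_(p <- l1) \sum_(q <- l2) p.1 * q.1 * B (q.2 - p.2).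

Lemma lin_cons u t l w : lin ((u, t) :: l) w = u * xi t w + lin l w.
Proof. by rewrite /lin big_cons. Qed.

Lemma measurable_lin l : measurable_fun setT (lin l).
Proof.
apply: measurable_sum => p; apply: measurable_funM => //.
exact: measurable_xi.
Qed.

Lemma xi_integrable_sqr t : P.-integrable setT (EFin \o (fun w => xi t w ^+ 2)).
Proof.
apply: (@integrable_of_integral_fin _ _ _ _ _ (B 0)).
- have mx2 : measurable_fun setT (fun x : R => x ^+ 2).
    by apply: continuous_measurable_fun => x; exact: is_derive_continuous.
  exact: (measurableT_comp mx2 (measurable_xi t)).
- by move=> w; exact: sqr_ge0.
- by rewrite -(subrr t) -xi_cov; under eq_integral do rewrite expr2.
Qed.

Lemma xi_integrable t : P.-integrable setT (EFin \o xi t).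
Proof. exact: integrable_sqr_RV (measurable_xi t) (xi_integrable_sqr t). Qed.

Lemma xi_integrable_mul s t :
  P.-integrable setT (EFin \o (fun w => xi s w * xi t w)).
Proof. by apply: integrable_mul_RV; first [exact: measurable_xi|exact: xi_integrable_sqr]. Qed.

Lemma lin_mean l : \int[P]_w (lin l w) = 0.
Proof.
have ip (p : R * R) : P.-integrable setT (EFin \o (fun w => p.1 * xi p.2 w)).
  rewrite (_ : EFin \o _ = fun w => (p.1%:E * (xi p.2 w)%:E)%E).
    by apply: integrableZl => //; exact: xi_integrable.
  by apply/funext => w; rewrite /= EFinM.
have [|_ ->] := @Rintegral_sum R _ _ P setT _ l (fun p w => p.1 * xi p.2 w) _ ip => //.
rewrite big1// => p _; rewrite RintegralZl//; last exact: xi_integrable.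
by have := xi_mean p.2; rewrite unlock /Rintegral => ->; rewrite mulr0.
Qed.

Lemma lin_integrable_mul l1 l2 :
  P.-integrable setT (EFin \o (fun w => lin l1 w * lin l2 w)) /\
  \int[P]_w (lin l1 w * lin l2 w) = lin_cov l1 l2.
Proof.
pose f (c : R * R * (R * R)) w := c.1.1 * c.2.1 * (xi c.1.2 w * xi c.2.2 w).
pose r := [seq (p, q) | p <- l1, q <- l2].
have intf c : P.-integrable setT (EFin \o f c).
  rewrite (_ : EFin \o _ = fun w =>
    ((c.1.1 * c.2.1)%:E * (xi c.1.2 w * xi c.2.2 w)%:E)%E).
    by apply: integrableZl => //; exact: xi_integrable_mul.
  by apply/funext => w; rewrite /= EFinM.
have fE : (fun w => lin l1 w * lin l2 w) = fun w => \sum_(c <- r) f c w.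
  apply/funext => w; rewrite big_allpairs /lin mulr_suml.
  apply: eq_bigr => p _; rewrite mulr_sumr; apply: eq_bigr => q _.
  by rewrite /f /=; ring.
rewrite fE; have [|-> ->] := @Rintegral_sum R _ _ P setT _ r f _ intf => //.
split=> //; rewrite big_allpairs; apply: eq_bigr => p _; apply: eq_bigr => q _.
rewrite /f /= RintegralZl//; last exact: xi_integrable_mul.
by rewrite /Rintegral xi_cov.
Qed.

Lemma gaussian_lin l : gaussian_law (pushforward P (lin l)).
Proof.
have := xi_gauss (map_tuple snd (in_tuple l)) (map_tuple fst (in_tuple l)).
congr (gaussian_law (pushforward P _)); apply/funext => w.
by rewrite /lin [RHS]big_tnth; apply: eq_bigr => i _; rewrite !tnth_map.
Qed.

Lemma lin_cov_ge0 l : 0 <= lin_cov l l.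
Proof.
by rewrite -(lin_integrable_mul l l).2; apply: Rintegral_ge0 => w _; rewrite -expr2 sqr_ge0.
Qed.

Lemma integral_cos_lin l psi :
  \int[P]_w cos (lin l w + psi) = cos psi * expR (- (lin_cov l l / 2)).
Proof.
have [ill covE] := lin_integrable_mul l l.
rewrite /Rintegral (@gaussian_cos _ _ _ _ _ (lin_cov l l))//.
- exact: measurable_lin.
- exact: gaussian_lin.
- have := lin_mean l; rewrite /Rintegral.
  have il : P.-integrable setT (EFin \o lin l).
    apply: integrable_sqr_RV; first exact: measurable_lin.
    by under eq_fun do rewrite expr2.
  by move=> h; rewrite -[LHS]fineK ?h//; exact: integrable_fin_num.
- rewrite -covE /Rintegral fineK; last exact: integrable_fin_num.
  by apply: eq_integral => w _; rewrite expr2.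
Qed.

Lemma integrable_cos_lin l psi : P.-integrable setT (EFin \o (fun w => cos (lin l w + psi))).
Proof.
apply: (@integrable_bounded_RV _ _ _ _ _ 1) => [|w].
  apply: (measurableT_comp (f := fun x : R => cos (x + psi))).
    by apply: continuous_measurable_fun => x; exact: is_derive_continuous.
  exact: measurable_lin.
by rewrite ler_norml cos_le1 cos_geN1.
Qed.

(** A wave of a standard normal variable minus its mean, which is given by the
    Fourier transform of the normal density. *)
Definition cwave u phi (x : R) : R :=
  cos (u * x + phi) - cos phi * expR (- (u ^+ 2 / 2)).

Lemma norm_cwave_le u phi x : `|cwave u phi x| <= 2.
Proof.
apply: le_trans (ler_normB _ _) _; rewrite -[2]/(1 + 1); apply: lerD.
  by rewrite ler_norml cos_le1 cos_geN1.
rewrite normrM -[leRHS]mulr1 ler_pM//; first by rewrite ler_norml cos_le1 cos_geN1.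
rewrite ger0_norm ?expR_ge0// -[leRHS]expR0 ler_expR oppr_le0.
by rewrite divr_ge0 ?sqr_ge0.
Qed.

Lemma measurable_cwave u phi : measurable_fun setT (cwave u phi).
Proof.
by apply: continuous_measurable_fun => x; exact: is_derive_continuous.
Qed.

Lemma expRN_lipschitz (x y : R) : 0 <= x -> 0 <= y ->
  `|expR (- x) - expR (- y)| <= `|x - y|.
Proof.
move=> x0 y0; wlog xy : x y x0 y0 / x <= y.
  move=> wl; case: (leP x y) => [/wl->//|/ltW/wl h].
  by rewrite distrC (distrC x); exact: h.
have e1 : expR (- x) <= 1 by rewrite -[leRHS]expR0 ler_expR oppr_le0.
have exy : expR (- y) <= expR (- x) by rewrite ler_expR lerN2.
rewrite ger0_norm ?subr_ge0// ler0_norm ?subr_le0// opprB.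
have -> : expR (- y) = expR (- x) * expR (- (y - x)).
  by rewrite -expRD; congr expR; ring.
rewrite -[X in X - _]mulr1 -mulrBr.
have h := expR_ge1Dx (- (y - x)).
have p := expR_ge0 (- x).
apply: (@le_trans _ _ (expR (- x) * (y - x))); first by rewrite ler_wpM2l//; lra.
by rewrite ler_piMl// subr_ge0.
Qed.

Lemma covariance_sym s t : B (t - s) = B (s - t).
Proof.
have := xi_cov s t; under eq_integral do rewrite mulrC.
by rewrite xi_cov => -[].
Qed.

Lemma lin_cov_cons u t l : lin_cov ((u, t) :: l) ((u, t) :: l) =
  u ^+ 2 + 2 * u * lin_cov [:: (1, t)] l + lin_cov l l.
Proof.
rewrite /lin_cov !big_cons !big_nil /= subrr xi_var addr0.
under [X in _ + X = _]eq_bigr => p _ do rewrite big_cons.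
rewrite big_split /=.
have -> : \sum_(p <- l) p.1 * u * B (t - p.2) =
    u * \sum_(q <- l) 1 * q.1 * B (q.2 - t).
  by rewrite mulr_sumr; apply: eq_bigr => p _; rewrite covariance_sym; ring.
have -> : \sum_(q <- l) u * q.1 * B (q.2 - t) =
    u * \sum_(q <- l) 1 * q.1 * B (q.2 - t).
  by rewrite mulr_sumr; apply: eq_bigr => p _; ring.
by ring.
Qed.

Lemma norm_lin_cov_cons s u t l :
  `|lin_cov [:: (1, s)] ((u, t) :: l)| <= `|u| * `|B (t - s)| + `|lin_cov [:: (1, s)] l|.
Proof.
rewrite /lin_cov !big_seq1 big_cons /= mul1r.
by apply: le_trans (ler_normD _ _) _; rewrite normrM.
Qed.

(** By product-to-sum, the span of the waves of linear combinations of the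
    process is stable under multiplication by centred waves. *)
Lemma cwaveM u phi t l psi w :
  cwave u phi (xi t w) * cos (lin l w + psi) =
  2^-1 * cos (lin ((- u, t) :: l) w + (psi - phi)) +
  2^-1 * cos (lin ((u, t) :: l) w + (psi + phi)) -
  cos phi * expR (- (u ^+ 2 / 2)) * cos (lin l w + psi).
Proof.
rewrite /cwave mulrBl [X in X - _]mulrC cosM !lin_cons; congr (_ * cos _ + _ * cos _ - _);
  ring.
Qed.

(** With c the covariance of xi t and of the linear combination, the two terms of
    the product-to-sum formula have the mean that independence would give, up to
    a factor exp (u c) or exp (- u c). *)
Lemma cov_cwave_lin u phi t l psi :
  `|\int[P]_w (cwave u phi (xi t w) * cos (lin l w + psi))| <=
  `|u| * `|lin_cov [:: (1, t)] l|.
Proof.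
have iZ (c : R) l' psi' : P.-integrable setT (EFin \o (fun w => c * cos (lin l' w + psi'))).
  rewrite (_ : EFin \o _ = fun w => (c%:E * (cos (lin l' w + psi'))%:E)%E).
    by apply: integrableZl => //; exact: integrable_cos_lin.
  by apply/funext => w; rewrite /= EFinM.
under eq_Rintegral do rewrite cwaveM.
rewrite RintegralB//; last first.
  rewrite (_ : EFin \o _ = fun w => ((2^-1 * cos (lin ((- u, t) :: l) w + (psi - phi)))%:E
    + (2^-1 * cos (lin ((u, t) :: l) w + (psi + phi)))%:E)%E).
    by apply: integrableD => //; exact: iZ.
  by apply/funext => w; rewrite /= EFinD.
rewrite RintegralD//.
rewrite !RintegralZl//; try exact: integrable_cos_lin.
rewrite !integral_cos_lin.
have p1 := lin_cov_ge0 ((- u, t) :: l); have p2 := lin_cov_ge0 ((u, t) :: l).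
have p0 : 0 <= u ^+ 2 + lin_cov l l by rewrite addr_ge0 ?sqr_ge0 ?lin_cov_ge0.
move: p1 p2; rewrite !lin_cov_cons sqrrN.
set v := lin_cov l l in p0 *; set c := lin_cov [:: (1, t)] l.
have -> : forall a b x y : R, a * expR x * (b * expR y) = b * a * expR (x + y).
  by move=> a b x y; rewrite expRD; ring.
set x1 := u ^+ 2 + 2 * - u * c + v; set x2 := u ^+ 2 + 2 * u * c + v => p1 p2.
have -> : - (u ^+ 2 / 2) - v / 2 = - ((u ^+ 2 + v) / 2) by lra.
rewrite cosM.
set e0 := expR (- ((u ^+ 2 + v) / 2)).
have h1 : `|expR (- (x1 / 2)) - e0| <= `|u * c|.
  apply: le_trans (expRN_lipschitz _ _) _; rewrite ?divr_ge0//.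
  by rewrite (_ : _ - _ = - (u * c)) ?normrN// /x1; lra.
have h2 : `|expR (- (x2 / 2)) - e0| <= `|u * c|.
  apply: le_trans (expRN_lipschitz _ _) _; rewrite ?divr_ge0//.
  by rewrite (_ : _ - _ = u * c)// /x2; lra.
have -> : forall C1 C2 E1 E2 : R, 2^-1 * (C1 * E1) + 2^-1 * (C2 * E2) -
    (2^-1 * C1 + 2^-1 * C2) * e0 =
    2^-1 * (C1 * (E1 - e0)) + 2^-1 * (C2 * (E2 - e0)) by move=> *; ring.
have bnd (C E : R) : `|C| <= 1 -> `|E| <= `|u * c| -> `|2^-1 * (C * E)| <= 2^-1 * `|u * c|.
  move=> C1 E1; rewrite normrM normfV normr_nat ler_pM2l// normrM -[leRHS]mul1r.
  by rewrite ler_pM.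
have cos1 (x : R) : `|cos x| <= 1 by rewrite ler_norml cos_le1 cos_geN1.
rewrite -normrM; apply: le_trans (ler_normD _ _) _.
have := bnd _ _ (cos1 (psi - phi)) h1; have := bnd _ _ (cos1 (psi + phi)) h2.
by lra.
Qed.

(** Induction on the number of waves: each one is absorbed into the linear
    combination, whose covariance with xi s it changes by u B (t - s). *)
Lemma cov_cwaves u phi s ts l psi :
  `|\int[P]_w (cwave u phi (xi s w) *
      ((\prod_(t <- ts) cwave u phi (xi t w)) * cos (lin l w + psi)))| <=
  2 ^+ size ts * (`|u| * `|lin_cov [:: (1, s)] l| +
    u ^+ 2 * \sum_(t <- ts) `|B (t - s)|).
Proof.
have cos1 (x : R) : `|cos x| <= 1 by rewrite ler_norml cos_le1 cos_geN1.
elim: ts l psi => [|t ts IH] l psi.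
  under eq_Rintegral do rewrite big_nil mul1r.
  by rewrite big_nil mulr0 addr0 expr0 mul1r; exact: cov_cwave_lin.
pose f l' psi' w := cwave u phi (xi s w) *
  ((\prod_(t <- ts) cwave u phi (xi t w)) * cos (lin l' w + psi')).
have mprod : measurable_fun setT (fun w => \prod_(t <- ts) cwave u phi (xi t w)).
  by apply: measurable_prod => t' _; exact: (measurableT_comp (measurable_cwave _ _) (measurable_xi t')).
have intf l' psi' : P.-integrable setT (EFin \o f l' psi').
  apply: (@integrable_bounded_RV _ _ _ _ _ (2 * 2 ^+ size ts)).
    apply: measurable_funM; first exact: (measurableT_comp (measurable_cwave _ _) (measurable_xi s)).
    apply: measurable_funM => //.
    have := integrable_cos_lin l' psi'; by case/integrableP => /measurable_EFinP.
  move=> w; rewrite /f normrM ler_pM ?norm_cwave_le// normrM.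
  rewrite -[leRHS]mulr1 ler_pM//.
  elim: ts {IH f mprod} => [|t' ts IH]; first by rewrite big_nil normr1.
  by rewrite big_cons normrM exprS ler_pM ?norm_cwave_le.
pose m := cos phi * expR (- (u ^+ 2 / 2)).
have m1 : `|m| <= 1.
  rewrite normrM -[leRHS]mulr1 ler_pM// ger0_norm ?expR_ge0// -[leRHS]expR0.
  by rewrite ler_expR oppr_le0 divr_ge0 ?sqr_ge0.
have -> : \int[P]_w (cwave u phi (xi s w) *
      ((\prod_(t <- t :: ts) cwave u phi (xi t w)) * cos (lin l w + psi))) =
    2^-1 * \int[P]_w f ((- u, t) :: l) (psi - phi) w +
    2^-1 * \int[P]_w f ((u, t) :: l) (psi + phi) w - m * \int[P]_w f l psi w.
  have iZ (c : R) l' psi' : P.-integrable setT (EFin \o (fun w => c * f l' psi' w)).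
    rewrite (_ : EFin \o _ = fun w => (c%:E * (f l' psi' w)%:E)%E).
      by apply: integrableZl => //; exact: intf.
    by apply/funext => w; rewrite /= EFinM.
  have iD (c c' : R) l1 p1 l2 p2 :
      P.-integrable setT (EFin \o (fun w => c * f l1 p1 w + c' * f l2 p2 w)).
    rewrite (_ : EFin \o _ = fun w => ((c * f l1 p1 w)%:E + (c' * f l2 p2 w)%:E)%E).
      by apply: integrableD => //; exact: iZ.
    by apply/funext => w; rewrite /= EFinD.
  rewrite -!RintegralZl// -RintegralD// -RintegralB//.
  apply: eq_Rintegral => w _; rewrite big_cons /f /m.
  rewrite [cwave u phi (xi t w) * _ * _]mulrAC cwaveM; ring.
have fIH l' psi' : `|\int[P]_w f l' psi' w| <= 2 ^+ size ts *
    (`|u| * `|lin_cov [:: (1, s)] l'| + u ^+ 2 * \sum_(t <- ts) `|B (t - s)|).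
  exact: IH.
have cN : `|lin_cov [:: (1, s)] ((- u, t) :: l)| <=
    `|u| * `|B (t - s)| + `|lin_cov [:: (1, s)] l|.
  by rewrite -[X in X * _]normrN; exact: norm_lin_cov_cons.
have cP := norm_lin_cov_cons s u t l.
have c0P : `|lin_cov [:: (1, s)] l| <= `|u| * `|B (t - s)| + `|lin_cov [:: (1, s)] l|.
  by rewrite lerDr mulr_ge0.
rewrite big_cons [size _]/= exprS -mulrA.
pose Q := 2 ^+ size ts * (`|u| * `|lin_cov [:: (1, s)] l| +
    u ^+ 2 * (`|B (t - s)| + \sum_(t0 <- ts) `|B (t0 - s)|)).
have leQ l' psi' : `|lin_cov [:: (1, s)] l'| <=
    `|u| * `|B (t - s)| + `|lin_cov [:: (1, s)] l| -> `|\int[P]_w f l' psi' w| <= Q.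
  move=> cl; apply: le_trans (fIH l' psi') _; rewrite ler_wpM2l ?exprn_ge0//.
  rewrite mulrDr addrA lerD2r -[u ^+ 2]real_normK ?num_real// expr2 -mulrA -mulrDr.
  by rewrite ler_wpM2l// addrC.
have q1 := leQ _ (psi - phi) cN; have q2 := leQ _ (psi + phi) cP.
have q3 := leQ _ psi c0P; rewrite -/Q.
have half (x : R) : `|x| <= Q -> `|2^-1 * x| <= 2^-1 * Q.
  by move=> xQ; rewrite normrM normfV normr_nat ler_pM2l.
have mq : `|m * \int[P]_w f l psi w| <= Q.
  by rewrite normrM; apply: le_trans q3; rewrite ler_piMl.
have := half _ q1; have := half _ q2.
set I1 := 2^-1 * \int[P]_w f _ (psi + phi) w.
set I2 := 2^-1 * \int[P]_w f _ (psi - phi) w; set I3 := m * _ in mq *.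
have := ler_normB (I2 + I1) I3; have := ler_normD I2 I1.
by clear - mq; lra.
Qed.

(** The case of three waves against one: the correlation is small as soon as the
    first time is far from the other three. *)
Lemma four_cwaves u phi t1 t2 t3 t4 :
  `|\int[P]_w (cwave u phi (xi t1 w) * cwave u phi (xi t2 w) *
       (cwave u phi (xi t3 w) * cwave u phi (xi t4 w)))| <=
  8 * u ^+ 2 * (`|B (t2 - t1)| + `|B (t3 - t1)| + `|B (t4 - t1)|).
Proof.
have := cov_cwaves u phi t1 [:: t2; t3; t4] [::] 0.
have -> : lin_cov [:: (1, t1)] [::] = 0.
  by rewrite /lin_cov big_seq1 big_nil.
rewrite normr0 mulr0 add0r !big_cons big_nil addr0 [2 ^+ _](_ : _ = 8); last first.
  by rewrite /= -natrX.
rewrite mulrA !addrA => h; apply: le_trans h.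
rewrite le_eqVlt; apply/orP; left; apply/eqP; congr `|_|.
apply: eq_Rintegral => w _; rewrite !big_cons big_nil mulr1 /lin big_nil add0r cos0.
by ring.
Qed.

End gaussian_process_moments.

(** * Exponential sums and autocorrelations *)

Section exponential_sums.
Context {R : realType}.
Implicit Types (n : nat) (a : nat -> R) (l psi : R).

Lemma sum_sqr_le (I : finType) (x : I -> R) :
  (\sum_i x i) ^+ 2 <= #|I|%:R * \sum_i x i ^+ 2.
Proof.
have -> : #|I|%:R * \sum_i x i ^+ 2 =
    \sum_i \sum_j (x i ^+ 2 / 2 + x j ^+ 2 / 2).
  under [RHS]eq_bigr do rewrite big_split/= sumr_const -mulr_suml.
  rewrite big_split/= sumrMnl -mulr_suml sumr_const -mulrnDl -splitr.
  by rewrite mulr_natl.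
rewrite expr2 mulr_suml; apply: ler_sum => i _; rewrite mulr_sumr.
apply: ler_sum => j _; rewrite -subr_ge0.
have -> : x i ^+ 2 / 2 + x j ^+ 2 / 2 - x i * x j = (x i - x j) ^+ 2 / 2 by field.
by rewrite divr_ge0// sqr_ge0.
Qed.

Lemma indic_sum_le1 m (C : pred 'I_m) : (forall x y, C x -> C y -> x = y) ->
  \sum_x (C x)%:R <= 1 :> R.
Proof.
move=> C1; have [x Cx|noC] := pickP C; last first.
  by rewrite big1// => x _; rewrite noC.
rewrite (bigD1 x)//= Cx big1 ?addr0// => y yx.
by case: (boolP (C y)) => // Cy; rewrite (C1 _ _ Cy Cx) eqxx in yx.
Qed.

(** Autocorrelation of the finite sequence a at lag h - n. *)
Definition autocorr n a (h : nat) : R :=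
  \sum_(k < n) \sum_(j < n) (k + n == j + h)%N%:R * (a k * a j).

Definition autocorr_energy n a : R := \sum_(h < 2 * n) autocorr n a h ^+ 2.

(** The square of the modulus of an exponential sum is the Fourier series of
    its autocorrelations, so the Cauchy-Schwarz inequality bounds it uniformly
    in the frequency. *)
Lemma exp_sum_le n a l psi :
  (\sum_(k < n) a k * cos (l * k%:R + psi)) ^+ 4 <=
    (2 * n)%:R * autocorr_energy n a.
Proof.
set A := \sum_(k < n) _; pose S := \sum_(k < n) a k * sin (l * k%:R + psi).
have sqrE : A ^+ 2 + S ^+ 2 =
    \sum_(h < 2 * n) cos (l * (h%:R - n%:R)) * autocorr n a h.
  under [RHS]eq_bigr do rewrite mulr_sumr.
  rewrite exchange_big/= /A /S !expr2 !mulr_suml -big_split/=.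
  apply: eq_bigr => k _.
  under [RHS]eq_bigr do rewrite mulr_sumr.
  rewrite exchange_big/= !mulr_sumr -big_split/=.
  apply: eq_bigr => j _.
  have lt_h : (k + n - j < 2 * n)%N by have := ltn_ord k; have := ltn_ord j; lia.
  rewrite (bigD1 (Ordinal lt_h))//= big1 ?addr0; last first.
    move=> h /eqP hne; case: eqP => [kh|]; last by rewrite mul0r mulr0.
    by case: hne; apply: val_inj => /=; lia.
  have -> : (k + n == j + (k + n - j))%N by have := ltn_ord j; lia.
  have -> : l * ((k + n - j)%:R - n%:R) = (l * k%:R + psi) - (l * j%:R + psi).
    rewrite natrB ?natrD; last by have := ltn_ord j; lia.
    by ring.
  by rewrite mul1r cosB; ring.
have A2 : A ^+ 2 <= \sum_(h < 2 * n) cos (l * (h%:R - n%:R)) * autocorr n a h.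
  by rewrite -sqrE lerDl sqr_ge0.
rewrite (_ : 4 = 2 * 2)%N// exprM.
apply: (@le_trans _ _
    ((\sum_(h < 2 * n) cos (l * (h%:R - n%:R)) * autocorr n a h) ^+ 2)).
  by rewrite ler_pXn2r ?nnegrE ?sqr_ge0// (le_trans (sqr_ge0 A)).
apply: le_trans (sum_sqr_le _) _; rewrite card_ord ler_wpM2l//.
apply: ler_sum => h _; rewrite exprMn ler_piMl ?sqr_ge0//.
Qed.

Lemma measurable_autocorr_energy d (T : measurableType d) n (a : nat -> T -> R) :
  (forall k, measurable_fun setT (a k)) ->
  measurable_fun setT (fun x => autocorr_energy n (fun k => a k x)).
Proof.
move=> ma; apply: measurable_sum => h; apply: measurable_funX.
apply: measurable_sum => k; apply: measurable_sum => j.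
by apply: measurable_funM => //; exact: measurable_funM.
Qed.

(** Given k and j, the constraints determine h, and j' from k': there are at most
    n choices left. The same holds given k and k', or k and j'. *)
Lemma lag_count n (be : nat -> nat -> R) : (forall i j, 0 <= be i j) ->
  \sum_(h < 2 * n) \sum_(k < n) \sum_(j < n) \sum_(k' < n) \sum_(j' < n)
    (k + n == j + h)%N%:R * (k' + n == j' + h)%N%:R *
    (be k j + be k k' + be k j') <=
  3 * n%:R * \sum_(k < n) \sum_(j < n) be k j.
Proof.
move=> be0.
pose w (k j h : nat) : R := (k + n == j + h)%N%:R.
have w0 k j h : 0 <= w k j h by rewrite ler0n.
have w_j k h : \sum_(j < n) w k j h <= 1.
  by apply: indic_sum_le1 => x y /eqP e1 /eqP e2; apply: val_inj => /=; lia.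
have w_k j h : \sum_(k < n) w k j h <= 1.
  by apply: indic_sum_le1 => x y /eqP e1 /eqP e2; apply: val_inj => /=; lia.
have w_h k j : \sum_(h < 2 * n) w k j h <= 1.
  by apply: indic_sum_le1 => x y /eqP e1 /eqP e2; apply: val_inj => /=; lia.
have n0 : 0 <= n%:R :> R by [].
have w_jh k : \sum_(h < 2 * n) \sum_(j < n) w k j h <= n%:R.
  rewrite exchange_big/=; apply: (@le_trans _ _ (\sum_(j < n) 1)).
    by apply: ler_sum => j _.
  by rewrite sumr_const card_ord.
set X := \sum_(k < n) \sum_(j < n) be k j.
have T1 : \sum_(h < 2 * n) \sum_(k < n) \sum_(j < n) \sum_(k' < n) \sum_(j' < n)
    w k j h * w k' j' h * be k j <= n%:R * X.
  apply: (@le_trans _ _ (\sum_(h < 2 * n) \sum_(k < n) \sum_(j < n)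
      n%:R * (w k j h * be k j))).
    apply: ler_sum => h _; apply: ler_sum => k _; apply: ler_sum => j _.
    apply: (@le_trans _ _ (\sum_(k' < n) w k j h * be k j)); last first.
      by rewrite sumr_const card_ord mulr_natl.
    apply: ler_sum => k' _.
    under eq_bigr do rewrite mulrAC.
    by rewrite -mulr_sumr ler_piMr// mulr_ge0.
  rewrite exchange_big/= /X mulr_sumr; apply: ler_sum => k _.
  rewrite exchange_big/= mulr_sumr; apply: ler_sum => j _.
  by rewrite -mulr_sumr -mulr_suml ler_wpM2l// ler_piMl.
have T2 : \sum_(h < 2 * n) \sum_(k < n) \sum_(j < n) \sum_(k' < n) \sum_(j' < n)
    w k j h * w k' j' h * be k k' <= n%:R * X.
  apply: (@le_trans _ _ (\sum_(h < 2 * n) \sum_(k < n) \sum_(j < n)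
      \sum_(k' < n) w k j h * be k k')).
    apply: ler_sum => h _; apply: ler_sum => k _; apply: ler_sum => j _.
    apply: ler_sum => k' _.
    under eq_bigr do rewrite mulrAC.
    by rewrite -mulr_sumr ler_piMr// mulr_ge0.
  rewrite exchange_big/= /X mulr_sumr; apply: ler_sum => k _.
  under eq_bigr do (under eq_bigr do rewrite -mulr_sumr; rewrite -mulr_suml).
  by rewrite -mulr_suml ler_wpM2r// sumr_ge0.
have T3 : \sum_(h < 2 * n) \sum_(k < n) \sum_(j < n) \sum_(k' < n) \sum_(j' < n)
    w k j h * w k' j' h * be k j' <= n%:R * X.
  apply: (@le_trans _ _ (\sum_(h < 2 * n) \sum_(k < n) \sum_(j < n)
      \sum_(j' < n) w k j h * be k j')).
    apply: ler_sum => h _; apply: ler_sum => k _; apply: ler_sum => j _.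
    rewrite exchange_big/=; apply: ler_sum => j' _.
    under eq_bigr do rewrite mulrAC.
    by rewrite -mulr_sumr ler_piMr// mulr_ge0.
  rewrite exchange_big/= /X mulr_sumr; apply: ler_sum => k _.
  under eq_bigr do (under eq_bigr do rewrite -mulr_sumr; rewrite -mulr_suml).
  by rewrite -mulr_suml ler_wpM2r// sumr_ge0.
have -> : 3 * n%:R * X = n%:R * X + n%:R * X + n%:R * X by ring.
apply: le_trans (lerD (lerD T1 T2) T3); rewrite -!big_split/= le_eqVlt.
apply/orP; left; apply/eqP.
apply: eq_bigr => h _; rewrite -!big_split/=; apply: eq_bigr => k _.
rewrite -!big_split/=; apply: eq_bigr => j _; rewrite -!big_split/=.
apply: eq_bigr => k' _; rewrite -!big_split/=; apply: eq_bigr => j' _.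
by rewrite -!mulrDr.
Qed.

Lemma sum_dist_le n (b : R -> R) : (forall x, b (- x) = b x) -> (forall x, 0 <= b x) ->
  \sum_(k < n) \sum_(j < n) b (j%:R - k%:R) <= 2 * n%:R * \sum_(m < n) b m%:R.
Proof.
move=> bN b0.
have one (k : 'I_n) : \sum_(j < n) b (j%:R - k%:R) <= 2 * \sum_(m < n) b m%:R.
  apply: (@le_trans _ _ (\sum_(j < n) \sum_(m < n)
      ((j == k + m :> nat)%N%:R * b m%:R + (k == j + m :> nat)%N%:R * b m%:R))).
    apply: ler_sum => j _.
    have pos (i : 'I_n) : 0 <= (j == k + i :> nat)%N%:R * b i%:R +
        (k == j + i :> nat)%N%:R * b i%:R by rewrite addr_ge0// mulr_ge0.
    have [kj|/ltnW jk] := leqP k j.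
      have lt_m : (j - k < n)%N by have := ltn_ord j; lia.
      rewrite (bigD1 (Ordinal lt_m))//= natrB// subnKC// eqxx mul1r -addrA lerDl.
      by rewrite addr_ge0 ?mulr_ge0// sumr_ge0.
    have lt_m : (k - j < n)%N by have := ltn_ord k; lia.
    rewrite (bigD1 (Ordinal lt_m))//= natrB// subnKC// eqxx mul1r.
    rewrite -[b (j%:R - _)]bN opprB.
    by apply: ler_wpDr; [exact: sumr_ge0|rewrite lerDr mulr_ge0].
  rewrite exchange_big/= mulr_sumr; apply: ler_sum => m _.
  rewrite big_split/= -!mulr_suml.
  have h1 : \sum_(j < n) (j == k + m :> nat)%N%:R <= 1 :> R.
    by apply: indic_sum_le1 => x y /eqP e1 /eqP e2; apply: val_inj => /=; lia.
  have h2 : \sum_(j < n) (k == j + m :> nat)%N%:R <= 1 :> R.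
    by apply: indic_sum_le1 => x y /eqP e1 /eqP e2; apply: val_inj => /=; lia.
  have := ler_wpM2r (b0 m%:R) h1; have := ler_wpM2r (b0 m%:R) h2; lra.
apply: le_trans (ler_sum _ (fun k _ => one k)) _.
by rewrite sumr_const card_ord -mulr_natl; lra.
Qed.

End exponential_sums.

(** * Integrals of the paths *)

Section process_integrals.
Context {R : realType} d (Omega : measurableType d) (P : probability Omega R).
Local Notation mu := (@lebesgue_measure R).

(** Tonelli's theorem turns a uniform bound on the expectations into one on the
    expected integral over [0, T], and Markov's inequality concludes. *)
Lemma tonelli_markov (F : R -> Omega -> R) (T C a : R) :
  measurable_process F -> (forall t w, 0 <= F t w) ->
  (forall t, (\int[P]_w (F t w)%:E <= C%:E)%E) -> 0 < T -> 0 < a ->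
  exists Bad, [/\ measurable Bad, (P Bad <= (C * T / a)%:E)%E &
    forall w, ~ Bad w -> mu.-integrable `[0, T] (EFin \o F ^~ w) /\
                         \int[mu]_(t in `[0, T]) F t w < a].
Proof.
move=> mF F0 FC T0 a0.
pose f (p : R * Omega) : \bar R := (F p.1 p.2 * \1_(`[0, T]%classic) p.1)%:E.
have mf : measurable_fun setT f.
  apply/measurable_EFinP; apply: measurable_funM => //.
  by apply: (measurableT_comp _ measurable_fst); exact: measurable_indic.
have f0 p : (0 <= f p)%E by rewrite lee_fin mulr_ge0.
have mG : measurable_fun setT (fubini_G mu f).
  exact: (@measurable_fun_fubini_tonelli_G _ _ _ _ _ mu _ mf f0).
have GE w : fubini_G mu f w = (\int[mu]_(t in `[0%R, T]) (F t w)%:E)%E.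
  rewrite /fubini_G [RHS]integral_mkcond; apply: eq_integral => t _.
  rewrite /f patchE indicE; case: ifP => _; first by rewrite mulr1.
  by rewrite mulr0.
have G0 w : (0 <= fubini_G mu f w)%E by apply: integral_ge0.
have intG : (\int[P]_w fubini_G mu f w <= (C * T)%:E)%E.
  rewrite -(@fubini_tonelli _ _ _ _ _ mu P f mf f0).
  have -> : (C * T)%:E = (\int[mu]_(t in `[0%R, T]) C%:E)%E.
    by rewrite integral_cst//= lebesgue_measure_itv/= lte_fin T0 sube0.
  rewrite [leRHS]integral_mkcond; apply: ge0_le_integral => //.
  - by move=> t _; exact: integral_ge0.
  - exact: (@measurable_fun_fubini_tonelli_F _ _ _ _ _ P _ mf f0).
  - by apply/(measurable_restrictT _ _).1 => //; exact: measurable_cst.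
  move=> t _; rewrite /fubini_F /f patchE /= indicE; case: ifP => _.
    under eq_integral do rewrite mulr1.
    exact: FC.
  under eq_integral do rewrite mulr0.
  by rewrite integral0.
pose Bad := [set w | (a%:E <= fubini_G mu f w)%E].
have mBad : measurable Bad.
  by rewrite -[Bad]setTI; exact: emeasurable_fun_c_infty.
exists Bad; split => //.
  have := @le_integral_comp_abse _ _ _ P setT measurableT (fubini_G mu f) a id
    (@measurable_id _ _ _) (fun=> id) (fun _ _ _ _ => id) mG a0.
  under eq_integral do rewrite gee0_abs//.
  under eq_set do rewrite gee0_abs//.
  have PBf : P Bad \is a fin_num by exact: fin_num_measure.
  rewrite setTI => /le_trans/(_ intG).
  move=> PB; have {}PB : (a%:E * P Bad <= (C * T)%:E)%E by exact: PB.
  move: PB; rewrite -(fineK PBf) -EFinM !lee_fin.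
  by rewrite ler_pdivlMr// mulrC.
move=> w /= /negP; rewrite -ltNge GE => lta.
have mw : measurable_fun (`[0, T]%classic : set R) (EFin \o F ^~ w).
  by apply/measurable_EFinP; apply: measurable_funTS; exact: measurable_section.
have int_w : mu.-integrable `[0, T] (EFin \o F ^~ w).
  apply/integrableP; split => //.
  under eq_integral do rewrite gee0_abs ?lee_fin//.
  exact: lt_le_trans lta (leey _).
by split=> //; rewrite -lte_fin /Rintegral fineK// integrable_fin_num.
Qed.

End process_integrals.

Section translation.
Context {R : realType}.
Local Notation mu := (@lebesgue_measure R).
Local Notation TR := (measurableTypeR R).

Lemma lebesgue_measureD (k : R) (A : set R) : measurable A ->
  pushforward mu (fun x : R => (x + k : TR)) A = mu A.
Proof.
move=> mA; have mk : measurable_fun [set: TR] (fun x : R => (x + k : TR)).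
  by apply: measurable_funD => //; exact: measurable_cst.
apply/esym/lebesgue_measure_unique => //= _ [[a b]] _ <-.
rewrite /pushforward.
have -> : (fun x : R => (x + k : TR)) @^-1` `]a, b] = `]a - k, b - k]%classic.
  by apply/seteqP; split => x /=; rewrite !in_itv/= ltrBlDr lerBrDr.
rewrite !lebesgue_measure_itv/= !lte_fin ltrD2r.
by case: ifP => // _; rewrite -!EFinB; congr (_ %:E); ring.
Qed.

Lemma Rintegral_shift (f : R -> R) (a b k : R) : measurable_fun setT f ->
  mu.-integrable `[a, b] (EFin \o (fun t => f (t + k))) ->
  \int[mu]_(t in `[a + k, b + k]) f t = \int[mu]_(t in `[a, b]) f (t + k).
Proof.
move=> mf intf; rewrite /Rintegral.
have mk : measurable_fun [set: TR] (fun x : R => (x + k : TR)).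
  by apply: measurable_funD => //; exact: measurable_cst.
have pre : (fun x : R => (x + k : TR)) @^-1` `[a + k, b + k] = `[a, b]%classic.
  by apply/seteqP; split => x /=; rewrite !in_itv/= !lerD2r.
have := @integral_pushforward _ _ _ TR R _ mk mu (`[a + k, b + k]%classic)
  (EFin \o f).
rewrite pre => <- //; last exact/measurable_EFinP.
congr fine; apply: eq_measure_integral => A mA _.
by apply/esym; exact: lebesgue_measureD.
Qed.

End translation.

Section energy_expectation.
Context {R : realType}.

Lemma Rintegral_sum_le d (U : measurableType d) (m : {measure set U -> \bar R})
    (I : finType) (f : I -> U -> R) (g : I -> R) :
    (forall i, m.-integrable setT (EFin \o f i) /\ \int[m]_x f i x <= g i) ->
  m.-integrable setT (EFin \o (fun x => \sum_i f i x)) /\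
  \int[m]_x (\sum_i f i x) <= \sum_i g i.
Proof.
move=> fg.
have [int_sum ->] := @Rintegral_sum R _ _ m setT I (index_enum I) f
  measurableT (fun i => (fg i).1).
by split=> //; apply: ler_sum => i _; exact: (fg i).2.
Qed.

Lemma autocorr_energyE n (a : nat -> R) : autocorr_energy n a =
  \sum_(h < 2 * n) \sum_(k < n) \sum_(j < n) \sum_(k' < n) \sum_(j' < n)
    (k + n == j + h)%N%:R * (k' + n == j' + h)%N%:R *
    (a k * a j * (a k' * a j')).
Proof.
apply: eq_bigr => h _; rewrite expr2 {1}/autocorr mulr_suml; apply: eq_bigr => k _.
rewrite mulr_suml; apply: eq_bigr => j _.
rewrite mulr_sumr; apply: eq_bigr => k' _.
rewrite mulr_sumr; apply: eq_bigr => j' _.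
by rewrite mulrACA.
Qed.

Context d {Omega : measurableType d} (P : probability Omega R).
Variables (xi : R -> Omega -> R) (B : R -> R).
Hypothesis xi_meas : measurable_process xi.
Hypothesis xi_gauss : gaussian_process P xi.
Hypothesis xi_mean : forall t, ('E_P[xi t] = 0)%E.
Hypothesis xi_cov : forall s t, (\int[P]_w (xi s w * xi t w)%:E = (B (t - s))%:E)%E.
Hypothesis xi_var : B 0 = 1.

Lemma measurable_cwave_xi u phi t : measurable_fun setT (fun w => cwave u phi (xi t w)).
Proof.
apply: (measurableT_comp (measurable_cwave u phi)).
exact: measurable_marginal xi_meas.
Qed.

(** The energy has of order n^3 terms, each bounded by covariances over gaps from
    its first index. Summing first over the indices that these gaps leave free
    gives n^2 times a partial sum of |B|, which is o(n^3) once B vanishes at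
    infinity. *)
Lemma expected_energy n u phi s :
  (\int[P]_w (autocorr_energy n (fun k => cwave u phi (xi (k%:R + s) w)))%:E <=
   (48 * u ^+ 2 * n%:R ^+ 2 * \sum_(m < n) `|B m%:R|)%:E)%E.
Proof.
pose f k w := cwave u phi (xi (k%:R + s) w).
pose be (i j : nat) := `|B (j%:R - i%:R)|.
have mf k : measurable_fun setT (f k) by exact: measurable_cwave_xi.
have f2 k w : `|f k w| <= 2 by exact: norm_cwave_le.
have shiftE (x y : R) : x + s - (y + s) = x - y by ring.
have term (k j k' j' h : nat) :
    P.-integrable setT (EFin \o (fun w => (k + n == j + h)%N%:R *
      (k' + n == j' + h)%N%:R * (f k w * f j w * (f k' w * f j' w)))) /\
    \int[P]_w ((k + n == j + h)%N%:R * (k' + n == j' + h)%N%:R *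
      (f k w * f j w * (f k' w * f j' w))) <=
    8 * u ^+ 2 * ((k + n == j + h)%N%:R * (k' + n == j' + h)%N%:R *
      (be k j + be k k' + be k j')).
  have intf : P.-integrable setT
      (EFin \o (fun w => f k w * f j w * (f k' w * f j' w))).
    apply: (@integrable_bounded_RV _ _ _ _ _ (2 * 2 * (2 * 2))).
      by do 2 apply: measurable_funM => //; exact: measurable_funM.
    by move=> w; rewrite !normrM !ler_pM// mulr_ge0.
  set c := (_ * _); have c0 : 0 <= c by rewrite mulr_ge0.
  split.
    rewrite (_ : _ \o _ = fun w =>
        (c%:E * (f k w * f j w * (f k' w * f j' w))%:E)%E).
      exact: integrableZl.
    by apply/funext => w; rewrite /= EFinM.
  rewrite RintegralZl//.
  rewrite [leRHS](_ : _ = c * (8 * u ^+ 2 * (be k j + be k k' + be k j'))).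
    apply: ler_wpM2l => //; apply: le_trans (ler_norm _) _.
    apply: le_trans (four_cwaves xi_meas xi_gauss xi_mean xi_cov xi_var _ _ _ _ _ _) _.
    by rewrite !shiftE.
  by rewrite mulrCA.
have [int_e le_e] : P.-integrable setT (EFin \o (fun w => autocorr_energy n (f ^~ w)))
    /\ \int[P]_w autocorr_energy n (f ^~ w) <=
      \sum_(h < 2 * n) \sum_(k < n) \sum_(j < n) \sum_(k' < n) \sum_(j' < n)
       8 * u ^+ 2 * ((k + n == j + h)%N%:R * (k' + n == j' + h)%N%:R *
      (be k j + be k k' + be k j')).
  have /funext -> := fun w => autocorr_energyE n (f ^~ w).
  do 5 apply: Rintegral_sum_le => ?.
  exact: term.
rewrite -[leLHS]fineK ?integrable_fin_num// lee_fin.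
apply: le_trans le_e _.
under eq_bigr do under eq_bigr do under eq_bigr do under eq_bigr do
  rewrite -mulr_sumr.
under eq_bigr do under eq_bigr do under eq_bigr do rewrite -mulr_sumr.
under eq_bigr do under eq_bigr do rewrite -mulr_sumr.
under eq_bigr do rewrite -mulr_sumr.
rewrite -mulr_sumr.
have u0 : 0 <= 8 * u ^+ 2 by rewrite mulr_ge0// sqr_ge0.
have be0 i j : 0 <= be i j by exact: normr_ge0.
apply: le_trans (ler_wpM2l u0 (lag_count n be0)) _.
have BN x : `|B (- x)| = `|B x|.
  by have := covariance_sym xi_cov 0 x; rewrite subr0 sub0r => ->.
have := @sum_dist_le R n (fun x => `|B x|) BN (fun x => normr_ge0 _).
move=> /(ler_wpM2l (ler0n R n)) /(ler_wpM2l u0) h.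
have -> : 48 * u ^+ 2 * n%:R ^+ 2 * (\sum_(m < n) `|B m%:R|) =
   3 * (8 * u ^+ 2 * (n%:R * (2 * n%:R * (\sum_(m < n) `|B m%:R|)))) by ring.
rewrite -(mulrA 3) (mulrCA _ 3); apply: ler_wpM2l => //.
Qed.

End energy_expectation.

(** * Bounds uniform in the frequency *)

Section unit_blocks.
Context {R : realType}.
Local Notation mu := (@lebesgue_measure R).
Implicit Types (f e : R -> R) (n : nat).

Lemma bounded_integrable_itv f (M a b : R) : measurable_fun setT f ->
  (forall t, `|f t| <= M) -> mu.-integrable `[a, b] (EFin \o f).
Proof.
move=> mf fM; apply: measurable_bounded_integrable => //.
- by rewrite /= lebesgue_measure_itv/=; case: ifP => // _; rewrite -EFinD ltry.
- exact: measurable_funTS.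
exists M; split; first exact: num_real.
by move=> x Mx t _; apply: le_trans (fM t) (ltW Mx).
Qed.

Lemma measurable_shift f (k : R) : measurable_fun setT f ->
  measurable_fun setT (fun t : R => f (t + k)).
Proof.
move=> mf; apply: (measurableT_comp mf).
by apply: measurable_funD => //; exact: measurable_cst.
Qed.

Lemma Rintegral_itv_split f (a x b M : R) : measurable_fun setT f ->
  (forall t, `|f t| <= M) -> a <= x -> x <= b ->
  \int[mu]_(t in `[a, b]) f t =
  \int[mu]_(t in `[a, x]) f t + \int[mu]_(t in `[x, b]) f t.
Proof.
move=> mf fM ax xb; apply/eqP; rewrite addrC -subr_eq; apply/eqP.
rewrite Rintegral_itvB ?bnd_simp//; last exact: bounded_integrable_itv fM.
rewrite Rintegral_itv_obnd_cbnd//.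
apply: integrableS (bounded_integrable_itv x b mf fM) => //.
by apply: subset_itvr; rewrite bnd_simp.
Qed.

Lemma Rintegral_blocks f n (M : R) : measurable_fun setT f ->
  (forall t, `|f t| <= M) ->
  \int[mu]_(t in `[0, n%:R]) f t =
  \int[mu]_(t in `[0, 1]) \sum_(k < n) f (t + k%:R).
Proof.
move=> mf fM.
have int_k (k : 'I_n) : mu.-integrable `[0, 1] (EFin \o (fun t => f (t + k%:R))).
  by apply: (bounded_integrable_itv _ _ (measurable_shift _ mf)) => t; exact: fM.
rewrite (@Rintegral_sum R _ _ mu `[0, 1]%classic _ (index_enum 'I_n)
  (fun k t => f (t + k%:R)) _ int_k).2//.
elim: n {int_k} => [|n IH]; first by rewrite big_ord0 set_itv1 Rintegral_set1.
rewrite big_ord_recr/= -IH (Rintegral_itv_split mf fM (x := n%:R))//; last first.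
  by rewrite ler_nat.
congr (_ + _); rewrite -Rintegral_shift//.
  by rewrite add0r -natr1 addrC.
by apply: (bounded_integrable_itv _ _ (measurable_shift _ mf)) => t; exact: fM.
Qed.

Lemma le_pow4_tail (y eta : R) : 0 <= y -> 0 < eta -> y <= eta + y ^+ 4 / eta ^+ 3.
Proof.
move=> y0 eta0; have [ye|/ltW ey] := leP y eta.
  by rewrite -[leLHS]addr0 lerD// divr_ge0// exprn_ge0// ltW.
rewrite -[leLHS]add0r lerD ?(ltW eta0)// ler_pdivlMr ?exprn_gt0//.
by rewrite [y ^+ 4]exprS ler_wpM2l// lerXn2r// nnegrE// ltW.
Qed.

(** A wave of frequency l takes at the points s + k values that form an
    exponential sum in k, so the autocorrelations of the sampled path control
    the integral of the path against all waves at once. *)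
Lemma Rintegral_blocks_le e n (eta l psi : R) : (0 < n)%N -> 0 < eta ->
  measurable_fun setT e -> (forall t, `|e t| <= 2) ->
  let F s := (2 * n)%:R / n%:R ^+ 4 * autocorr_energy n (fun k => e (k%:R + s)) in
  mu.-integrable `[0, 1] (EFin \o F) ->
  \int[mu]_(s in `[0, 1]) F s <= eta ^+ 4 ->
  `|\int[mu]_(t in `[0, n%:R]) (cos (l * t + psi) * e t)| <= 2 * eta * n%:R.
Proof.
move=> n0 eta0 me e2 F intF Feta.
pose f t := cos (l * t + psi) * e t.
have mcos : measurable_fun setT (fun t : R => cos (l * t + psi)).
  by apply: continuous_measurable_fun; exact: continuous_cos_affine.
have mf : measurable_fun setT f by exact: measurable_funM.
have f2 t : `|f t| <= 2.
  rewrite normrM -[leRHS]mul1r ler_pM//.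
  by rewrite ler_norml cos_le1 cos_geN1.
rewrite (Rintegral_blocks n mf f2).
have nr0 : 0 < n%:R :> R by rewrite ltr0n.
have mS : measurable_fun setT (fun s : R => \sum_(k < n) f (s + k%:R)).
  by apply: measurable_sum => k; exact: measurable_shift.
have S2 s : `|\sum_(k < n) f (s + k%:R)| <= 2 * n%:R.
  apply: le_trans (ler_norm_sum _ _ _) _.
  apply: le_trans (ler_sum _ (fun k _ => f2 _)) _.
  by rewrite sumr_const card_ord mulr_natr.
have intS := bounded_integrable_itv 0 1 mS S2.
have intG : mu.-integrable `[0, 1]
    (EFin \o (fun s => n%:R * eta + n%:R / eta ^+ 3 * F s)).
  rewrite (_ : _ \o _ = (fun s => (n%:R * eta)%:E + (n%:R / eta ^+ 3)%:E * (F s)%:E)%E).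
    apply: integrableD => //; last exact: integrableZl.
    by apply: continuous_integrable_itv; exact: cst_continuous.
  by apply/funext => s; rewrite /= EFinD EFinM.
apply: le_trans (le_normr_Rintegral _ intS) _ => //.
apply: (@le_trans _ _ (\int[mu]_(s in `[0, 1]) (n%:R * eta + n%:R / eta ^+ 3 * F s))).
  apply: le_Rintegral => //; first exact: integrable_norm.
  move=> s _.
  set A := \sum_(k < n) _.
  have A4 : (`|A| / n%:R) ^+ 4 <= F s.
    rewrite expr_div_n -normrX ger0_norm; last by rewrite -[4%N]/(2 * 2)%N exprM sqr_ge0.
    rewrite /F [leRHS]mulrAC ler_pM2r ?invr_gt0 ?exprn_gt0//.
    have -> : A = \sum_(k < n) e (k%:R + s) * cos (l * k%:R + (l * s + psi)).
      apply: eq_bigr => k _; rewrite /f mulrC (addrC s).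
      by congr (_ * cos _); ring.
    exact: exp_sum_le.
  have := @le_pow4_tail (`|A| / n%:R) eta (divr_ge0 (normr_ge0 _) (ler0n _ _)) eta0.
  rewrite ler_pdivrMr// => /le_trans; apply.
  rewrite mulrDl [eta * _]mulrC lerD2l -mulrA mulrC [_^-1 * _]mulrC.
  by rewrite ler_wpM2l// ler_wpM2r// invr_ge0 exprn_ge0// ltW.
rewrite RintegralD//; last 2 first.
- by apply: continuous_integrable_itv; exact: cst_continuous.
- rewrite (_ : _ \o _ = (fun s => (n%:R / eta ^+ 3)%:E * (F s)%:E)%E).
    exact: integrableZl.
  by apply/funext => s; rewrite /= EFinM.
rewrite Rintegral_itv_cst// mulr1 RintegralZl//.
have : n%:R / eta ^+ 3 * \int[mu]_(s in `[0, 1]) F s <= n%:R / eta ^+ 3 * eta ^+ 4.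
  by rewrite ler_wpM2l// divr_ge0 ?ler0n// exprn_ge0// ltW.
have -> : n%:R / eta ^+ 3 * eta ^+ 4 = n%:R * eta.
  by rewrite (exprSr eta 3) mulrA divfK// gt_eqF// exprn_gt0.
move=> h; have -> : 2 * eta * n%:R = n%:R * eta + n%:R * eta by ring.
by rewrite lerD2l.
Qed.

End unit_blocks.

(** * Noises uncorrelated with all waves *)

Section negligible_noise.
Context {R : realType} d {Omega : measurableType d} (P : probability Omega R).
Local Notation mu := (@lebesgue_measure R).
Implicit Types e : R -> Omega -> R.

(** The correlation with waves is o(T) in probability, uniformly over all waves;
    the exceptional event Bad spares measuring the supremum over them. *)
Definition negligible_noise e := forall eta delta : R, 0 < eta -> 0 < delta ->
  exists2 T1 : R, 0 < T1 & forall T, T1 <= T -> exists Bad,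
  [/\ measurable Bad, (P Bad <= delta%:E)%E & forall w, ~ Bad w ->
     mu.-integrable `[0, T] (EFin \o e ^~ w) /\
     forall l psi, `|\int[mu]_(t in `[0, T]) (cos (l * t + psi) * e t w)| <= eta * T].

Lemma negligible_noise0 : negligible_noise (fun _ _ => 0).
Proof.
move=> eta delta eta0 delta0; exists 1 => // T T1.
have T0 : 0 < T by apply: lt_le_trans T1.
exists set0; split; first exact: measurable0.
  by rewrite measure0 lee_fin ltW.
move=> w _; split.
  by apply: continuous_integrable_itv; exact: cst_continuous.
move=> l psi; under eq_Rintegral do rewrite mulr0.
by rewrite Rintegral_itv_cst// mul0r normr0 mulr_ge0// ltW.
Qed.

Lemma negligible_noiseZ_add (a : R) e1 e2 : negligible_noise e1 ->
  negligible_noise e2 -> negligible_noise (fun t w => a * e1 t w + e2 t w).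
Proof.
move=> n1 n2 eta delta eta0 delta0.
have a0 : 0 < `|a| + 1 by rewrite ltr_wpDl.
have eta2 : 0 < eta / 2 by rewrite divr_gt0.
have d2 : 0 < delta / 2 by rewrite divr_gt0.
have [S1 S10 h1] := n1 (eta / 2 / (`|a| + 1)) (delta / 2) (divr_gt0 eta2 a0) d2.
have [S2 S20 h2] := n2 (eta / 2) (delta / 2) eta2 d2.
exists (S1 + S2) => [|T ST]; first exact: addr_gt0.
have T1 : S1 <= T by apply: le_trans ST; rewrite lerDl ltW.
have T2 : S2 <= T by apply: le_trans ST; rewrite lerDr ltW.
have T0 : 0 < T by exact: lt_le_trans T1.
have [Bad1 [mB1 PB1 g1]] := h1 T T1.
have [Bad2 [mB2 PB2 g2]] := h2 T T2.
exists (Bad1 `|` Bad2); split; first exact: measurableU.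
  apply: le_trans (measureU2 _ mB1 mB2) _.
  by rewrite (splitr delta) EFinD; exact: leeD.
move=> w /not_orP[/g1 [i1 b1] /g2 [i2 b2]].
have ia1 : mu.-integrable `[0, T] (EFin \o (fun t => a * e1 t w)).
  rewrite (_ : _ \o _ = fun t => (a%:E * (e1 t w)%:E)%E); first exact: integrableZl.
  by apply/funext => t; rewrite /= EFinM.
split.
  rewrite (_ : _ \o _ = fun t => ((a * e1 t w)%:E + (e2 t w)%:E)%E).
    exact: integrableD.
  by apply/funext => t; rewrite /= EFinD.
move=> l psi.
have j1 := integrable_wave_mul l psi i1.
have j2 := integrable_wave_mul l psi i2.
have -> : \int[mu]_(t in `[0, T]) (cos (l * t + psi) * (a * e1 t w + e2 t w)) =
    a * \int[mu]_(t in `[0, T]) (cos (l * t + psi) * e1 t w) +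
    \int[mu]_(t in `[0, T]) (cos (l * t + psi) * e2 t w).
  rewrite -RintegralZl// -RintegralD//.
    by apply: eq_Rintegral => t _; rewrite mulrDr mulrCA.
  rewrite (_ : _ \o _ = fun t => (a%:E * (cos (l * t + psi) * e1 t w)%:E)%E).
    exact: integrableZl.
  by apply/funext => t; rewrite /= EFinM.
apply: le_trans (ler_normD _ _) _.
rewrite (splitr eta) mulrDl; apply: lerD; last exact: b2.
rewrite normrM; apply: le_trans (ler_wpM2l (normr_ge0 a) (b1 l psi)) _.
rewrite mulrA ler_pM2r// mulrCA -[leRHS]mulr1 ler_wpM2l ?(ltW eta2)//.
by rewrite ler_pdivrMr// mul1r lerDl.
Qed.

(** An approximation in mean, uniform in time, changes the integrals against
    waves by at most the integral of the absolute error. *)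
Lemma negligible_noise_approx e :
  measurable_process e ->
  (forall delta, 0 < delta -> exists f, [/\ measurable_process f,
    negligible_noise f &
    forall t, (\int[P]_w (`|e t w - f t w|)%:E <= delta%:E)%E]) ->
  negligible_noise e.
Proof.
move=> me approx eta delta eta0 delta0.
have eta2 : 0 < eta / 2 by rewrite divr_gt0.
have d2 : 0 < delta / 2 by rewrite divr_gt0.
have [f [mf nf ef]] := approx (eta / 2 * (delta / 2)) (mulr_gt0 eta2 d2).
have [T1 T10 h] := nf _ _ eta2 d2.
exists T1 => // T TT1; have T0 : 0 < T by exact: lt_le_trans TT1.
have [Bad1 [mB1 PB1 g1]] := h T TT1.
have mD : measurable_process (fun t w => `|e t w - f t w|).
  by apply: measurableT_comp => //; exact: measurable_funB.
have [Bad2 [mB2 PB2 g2]] := tonelli_markov mD (fun _ _ => normr_ge0 _) ef T0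
  (mulr_gt0 eta2 T0).
exists (Bad1 `|` Bad2); split; first exact: measurableU.
  apply: le_trans (measureU2 _ mB1 mB2) _.
  rewrite (splitr delta) EFinD; apply: leeD => //; apply: le_trans PB2 _.
  rewrite lee_fin le_eqVlt; apply/orP; left; apply/eqP.
  by field; rewrite !gt_eqF.
move=> w /not_orP[/g1 [i1 b1] /g2 [i2 b2]].
have mdw : measurable_fun (`[0, T]%classic : set R) (fun t => e t w - f t w).
  by apply: measurable_funTS; apply: measurable_funB; exact: measurable_section.
have idw : mu.-integrable `[0, T] (EFin \o (fun t => e t w - f t w)).
  apply: le_integrable i2 => //; first exact/measurable_EFinP.
  by move=> t _ /=; rewrite normr_id.
have iew : mu.-integrable `[0, T] (EFin \o e ^~ w).
  rewrite (_ : _ \o _ = fun t => ((e t w - f t w)%:E + (f t w)%:E)%E).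
    exact: integrableD.
  by apply/funext => t; rewrite /= -EFinD subrK.
split=> // l psi.
have jd := integrable_wave_mul l psi idw.
have jf := integrable_wave_mul l psi i1.
have -> : \int[mu]_(t in `[0, T]) (cos (l * t + psi) * e t w) =
    \int[mu]_(t in `[0, T]) (cos (l * t + psi) * (e t w - f t w)) +
    \int[mu]_(t in `[0, T]) (cos (l * t + psi) * f t w).
  rewrite -RintegralD//; apply: eq_Rintegral => t _.
  by rewrite -mulrDr subrK.
apply: le_trans (ler_normD _ _) _.
rewrite (splitr eta) mulrDl; apply: lerD; last exact: b1.
apply: le_trans (le_normr_Rintegral _ jd) _ => //.
apply: le_trans (ltW b2); apply: le_Rintegral => //; first exact: integrable_norm.
move=> t _; rewrite normrM -[leRHS]mul1r ler_wpM2r//.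
by rewrite ler_norml cos_le1 cos_geN1.
Qed.

End negligible_noise.

Section negligible_wave.
Context {R : realType} d {Omega : measurableType d} (P : probability Omega R).
Local Notation mu := (@lebesgue_measure R).
Variables (xi : R -> Omega -> R) (B : R -> R).
Hypothesis xi_meas : measurable_process xi.
Hypothesis xi_gauss : gaussian_process P xi.
Hypothesis xi_mean : forall t, ('E_P[xi t] = 0)%E.
Hypothesis xi_cov : forall s t, (\int[P]_w (xi s w * xi t w)%:E = (B (t - s))%:E)%E.
Hypothesis xi_var : B 0 = 1.
Hypothesis B_cvg0 : B m%:R @[m --> \oo] --> 0.

Lemma mean_cov_cvg0 (c : R) : 0 < c -> exists n0, forall n, (n0 < n)%N ->
  \sum_(m < n) `|B m%:R| <= c * n%:R.
Proof.
move=> c0.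
have : arithmetic_mean (fun m => `|B m%:R|) @ \oo --> (0 : R).
  by apply: cesaro; rewrite -(normr0 R); exact: cvg_norm.
move=> /cvgrPdist_le/(_ c c0)[n0 _ h]; exists n0 => -[//|n] n0n.
have := h n n0n; rewrite sub0r normrN /arithmetic_mean /series/= big_mkord.
move=> /(le_trans (ler_norm _)).
by rewrite mulrC ler_pdivrMr.
Qed.

Lemma measurable_process_cwave u phi :
  measurable_process (fun t w => cwave u phi (xi t w)).
Proof. exact: (measurableT_comp (measurable_cwave u phi) xi_meas). Qed.

(** The wave is sampled along a translate of the integers; the expected
    energy of the sample is of smaller order than n^3 because the mean
    covariance tends to 0. *)
Lemma negligible_cwave u phi : negligible_noise P (fun t w => cwave u phi (xi t w)).
Proof.
move=> eta delta eta0 delta0.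
pose h := eta / 4; have h0 : 0 < h by rewrite divr_gt0.
have h40 : 0 < h ^+ 4 by rewrite exprn_gt0.
have u0 : 0 < 96 * u ^+ 2 + 1 by rewrite ltr_wpDl// mulr_ge0// sqr_ge0.
have [n0 Bn0] := mean_cov_cvg0 (divr_gt0 (mulr_gt0 delta0 h40) u0).
exists (n0.+1%:R + h^-1) => [|T TT]; first by rewrite addr_gt0 ?invr_gt0.
have Tn0 : n0.+1%:R <= T by apply: le_trans TT; rewrite lerDl invr_ge0 ltW.
have Th : 1 <= h * T.
  by rewrite mulrC -ler_pdivrMr// mul1r; apply: le_trans TT; rewrite lerDr.
have T0 : 0 <= T by apply: le_trans Tn0.
set n := Num.truncn T.
have /andP[nT Tn] := truncn_itv T0.
have n0n : (n0 < n)%N.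
  by rewrite -ltnS -(ltr_nat R); apply: le_lt_trans Tn.
have ngt0 : (0 < n)%N by exact: leq_ltn_trans n0n.
have nr0 : 0 < n%:R :> R by rewrite ltr0n.
pose F s w := (2 * n)%:R / n%:R ^+ 4 *
  autocorr_energy n (fun k => cwave u phi (xi (k%:R + s) w)).
have cn0 : 0 <= (2 * n)%:R / n%:R ^+ 4 :> R by rewrite divr_ge0// exprn_ge0.
have mE : measurable_process
    (fun s w => autocorr_energy n (fun k => cwave u phi (xi (k%:R + s) w))).
  apply: (@measurable_autocorr_energy _ _ _ n
    (fun k (p : R * Omega) => cwave u phi (xi (k%:R + p.1) p.2))) => k.
  have mshift : measurable_fun [set: R * Omega] (fun p => (k%:R + p.1, p.2)).
    by apply/measurable_fun_pair => //; exact: measurable_funD.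
  exact: (measurableT_comp (measurable_process_cwave u phi) mshift).
have mF : measurable_process F by apply: measurable_funM => //; exact: measurable_cst.
have E0 s w : 0 <= autocorr_energy n (fun k => cwave u phi (xi (k%:R + s) w)).
  by apply: sumr_ge0 => i _; exact: sqr_ge0.
have F0 s w : 0 <= F s w by exact: mulr_ge0.
have FC s : (\int[P]_w (F s w)%:E <= (delta * h ^+ 4)%:E)%E.
  rewrite (_ : (fun w => (F s w)%:E) = fun w => (((2 * n)%:R / n%:R ^+ 4)%:E *
     (autocorr_energy n (fun k => cwave u phi (xi (k%:R + s) w)))%:E)%E); last first.
    by apply/funext => w; rewrite -EFinM.
  rewrite ge0_integralZl_EFin//; last exact: measurable_marginal mE.
  apply: le_trans (lee_wpmul2l _ (expected_energy xi_meas xi_gauss xi_mean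
    xi_cov xi_var n u phi s)) _; first by rewrite lee_fin.
  rewrite -EFinM lee_fin.
  have -> : (2 * n)%:R / n%:R ^+ 4 * (48 * u ^+ 2 * n%:R ^+ 2 * \sum_(m < n) `|B m%:R|)
     = 96 * u ^+ 2 * ((\sum_(m < n) `|B m%:R|) / n%:R).
    by rewrite natrM; field; rewrite gt_eqF.
  apply: (@le_trans _ _ ((96 * u ^+ 2 + 1) * (delta * h ^+ 4 / (96 * u ^+ 2 + 1)))).
    apply: ler_pM; rewrite ?lerDl//.
    - by rewrite mulr_ge0// sqr_ge0.
    - by rewrite divr_ge0// sumr_ge0.
    - by rewrite ler_pdivrMr// Bn0.
  by rewrite mulrC divfK// gt_eqF.
have [Bad [mB PB gB]] := tonelli_markov mF F0 FC ltr01 h40.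
exists Bad; split => //.
  by apply: le_trans PB _; rewrite lee_fin mulr1 mulfK// gt_eqF.
move=> w /gB [intF Fh].
have me : measurable_fun setT (fun t => cwave u phi (xi t w)).
  exact: (measurable_section _ (measurable_process_cwave u phi)).
have e2 t : `|cwave u phi (xi t w)| <= 2 by exact: norm_cwave_le.
split; first exact: bounded_integrable_itv me e2.
move=> l psi.
have mcos : measurable_fun setT (fun t : R => cos (l * t + psi)).
  by apply: continuous_measurable_fun; exact: continuous_cos_affine.
have mf : measurable_fun setT (fun t => cos (l * t + psi) * cwave u phi (xi t w)).
  exact: measurable_funM.
have f2 t : `|cos (l * t + psi) * cwave u phi (xi t w)| <= 2.
  by rewrite normrM -[leRHS]mul1r ler_pM// ler_norml cos_le1 cos_geN1.
rewrite (Rintegral_itv_split mf f2 (ler0n _ n) nT).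
apply: le_trans (ler_normD _ _) _.
(* the last block is incomplete, but the path is bounded by 2 *)
have A1 := Rintegral_blocks_le l psi ngt0 h0 me e2 intF (ltW Fh).
have A2 : `|\int[mu]_(t in `[n%:R, T]) (cos (l * t + psi) * cwave u phi (xi t w))| <= 2.
  have intf := bounded_integrable_itv n%:R T mf f2.
  apply: le_trans (le_normr_Rintegral _ intf) _ => //.
  apply: (@le_trans _ _ (\int[mu]_(t in `[n%:R, T]) 2)).
    apply: le_Rintegral => //; first exact: integrable_norm.
    by apply: continuous_integrable_itv; exact: cst_continuous.
  rewrite Rintegral_cst//= lebesgue_measure_itv/= lte_fin.
  case: ifP => _; last by rewrite mulr0.
  rewrite -EFinB/= -[leRHS]mulr1 ler_wpM2l// lerBlDl natr1.
  exact: ltW.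
apply: le_trans (lerD A1 A2) _.
have : 2 * h * n%:R <= 2 * h * T by rewrite ler_wpM2l// mulr_ge0// ltW.
have -> : eta = 4 * h by rewrite /h mulrC divfK.
move=> le_h; have -> : 4 * h * T = 2 * h * T + 2 * (h * T) by ring.
by apply: lerD => //; rewrite -[leLHS]mulr1 ler_pM2l.
Qed.

End negligible_wave.

(** * Transformations of the Gaussian process *)

Section gaussian_transform.
Context {R : realType} d {Omega : measurableType d} (P : probability Omega R).
Local Notation mu := (@lebesgue_measure R).
Local Notation TR := (measurableTypeR R).
Local Notation gam := (normal_prob 0 1 : {measure set TR -> \bar R}).
Variables (xi : R -> Omega -> R) (B : R -> R).
Hypothesis xi_meas : measurable_process xi.
Hypothesis xi_gauss : gaussian_process P xi.
Hypothesis xi_mean : forall t, ('E_P[xi t] = 0)%E.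
Hypothesis xi_cov : forall s t, (\int[P]_w (xi s w * xi t w)%:E = (B (t - s))%:E)%E.
Hypothesis xi_var : B 0 = 1.
Hypothesis B_cvg0 : B m%:R @[m --> \oo] --> 0.

Lemma standard_normal_law t (A : set TR) : measurable A ->
  pushforward P (xi t : Omega -> TR) A = gam A.
Proof.
have glaw : gaussian_law (pushforward P (xi t)).
  have := gaussian_lin xi_gauss [:: (1, t)].
  congr (gaussian_law (pushforward P _)); apply/funext => w.
  by rewrite /lin big_seq1 mul1r.
have mean0 : (\int[P]_w (xi t w)%:E = 0)%E by have := xi_mean t; rewrite unlock.
have var1 : (\int[P]_w (xi t w ^+ 2)%:E = 1%:E)%E.
  by rewrite -xi_var -(subrr t) -xi_cov; under eq_integral do rewrite expr2.
have [s [s0 s2 law]] := gaussian_law_centered (measurable_marginal t xi_meas)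
  glaw mean0 var1.
have s1 : s = 1 by apply/eqP; rewrite -sqrp_eq1// s2.
by move=> mA; rewrite [LHS](law A mA) s1 /normal_law oner_eq0.
Qed.

Lemma ge0_integral_normal (f : R -> R) t : measurable_fun setT f ->
  (forall x, 0 <= f x) ->
  (\int[P]_w (f (xi t w))%:E = \int[gam]_x (f x)%:E)%E.
Proof.
move=> mf f0.
have mt : measurable_fun setT (xi t : Omega -> TR) by exact: measurable_marginal.
transitivity (\int[pushforward P (xi t : Omega -> TR)]_x (f x)%:E)%E.
  rewrite (ge0_integral_pushforward mt)//.
    exact/measurable_EFinP.
  by move=> x _; rewrite lee_fin.
by apply: eq_measure_integral => A mA _; exact: standard_normal_law.
Qed.

Lemma integral_cwave u phi t : \int[P]_w cwave u phi (xi t w) = 0.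
Proof.
have linE w : lin xi [:: (u, t)] w = u * xi t w by rewrite /lin big_seq1.
have := integral_cos_lin xi_meas xi_gauss xi_mean xi_cov [:: (u, t)] phi.
have -> : lin_cov B [:: (u, t)] [:: (u, t)] = u ^+ 2.
  by rewrite /lin_cov !big_seq1 subrr xi_var mulr1.
under eq_Rintegral do rewrite linE.
move=> cosE; rewrite /cwave RintegralB//.
- by rewrite cosE Rintegral_cst//= probability_setT mulr1 subrr.
- apply: (@integrable_bounded_RV _ _ _ _ _ 1) => [|w].
    apply: (@measurableT_comp _ _ _ _ _ _ (fun x : R => cos (u * x + phi))).
      by apply: continuous_measurable_fun; exact: continuous_cos_affine.
    exact: measurable_marginal xi_meas.
  by rewrite ler_norml cos_le1 cos_geN1.
- apply: (@integrable_bounded_RV _ _ _ _ _ `|cos phi * expR (- (u ^+ 2 / 2))|) => //.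
Qed.

Definition centred_trig_poly l (x : R) : R :=
  \sum_(p <- l) p.1.1 * cwave p.1.2 p.2 x.

Lemma measurable_centred_trig_poly l : measurable_fun setT (centred_trig_poly l).
Proof.
apply: measurable_sum => p; apply: measurable_funM => //.
exact: measurable_cwave.
Qed.

Lemma centred_trig_polyE l : exists m, forall x, trig_poly l x = centred_trig_poly l x + m.
Proof.
exists (\sum_(p <- l) p.1.1 * (cos p.2 * expR (- (p.1.2 ^+ 2 / 2)))) => x.
rewrite /centred_trig_poly -big_split/=; apply: eq_bigr => p _.
by rewrite /cwave -mulrDr subrK.
Qed.

Lemma integral_centred_trig_poly l t :
  P.-integrable setT (EFin \o (fun w => centred_trig_poly l (xi t w))) /\
  \int[P]_w centred_trig_poly l (xi t w) = 0.
Proof.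
have int_p (p : R * R * R) : P.-integrable setT
    (EFin \o (fun w => p.1.1 * cwave p.1.2 p.2 (xi t w))).
  apply: (@integrable_bounded_RV _ _ _ _ _ (`|p.1.1| * 2)).
    by apply: measurable_funM => //; exact: measurable_cwave_xi.
  by move=> w; rewrite normrM ler_wpM2l// norm_cwave_le.
have [int_l ->] := @Rintegral_sum R _ _ P setT _ l
  (fun p w => p.1.1 * cwave p.1.2 p.2 (xi t w)) measurableT int_p.
split=> //; rewrite big1// => p _.
rewrite RintegralZl//; first by rewrite integral_cwave mulr0.
apply: (@integrable_bounded_RV _ _ _ _ _ 2); first exact: measurable_cwave_xi.
by move=> w; exact: norm_cwave_le.
Qed.

Lemma negligible_centred_trig_poly l :
  negligible_noise P (fun t w => centred_trig_poly l (xi t w)).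
Proof.
elim: l => [|p l IH].
  rewrite (_ : (fun t w => _) = fun _ _ => 0); first exact: negligible_noise0.
  by apply/funext => t; apply/funext => w; rewrite /centred_trig_poly big_nil.
rewrite (_ : (fun t w => _) = fun t w => p.1.1 * cwave p.1.2 p.2 (xi t w) +
    centred_trig_poly l (xi t w)).
  apply: negligible_noiseZ_add => //.
  exact: (negligible_cwave xi_meas xi_gauss xi_mean xi_cov xi_var B_cvg0).
by apply/funext => t; apply/funext => w; rewrite /centred_trig_poly big_cons.
Qed.

Section transform.
Variable G : R -> R.
Hypothesis G_meas : measurable_fun setT G.
Hypothesis G_sqr : (\int[P]_w (G (xi 0 w) ^+ 2)%:E < +oo)%E.
Hypothesis G_mean : (\int[P]_w (G (xi 0 w))%:E = 0)%E.

Lemma measurable_process_transform : measurable_process (fun t w => G (xi t w)).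
Proof. exact: (measurableT_comp G_meas xi_meas). Qed.

Lemma measurable_transform_sqr : measurable_fun setT (fun x => G x ^+ 2).
Proof. exact: measurable_funX. Qed.

Lemma transform_sqr t :
  (\int[P]_w (G (xi t w) ^+ 2)%:E = \int[gam]_x (G x ^+ 2)%:E)%E.
Proof.
apply: (ge0_integral_normal (f := fun x => G x ^+ 2)) => [|x].
  exact: measurable_transform_sqr.
exact: sqr_ge0.
Qed.

Lemma integrable_transform : P.-integrable setT (EFin \o (fun w => G (xi 0 w))).
Proof.
apply: integrable_sqr_RV; first exact: measurable_marginal measurable_process_transform.
apply/integrableP; split.
  apply/measurable_EFinP.
  exact: measurable_funX (measurable_marginal 0 measurable_process_transform).
under eq_integral do rewrite gee0_abs ?lee_fin ?sqr_ge0//.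
exact: G_sqr.
Qed.

(** Trigonometric polynomials are dense in L^1 of the Gaussian law. As G is
    centred, the mean of an approximating polynomial is small, and removing it
    leaves a combination of centred waves. *)
Lemma transform_approx delta : 0 < delta -> exists l, forall t,
  (\int[P]_w (`|G (xi t w) - centred_trig_poly l (xi t w)|)%:E <= delta%:E)%E.
Proof.
move=> delta0; have d2 : 0 < delta / 2 by rewrite divr_gt0.
have G2 : (\int[gam]_x (G x ^+ 2)%:E < +oo)%E by rewrite -(transform_sqr 0).
have [l Gl] := trig_dense G_meas G2 d2.
have [m mE] := centred_trig_polyE l; exists l => t.
have mc := measurable_centred_trig_poly l.
have mD : measurable_fun setT (fun x => `|G x - trig_poly l x|).
  apply: measurableT_comp => //; apply: measurable_funB => //.
  by apply: continuous_measurable_fun; exact: continuous_trig_poly.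
have dP s : (\int[P]_w (`|G (xi s w) - trig_poly l (xi s w)|)%:E <= (delta / 2)%:E)%E.
  by rewrite (ge0_integral_normal s mD).
have mcP s : measurable_fun setT (fun w => centred_trig_poly l (xi s w)).
  exact: (measurableT_comp mc (measurable_marginal s xi_meas)).
have mGP s : measurable_fun setT (fun w => G (xi s w)).
  exact: measurable_marginal measurable_process_transform.
have m_le : `|m| <= delta / 2.
  have [int_c Ec] := integral_centred_trig_poly l 0.
  have int_m : P.-integrable setT (EFin \o (fun _ : Omega => m)).
    by apply: (@integrable_bounded_RV _ _ _ _ _ `|m|).
  have int_cm : P.-integrable setT
      (EFin \o (fun w => centred_trig_poly l (xi 0 w) + m)).
    rewrite (_ : _ \o _ = fun w => ((centred_trig_poly l (xi 0 w))%:E + m%:E)%E).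
      exact: integrableD.
    by apply/funext => w; rewrite /= EFinD.
  have int_d : P.-integrable setT
      (EFin \o (fun w => G (xi 0 w) - (centred_trig_poly l (xi 0 w) + m))).
    rewrite (_ : _ \o _ = fun w =>
        ((G (xi 0 w))%:E - (centred_trig_poly l (xi 0 w) + m)%:E)%E).
      by apply: integrableB => //; exact: integrable_transform.
    by apply/funext => w; rewrite /= EFinB.
  have -> : m = - \int[P]_w (G (xi 0 w) - (centred_trig_poly l (xi 0 w) + m)).
    rewrite RintegralB//; last exact: integrable_transform.
    rewrite RintegralD// Ec Rintegral_cst//= probability_setT mulr1 add0r.
    by rewrite /Rintegral G_mean/= sub0r opprK.
  rewrite normrN; apply: le_trans (le_normr_Rintegral _ int_d) _ => //.
  rewrite -lee_fin; apply: le_trans (dP 0).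
  rewrite /Rintegral fineK; last exact/integrable_fin_num/integrable_norm.
  by under eq_integral do rewrite -mE.
apply: (@le_trans _ _ (\int[P]_w (`|G (xi t w) - trig_poly l (xi t w)| + `|m|)%:E)%E).
  apply: ge0_le_integral => //.
  - by apply/measurable_EFinP; apply: measurableT_comp => //; exact: measurable_funB.
  - apply/measurable_EFinP; apply: measurable_funD => //.
    exact: (measurableT_comp mD (measurable_marginal t xi_meas)).
  - move=> w _; rewrite lee_fin mE opprD addrA.
    by rewrite -[X in `|X| <= _](subrK m) ler_normD.
rewrite ge0_integralD_EFin//; last exact: (measurableT_comp mD (measurable_marginal t xi_meas)).
rewrite (splitr delta) EFinD; apply: leeD => //.
by rewrite integral_cst//= probability_setT mule1 lee_fin.
Qed.

Theorem negligible_transform : negligible_noise P (fun t w => G (xi t w)).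
Proof.
apply: negligible_noise_approx; first exact: measurable_process_transform.
move=> delta /transform_approx[l le_l].
exists (fun t w => centred_trig_poly l (xi t w)); split => //.
  exact: (measurableT_comp (measurable_centred_trig_poly l) xi_meas).
exact: negligible_centred_trig_poly.
Qed.

(** Only almost every path is square integrable; Markov's inequality bounds the
    expected energy on [0, T] off an event as small as needed. *)
Lemma sqr_integrable_path T delta : 0 < T -> 0 < delta -> exists Bad,
  [/\ measurable Bad, (P Bad <= delta%:E)%E & forall w, ~ Bad w ->
     mu.-integrable `[0, T] (EFin \o (fun t => G (xi t w) ^+ 2))].
Proof.
move=> T0 delta0.
have m2 : measurable_process (fun t w => G (xi t w) ^+ 2).
  exact: measurable_funX measurable_process_transform.
pose C := fine (\int[P]_w (G (xi 0 w) ^+ 2)%:E)%E.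
have CE t : (\int[P]_w (G (xi t w) ^+ 2)%:E <= C%:E)%E.
  rewrite transform_sqr -(transform_sqr 0) fineK// ge0_fin_numE//.
  by apply: integral_ge0 => w _; rewrite lee_fin sqr_ge0.
have C0 : 0 <= C by apply: fine_ge0; apply: integral_ge0 => w _; rewrite lee_fin sqr_ge0.
have a0 : 0 < (C * T + 1) / delta by rewrite divr_gt0// ltr_wpDl// mulr_ge0// ltW.
have [Bad [mB PB gB]] := tonelli_markov m2 (fun _ _ => sqr_ge0 _) CE T0 a0.
exists Bad; split => // [|w /gB[]//].
apply: le_trans PB _; rewrite lee_fin invf_div mulrCA -[leRHS]mulr1.
rewrite ler_wpM2l ?(ltW delta0)// ler_pdivrMr ?mul1r ?lerDl//.
by rewrite ltr_wpDl// mulr_ge0// ltW.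
Qed.

End transform.
End gaussian_transform.

(** * The covariance function *)

Section covariance_function.
Context {R : realType}.

Lemma covB0 kappa (D kap alpha : 'I_kappa.+1 -> R) :
  \sum_(j < kappa.+1) D j = 1 -> covB D kap alpha 0 = 1.
Proof.
move=> <-; apply: eq_bigr => j _.
by rewrite mulr0 cos0 expr0n addr0 powR1 divr1 mulr1.
Qed.

Lemma powR_decay (alpha : R) : 0 < alpha ->
  ((1 + m%:R ^+ 2) `^ alpha)^-1 @[m --> \oo] --> (0 : R).
Proof.
move=> alpha0; apply/cvgrPdist_le => e e0.
exists (Num.truncn (e^-1 `^ alpha^-1)).+1 => // m /= ltm.
have e10 : 0 <= e^-1 by rewrite invr_ge0 ltW.
rewrite sub0r normrN ger0_norm ?invr_ge0 ?powR_ge0//.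
rewrite -[leRHS]invrK lef_pV2 ?posrE ?invr_gt0 ?powR_gt0 ?ltr_pwDl ?sqr_ge0//.
have -> : e^-1 = (e^-1 `^ alpha^-1) `^ alpha.
  by rewrite -powRrM mulVf ?gt_eqF// powRr1.
have lem : e^-1 `^ alpha^-1 <= m%:R.
  apply/ltW/(lt_le_trans (truncnS_gt _)); by rewrite ler_nat.
rewrite ge0_ler_powR ?nnegrE ?powR_ge0 ?(ltW alpha0)//.
apply: le_trans lem _; rewrite -natrX -[1]/(1%:R) -natrD ler_nat.
by nia.
Qed.

Lemma cvg_sum0 I (r : seq I) (f : I -> R^nat) :
  (forall i, f i @ \oo --> (0 : R)) ->
  (fun m => \sum_(i <- r) f i m : R) @ \oo --> (0 : R).
Proof.
move=> f0; elim: r => [|i r IH].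
  by rewrite (_ : (fun m => _) = cst 0); [exact: cvg_cst|apply/funext => m; rewrite big_nil].
rewrite (_ : (fun m => _) = (fun m => f i m + \sum_(j <- r) f j m : R)).
  by rewrite -[X in _ --> X]addr0; exact: cvgD.
by apply/funext => m; rewrite big_cons.
Qed.

Lemma covB_cvg0 kappa (D kap alpha : 'I_kappa.+1 -> R) :
  (forall j, 0 < alpha j) -> covB D kap alpha m%:R @[m --> \oo] --> (0 : R).
Proof.
move=> alpha0; rewrite /covB.
pose f j (m : nat) : R := D j * (cos (kap j * m%:R) / (1 + m%:R ^+ 2) `^ (alpha j / 2)).
have f0 j : f j m @[m --> \oo] --> (0 : R).
  rewrite -(mulr0 (D j)); apply: cvgMl_tmp; apply/norm_cvg0P.
  have h := powR_decay (divr_gt0 (alpha0 j) (ltr0Sn R 1)).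
  apply: (squeeze_cvgr _ (cvg_cst 0) h).
  apply: nearW => m; rewrite normr_ge0/= normrM -[leRHS]mul1r ler_pM//.
    by rewrite ler_norml cos_le1 cos_geN1.
  by rewrite normfV ger0_norm// powR_ge0.
exact: (@cvg_sum0 _ (index_enum 'I_kappa.+1) f f0).
Qed.

End covariance_function.

Section stationary_covariance.
Context {R : realType} d {Omega : measurableType d} (P : probability Omega R).
Variable xi : R -> Omega -> R.
Hypothesis xi_meas : measurable_process xi.
Hypothesis xi_stat : strictly_stationary P xi.
Hypothesis xi_var : forall t, ('E_P[(fun w => xi t w ^+ 2)%R] = 1)%E.

Lemma integrable_product s t : P.-integrable setT (EFin \o (fun w => xi s w * xi t w)).
Proof.
have sqr_int u : P.-integrable setT (EFin \o (fun w => xi u w ^+ 2)).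
  apply: (@integrable_of_integral_fin _ _ _ _ _ 1).
  - exact: measurable_funX (measurable_marginal u xi_meas).
  - by move=> w; exact: sqr_ge0.
  - by have := xi_var u; rewrite unlock.
by apply: integrable_mul_RV; first [exact: measurable_marginal|exact: sqr_int].
Qed.

Lemma stationary_covariance s t :
  (\int[P]_w (xi s w * xi t w)%:E = \int[P]_w (xi 0 w * xi (t - s) w)%:E)%E.
Proof.
pose prod2 (v : 2.-tuple R) := tnth v ord0 * tnth v ord_max.
have mprod : measurable_fun setT prod2.
  by apply: measurable_funM; exact: measurable_tnth.
have mfdd (u : 2.-tuple R) : measurable_fun setT (fdd_vector xi u).
  apply/measurable_fun_tnthP => i; rewrite (_ : _ \o _ = xi (tnth u i)).
    exact: measurable_marginal.
  by apply/funext => w; rewrite /fdd_vector /= tnth_mktuple.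
have fddE (u : 2.-tuple R) w :
    prod2 (fdd_vector xi u w) = xi (tnth u ord0) w * xi (tnth u ord_max) w.
  by rewrite /prod2 /fdd_vector !tnth_mktuple.
have transfer (u : 2.-tuple R) :
    (\int[pushforward P (fdd_vector xi u)]_v (prod2 v)%:E =
     \int[P]_w (xi (tnth u ord0) w * xi (tnth u ord_max) w)%:E)%E.
  rewrite (integral_pushforward (mfdd u) (f := EFin \o prod2))//.
  - by apply: eq_integral => w _ /=; rewrite fddE.
  - exact/measurable_EFinP.
  rewrite preimage_setT (_ : _ \o _ = (EFin \o (fun w =>
      xi (tnth u ord0) w * xi (tnth u ord_max) w))).
    exact: integrable_product.
  by apply/funext => w /=; rewrite fddE.
pose u := [tuple 0; t - s].
have := transfer u; have := transfer [tuple tnth u i + s | i < 2].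
rewrite !tnth_mktuple !(tnth_nth 0)/= add0r subrK => <- <-.
by apply: eq_measure_integral => A mA _; exact: xi_stat.
Qed.

End stationary_covariance.

(** * Walker systems and consistency *)

Section walker_systems.
Context {R : realType} (N : nat).

Lemma closed_sep (T K : R) : closed [set phi : 'rV[R]_N | sep T K phi].
Proof.
have cT (f : 'rV[R]_N -> R) : continuous f -> closed [set phi | K <= f phi].
  move=> cf; apply: (@closed_comp _ _ f [set x | K <= x]); last exact: closed_ge.
  by move=> x _; exact: cf.
have ck k : continuous (fun phi : 'rV[R]_N => phi 0 k) by exact: coord_continuous.
have -> : [set phi : 'rV[R]_N | sep T K phi] =
  (\bigcap_(p in [set p : 'I_N * 'I_N | (p.1 < p.2)%N])
     [set phi | K <= T * (phi 0 p.2 - phi 0 p.1)]) `&`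
  (\bigcap_(k in [set: 'I_N]) [set phi | K <= T * phi 0 k]).
  apply/seteqP; split => phi /=.
    by case=> gap coord; split=> [[j k] /= jk|k _]; [exact: gap|exact: coord].
  by case=> gap coord; split=> [j k jk|k]; [exact: (gap (j, k))|exact: coord].
apply: closedI; apply: closed_bigI => p _; apply: cT => phi.
  exact: (continuousM (@cst_continuous _ _ T phi)
            (continuousB (ck p.2 phi) (ck p.1 phi))).
exact: (continuousM (@cst_continuous _ _ T phi) (ck p phi)).
Qed.

(** The separation conditions are closed, so they pass from S_T to its closure,
    where the estimator takes its values. *)
Lemma walker_sep hN lo hi phi0 T0 (S : R -> set 'rV[R]_N) K :
  0 < T0 -> walker_system hN lo hi phi0 T0 S ->
  exists2 T1, T0 < T1 & forall T, T1 <= T ->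
    forall phi, closure (S T) phi -> sep T K phi.
Proof.
move=> T00 [S_open _ /cvgeyPge/(_ K) [M1 [_ gap]] /cvgeyPge/(_ K) [M2 [_ coord]]].
exists (Num.max T0 (Num.max M1 M2) + 1).
  by rewrite ltr_pwDr// le_max lexx.
move=> T TT.
have lt_T : [/\ T0 < T, M1 < T & M2 < T].
  have : Num.max T0 (Num.max M1 M2) < T by apply: lt_le_trans TT; rewrite ltrDl.
  by rewrite !gt_max => /and3P[].
case: lt_T => T0T /gap gapT /coord coordT.
have T_gt0 : 0 < T by exact: lt_trans T0T.
have [_ S_reg _] := S_open T T0T.
have S_sep : S T `<=` [set phi | sep T K phi].
  move=> phi Sphi.
  have coord0 : K <= T * phi 0 (Ordinal hN).
    rewrite -lee_fin; apply: le_trans coordT _.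
    by apply: ereal_inf_lbound; exists phi.
  split=> [j k jk|k].
    rewrite -lee_fin; apply: le_trans gapT _.
    by apply: ereal_inf_lbound; exists j, k, phi.
  apply: le_trans coord0 _; rewrite ler_pM2l//.
  have [k0|k0] := posnP k.
    by rewrite (_ : Ordinal hN = k)//; exact: val_inj.
  by apply: ltW; apply: (S_reg _ Sphi).2.
move=> phi /(closureS S_sep).
by rewrite -((closure_id _).1 (@closed_sep T K)).
Qed.

End walker_systems.

Section consistency.
Context {R : realType} d {Omega : measurableType d} (P : probability Omega R).
Local Notation mu := (@lebesgue_measure R).

Lemma cvg_in_probability_bad (X : R -> Omega -> R) (c T0 : R) :
  (forall T, T0 < T -> measurable_fun setT (X T)) ->
  (forall e delta, 0 < e -> 0 < delta -> exists T1, forall T, T1 <= T ->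
    exists Bad, [/\ measurable Bad, (P Bad <= delta%:E)%E &
      forall w, ~ Bad w -> `|X T w - c| < e]) ->
  cvg_in_probability P X c.
Proof.
move=> mX bad e e0.
have mE T : T0 < T -> measurable [set w | e <= `|X T w - c|].
  move=> /mX mXT.
  have mD : measurable_fun setT (fun w => `|X T w - c|).
    by apply: measurableT_comp => //; apply: measurable_funB.
  by rewrite -[X in measurable X]setTI; exact: measurable_fun_le.
apply/fine_cvgP; split.
  exists T0; split; first exact: num_real.
  by move=> T /mE mT; exact: fin_num_measure.
apply/cvgrPdist_le => delta delta0.
have [T1 h] := bad e delta e0 delta0.
exists (Num.max T0 T1); split; first exact: num_real.
move=> T; rewrite gt_max => /andP[T0T T1T].
have [Bad [mB PB gB]] := h T (ltW T1T).
rewrite sub0r normrN ger0_norm ?fine_ge0//.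
rewrite -lee_fin fineK; last exact: fin_num_measure (mE T T0T).
apply: le_trans PB; apply: le_measure; rewrite ?inE//; first exact: mE.
move=> w /= ew; apply: contrapT => /gB.
by rewrite ltNge ew.
Qed.

(** The true parameter competes in the infimum, where its criterion is finite
    because the noise path is square integrable; hence so is the minimum. *)
Lemma walker_lse_le N (theta : param R N) (S : set 'rV[R]_N) (T : R)
    (eps : R -> R) (tau : param R N) : 0 < T -> S (freq theta) ->
  mu.-integrable `[0, T] (EFin \o (fun t => eps t ^+ 2)) ->
  measurable_fun setT eps ->
  lsq (fun t => trig_sum t theta + eps t) T tau =
    ereal_inf (lsq (fun t => trig_sum t theta + eps t) T @` param_closure S) ->
  \int[mu]_(t in `[0, T]) (trig_sum t theta + eps t - trig_sum t tau) ^+ 2 <=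
  \int[mu]_(t in `[0, T]) eps t ^+ 2.
Proof.
move=> T0 Stheta ieps meps lse.
pose x t := trig_sum t theta + eps t.
have : (lsq x T tau <= lsq x T theta)%E.
  rewrite lse; apply: ereal_inf_lbound; exists theta => //.
  exact: subset_closure.
rewrite /lsq lee_pmul2l//; last by rewrite lte_fin invr_gt0.
have -> : (\int[mu]_(t in `[0%R, T]) ((trig_sum t theta + eps t - trig_sum t theta) ^+ 2)%:E
  = \int[mu]_(t in `[0%R, T]) (eps t ^+ 2)%:E)%E.
  by apply: eq_integral => t _; rewrite addrC addKr.
have fin_eps := integrable_fin_num _ ieps.
move=> le_int; rewrite /Rintegral fine_le//; last exact: fin_eps.
rewrite ge0_fin_numE; last by apply: integral_ge0 => t _; rewrite lee_fin sqr_ge0.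
by apply: le_lt_trans le_int _; rewrite ltey_eq fin_eps.
Qed.

End consistency.

Lemma integral_sqr_lty (R : realType) d (Omega : measurableType d)
    (P : probability Omega R) (Z : Omega -> R) : measurable_fun setT Z ->
  ('E_P[(fun w => Z w ^+ 4)%R] < +oo)%E -> (\int[P]_w (Z w ^+ 2)%:E < +oo)%E.
Proof.
move=> mZ; rewrite unlock => Z4.
have m4 : measurable_fun setT (fun w => Z w ^+ 4) by exact: measurable_funX.
have ge0 w : 0 <= Z w ^+ 4 by rewrite -[4%N]/(2 * 2)%N exprM sqr_ge0.
apply: (@le_lt_trans _ _ (\int[P]_w (1 + Z w ^+ 4)%:E)%E).
  apply: ge0_le_integral => //.
  - by move=> w _; rewrite lee_fin sqr_ge0.
  - by apply/measurable_EFinP; exact: measurable_funX.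
  - by apply/measurable_EFinP; exact: measurable_funD.
  move=> w _; rewrite lee_fin -[4%N]/(2 * 2)%N exprM.
  by have := sqr_ge0 (Z w ^+ 2 - 1); have := sqr_ge0 (Z w); rewrite sqrrB1; lra.
rewrite ge0_integralD_EFin//.
by rewrite integral_cst//= probability_setT mule1 lte_add_pinfty ?ltry.
Qed.

Theorem theorem1 (R : realType) (d : measure_display)
  (Omega : measurableType d) (P : probability Omega R)
  (* the Gaussian process and its covariance *)
  (xi : R -> Omega -> R)
  (kappa : nat) (D kap alpha : 'I_kappa.+1 -> R)
  (xi_meas : measurable_process xi)
  (xi_msc : ms_continuous P xi)
  (xi_stat : strictly_stationary P xi)
  (xi_gauss : gaussian_process P xi)
  (xi_mean : forall t, 'E_P[xi t]%E = 0%E)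
  (xi_var : forall t, 'E_P[(fun w => xi t w ^+ 2)%R]%E = 1%E)
  (xi_cov : forall t,
     'E_P[(fun w => xi 0 w * xi t w)%R]%E = (covB D kap alpha t)%:E)
  (D_ge0 : forall j, 0 <= D j)
  (D_sum : \sum_(j < kappa.+1) D j = 1)
  (kap_ge0 : 0 <= kap ord0)
  (kap_incr : forall i j : 'I_kappa.+1, (i < j)%N -> kap i < kap j)
  (alpha_gt0 : forall j, 0 < alpha j)
  (* the transformation G *)
  (G : R -> R)
  (G_meas : measurable_fun [set: R] G)
  (G_mean : 'E_P[(fun w => G (xi 0 w))%R]%E = 0%E)
  (G_mom4 : ('E_P[(fun w => G (xi 0 w) ^+ 4)%R] < +oo)%E)
  (* the true parameter *)
  (N : nat) (hN : (0 < N)%N) (lo hi : R) (lo_ge0 : 0 <= lo)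
  (theta : param R N)
  (theta_amp : forall k, 0 < amp_cos theta 0 k ^+ 2 + amp_sin theta 0 k ^+ 2)
  (theta_freq : freq_region lo hi (freq theta))
  (* the estimator *)
  (T0 : R) (T0_gt0 : 0 < T0)
  (S : R -> set 'rV[R]_N)
  (S_walker : walker_system hN lo hi (freq theta) T0 S)
  (theta_hat : R -> Omega -> param R N)
  (theta_hat_lse : forall T, T0 < T ->
     walker_lse (fun t w => trig_sum t theta + G (xi t w)) T (S T)
       (theta_hat T)) :
  forall k : 'I_N,
    [/\ cvg_in_probability P (fun T w => amp_cos (theta_hat T w) 0 k)
          (amp_cos theta 0 k),
        cvg_in_probability P (fun T w => amp_sin (theta_hat T w) 0 k)
          (amp_sin theta 0 k)
      & cvg_in_probability P
          (fun T w => T * (freq (theta_hat T w) 0 k - freq theta 0 k)) 0].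
Proof.
have covE s t : (\int[P]_w (xi s w * xi t w)%:E = (covB D kap alpha (t - s))%:E)%E.
  rewrite (stationary_covariance xi_meas xi_stat xi_var).
  by rewrite -xi_cov unlock.
have covB_0 := covB0 kap alpha D_sum.
have covB_cvg := covB_cvg0 D kap alpha_gt0.
have Gmean : (\int[P]_w (G (xi 0 w))%:E = 0)%E by have := G_mean; rewrite unlock.
have Gsqr : (\int[P]_w (G (xi 0 w) ^+ 2)%:E < +oo)%E.
  exact: integral_sqr_lty (measurable_marginal 0 (measurable_process_transform xi_meas G_meas)) G_mom4.
have noise := negligible_transform xi_meas xi_gauss xi_mean covE covB_0 covB_cvg
  G_meas Gsqr Gmean.
have main e delta : 0 < e -> 0 < delta -> exists T1, forall T, T1 <= T ->
    exists Bad, [/\ measurable Bad, (P Bad <= delta%:E)%E & forall w, ~ Bad w ->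
      forall k, [/\ `|amp_cos (theta_hat T w) 0 k - amp_cos theta 0 k| < e,
        `|amp_sin (theta_hat T w) 0 k - amp_sin theta 0 k| < e &
        `|T * (freq (theta_hat T w) 0 k - freq theta 0 k)| < e]].
  move=> e0 delta0; have d2 : 0 < delta / 2 by rewrite divr_gt0.
  have [eta [K [eta0 K0 identify]]] := lse_identification theta_amp e0.
  have [T1 T01 sepT] := walker_sep K T0_gt0 S_walker.
  have [T2 T20 noiseT] := noise _ _ eta0 d2.
  exists (T1 + T2) => T TT.
  have T1T : T1 <= T by apply: le_trans TT; rewrite lerDl ltW.
  have T2T : T2 <= T.
    by apply: le_trans TT; rewrite lerDr ltW// (lt_trans T0_gt0).
  have T0T : T0 < T by exact: lt_le_trans T1T.
  have T_gt0 : 0 < T by exact: lt_trans T0T.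
  have [Bad1 [mB1 PB1 g1]] := noiseT T T2T.
  have [Bad2 [mB2 PB2 g2]] := sqr_integrable_path xi_meas xi_gauss xi_mean covE
    covB_0 G_meas Gsqr T_gt0 d2.
  have [_ _ _ hat_region hat_min] := theta_hat_lse T T0T.
  have [S_open _ _ _] := S_walker; have [_ _ S_theta] := S_open T T0T.
  exists (Bad1 `|` Bad2); split; first exact: measurableU.
    apply: le_trans (measureU2 _ mB1 mB2) _.
    by rewrite (splitr delta) EFinD; exact: leeD.
  move=> w /not_orP[/g1[ieps small] /g2 ieps2].
  apply: (identify T (theta_hat T w) (fun t => G (xi t w))) => //.
  - exact: sepT (hat_region w).
  - by apply: sepT => //; exact: subset_closure.
  apply: walker_lse_le (hat_min w) => //.
  exact: measurable_section (measurable_process_transform xi_meas G_meas).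
have meas T : T0 < T -> walker_lse (fun t w => trig_sum t theta + G (xi t w)) T (S T)
  (theta_hat T) by exact: theta_hat_lse.
move=> k; split; apply: (@cvg_in_probability_bad _ _ _ _ _ _ T0).
- by move=> T /meas[].
- move=> e delta e0 delta0; have [T1 h] := main e delta e0 delta0.
  exists T1 => T /h[Bad [mB PB gB]]; exists Bad; split => // w /gB/(_ k).
  by case.
- by move=> T /meas[].
- move=> e delta e0 delta0; have [T1 h] := main e delta e0 delta0.
  exists T1 => T /h[Bad [mB PB gB]]; exists Bad; split => // w /gB/(_ k).
  by case.
- move=> T /meas[_ _ mfreq _ _].
  by apply: measurable_funM => //; apply: measurable_funB.
- move=> e delta e0 delta0; have [T1 h] := main e delta e0 delta0.
  exists T1 => T /h[Bad [mB PB gB]]; exists Bad; split => // w /gB/(_ k).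
  by case; rewrite subr0.
Qed.
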